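(* Let $(\Omega_C,\mathbf{g})$ denote the maximal globally hyperbolic development, with its acoustical metric, of the initial value problem $$-\partial_t^2\Phi-(\partial_t\Phi-2\partial_x\Phi)\,\partial_t\partial_x\Phi+2\big(2+(\partial_t\Phi-2\partial_x\Phi)\big)\partial_x^2\Phi=0,\qquad \big(\Phi(0,x),\partial_t\Phi(0,x)\big)=(0,-\arctan(x)),$$ and let $\mathbf{g}$ also denote the continuous extension of the acoustical metric to the closure $\mathrm{cl}(\Omega_C)$. Then any point $p$ of the singular boundary $\mathcal{B}$ has a causal bubble with respect to the extended acoustical metric $\mathbf{g}$; that is, $J^-(p,\mathrm{cl}(\Omega_C))\setminus I^-(p,\mathrm{cl}(\Omega_C))$ has non-empty interior.
   Context: Points of $\mathbb{R}^{1+1}$ are written $(t,x)$. Put $\Psi:=\partial_t\Phi-2\partial_x\Phi$. The acoustical metric is $$\mathbf{g}=-\frac{8(2+\Psi)}{(4+\Psi)^2}\,dt^2-\frac{2\Psi}{(4+\Psi)^2}\,(dt\otimes dx+dx\otimes dt)+\frac{4}{(4+\Psi)^2}\,dx^2,$$ and $L:=\partial_t+(2+\Psi)\partial_x$, $\underline{L}:=\partial_t-2\partial_x$ are $\mathbf{g}$-null. A globally hyperbolic development is a pair $(\Omega,\Phi)$ with $\Omega\supset\{t=0\}\times\mathbb{R}$ open and $\Phi$ a smooth solution on $\Omega$ attaining the data, such that every inextendible $\mathbf{g}$-timelike $C^1$ curve in $\Omega$ meets $\{t=0\}$ exactly once; it is maximal if it cannot be extended to a strictly larger one. The initial value problem has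 a unique maximal globally hyperbolic development $(\Omega_C,\Phi_C)$. Explicitly, with $\Psi_0(x)=-\arctan x$ and $\gamma_{x_0}(t)=(t,x_0+t(2+\Psi_0(x_0)))$, $$\Omega_C=\bigcup_{x_0>0}\{\gamma_{x_0}(t): t<1+x_0^2\}\ \cup\ \bigcup_{x_0\le0}\Big\{\gamma_{x_0}(t): t<\tfrac{4-x_0}{4+\Psi_0(x_0)}\Big\},$$ and $\Psi_C:=\partial_t\Phi_C-2\partial_x\Phi_C$ takes the constant value $\Psi_0(x_0)$ along $\gamma_{x_0}$ in $\Omega_C$. The boundary of $\Omega_C$ is the disjoint union of $\mathcal{S}=(1,2)$ (initial singularity), the singular boundary $\mathcal{B}=\{(1+z^2,\,(2-\arctan z)(1+z^2)+z): z>0\}$, and the Cauchy horizon $\underline{\mathcal{C}}=\{(t,x):t>1,\ x=4-2t\}$. $\Psi_C$, and hence $\mathbf{g}$ and $L$, extend continuously to $\mathrm{cl}(\Omega_C)$. A nonzero vector $X$ at a point of $\mathrm{cl}(\Omega_C)$ is timelike if $\mathbf{g}(X,X)<0$ and causal if $\mathbf{g}(X,X)\le0$. The timelike vectors at a point form a disconnected double cone; the future component is the one whose closure contains $L$ and $\underline{L}$, the other is the past component. A nonzero causal vector lying in the closure of the past component is past directed causal; a timelike vector in the past component is past directed timelike. A piecewise $C^1$-regular curve in $\mathrm{cl}(\Omega_C)$ is past directed timelike (causal) if its tangent vectors are. For $p\in\mathrm{cl}(\Omega_C)$, $I^-(p,\mathrm{cl}(\Omega_C))$ (resp. $J^-(p,\mathrm{cl}(\Omega_C))$)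 is the set of all $q\in\mathrm{cl}(\Omega_C)$ such that there is a past directed timelike (resp. causal) piecewise $C^1$ curve in $\mathrm{cl}(\Omega_C)$ from $p$ to $q$. *)

(* Defs.v *)
From mathcomp Require Import all_boot all_order all_algebra.
From mathcomp Require Import all_classical all_reals all_analysis.

Set Implicit Arguments.
Unset Strict Implicit.
Unset Printing Implicit Defensive.

Import Order.TTheory GRing.Theory Num.Theory.
Import numFieldNormedType.Exports.

Local Open Scope classical_set_scope.
Local Open Scope ring_scope.

(* Points of R^{1+1} and tangent vectors are pairs (t, x). *)

Section Calculus.
Variable R : realType.
Implicit Types (Omega : set (R * R)) (f Phi : R * R -> R).

Definition dt f : R * R -> R := fun p => 'D_((1, 0) : R * R) f p.
Definition dx f : R * R -> R := fun p => 'D_((0, 1) : R * R) f p.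

Fixpoint partials (w : seq bool) f : R * R -> R :=
  if w is b :: w' then (if b then dt else dx) (partials w' f) else f.

(* C^oo on the open set Omega: all iterated partial derivatives are Frechet
   differentiable, hence continuous, at every point of Omega. *)
Definition smooth_on Omega f : Prop :=
  forall (w : seq bool) (p : R * R), Omega p -> differentiable (partials w f) p.

(* C^1 curve on an interval I with velocity v; the difference quotients are
   taken inside I, so derivatives are one-sided at the endpoints I contains. *)
Definition C1_curve (I : set R) (c v : R -> R * R) : Prop :=
  {within I, continuous v} /\
  forall s, I s -> (s' - s)^-1 *: (c s' - c s) @[s' --> within I s^'] --> v s.

End Calculus.

Section Metric.
Variable R : realType.
Implicit Types (psi : R) (X Y : R * R).

(* The acoustical metric at a point where Psi takes the value psi. *)
Definition acoustical_metric psi X Y : R :=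
  - (8 * (2 + psi) / (4 + psi) ^+ 2) * (X.1 * Y.1)
  - (2 * psi / (4 + psi) ^+ 2) * (X.1 * Y.2 + X.2 * Y.1)
  + (4 / (4 + psi) ^+ 2) * (X.2 * Y.2).

Definition vecL psi : R * R := (1, 2 + psi).
Definition vecLbar : R * R := (1, - 2).

Definition timelike psi : set (R * R) :=
  [set X | X != 0 /\ acoustical_metric psi X X < 0].
Definition causal psi : set (R * R) :=
  [set X | X != 0 /\ acoustical_metric psi X X <= 0].

(* The connected component of the timelike double cone whose closure contains
   both L and Lbar. *)
Definition future_timelike psi : set (R * R) :=
  [set X | timelike psi X /\
    let C := connected_component (timelike psi) X in
    closure C (vecL psi) /\ closure C vecLbar].

Definition past_timelike psi : set (R * R) :=
  timelike psi `\` future_timelike psi.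
Definition past_causal psi : set (R * R) :=
  causal psi `&` closure (past_timelike psi).

End Metric.

Section Development.
Variable R : realType.
Implicit Types (Omega : set (R * R)) (Phi : R * R -> R).

Definition Psi Phi : R * R -> R := fun p => dt Phi p - 2 * dx Phi p.

Definition wave_equation Phi (p : R * R) : Prop :=
  - dt (dt Phi) p - Psi Phi p * dt (dx Phi) p
  + 2 * (2 + Psi Phi p) * dx (dx Phi) p = 0.

Definition initial_data Phi : Prop :=
  forall x : R, Phi (0, x) = 0 /\ dt Phi (0, x) = - atan x.

(* Endpoints of a curve at the upper, resp. lower, end of its parameter
   interval; they need not be attained. *)
Definition upper_endpoint (I : set R) (c : R -> R * R) (q : R * R) : Prop :=
  forall U, nbhs q U ->
    exists2 s0, I s0 & forall s, I s -> s0 <= s -> U (c s).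
Definition lower_endpoint (I : set R) (c : R -> R * R) (q : R * R) : Prop :=
  forall U, nbhs q U ->
    exists2 s0, I s0 & forall s, I s -> s <= s0 -> U (c s).

(* Inextendibility means having no endpoint in Omega. Not being extendible as
   a C^1 timelike curve would be too weak: a timelike curve may become null at
   an endpoint in Omega. *)
Definition inextendible_timelike Omega Phi (I : set R) (c : R -> R * R) :=
  [/\ I !=set0 /\ open I /\ is_interval I,
      forall s, I s -> Omega (c s),
      exists v, C1_curve I c v /\
        forall s, I s -> timelike (Psi Phi (c s)) (v s)
    & forall q, Omega q -> ~ upper_endpoint I c q /\ ~ lower_endpoint I c q].

(* The condition 4 + Psi != 0 says that the acoustical metric is defined
   on Omega. *)
Definition globally_hyperbolic_development Omega Phi : Prop :=
  [/\ open Omega /\ (forall x, Omega (0, x)),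
      smooth_on Omega Phi,
      (forall p, Omega p -> wave_equation Phi p) /\ initial_data Phi,
      forall p, Omega p -> 4 + Psi Phi p != 0
    & forall I c, inextendible_timelike Omega Phi I c ->
        exists! s, I s /\ (c s).1 = 0].

Definition maximal_globally_hyperbolic_development Omega Phi : Prop :=
  globally_hyperbolic_development Omega Phi /\
  forall Omega' Phi', globally_hyperbolic_development Omega' Phi' ->
    Omega `<=` Omega' -> (forall p, Omega p -> Phi' p = Phi p) ->
    Omega' = Omega.

(* The continuous extension of Psi to the closure of Omega. *)
Definition Psi_ext Omega Phi : R * R -> R :=
  fun p => lim (Psi Phi q @[q --> within Omega (nbhs p)]).

(* q is reached from p by a piecewise C^1 curve in the closure of Omega whose
   velocity at c s, on each (closed) piece, lies in cone (Psi_ext (c s)). *)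
Definition piecewise_C1_reachable (cone : R -> set (R * R)) Omega Phi
    (p q : R * R) : Prop :=
  exists (n : nat) (tau : nat -> R) (c : R -> R * R),
    [/\ (0 < n)%N /\ (forall i, (i < n)%N -> tau i < tau i.+1),
        c (tau 0%N) = p /\ c (tau n) = q,
        forall s, s \in `[tau 0%N, tau n] -> closure Omega (c s)
      & forall i, (i < n)%N ->
          exists v, C1_curve `[tau i, tau i.+1]%classic c v /\
            forall s, s \in `[tau i, tau i.+1] ->
              cone (Psi_ext Omega Phi (c s)) (v s)].

Definition chronological_past Omega Phi (p : R * R) : set (R * R) :=
  [set q | piecewise_C1_reachable (@past_timelike R) Omega Phi p q].
Definition causal_past Omega Phi (p : R * R) : set (R * R) :=
  [set q | piecewise_C1_reachable (@past_causal R) Omega Phi p q].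

Definition causal_bubble Omega Phi (p : R * R) : Prop :=
  interior (causal_past Omega Phi p `\` chronological_past Omega Phi p)
    !=set0.

Definition singular_boundary : set (R * R) :=
  [set (1 + z ^+ 2, (2 - atan z) * (1 + z ^+ 2) + z) | z in [set z : R | 0 < z]].

End Development.

(* Main.v *)
From HB Require Import structures.
From mathcomp Require Import all_boot all_order all_algebra.
From mathcomp Require Import all_classical all_reals all_analysis.
From mathcomp Require Import ring lra.
Require Import Defs.

(** The proof has three parts: every development is contained in an explicit
    one, the explicit one is a development, so that a maximal development is
    the explicit one, and the explicit one has the bubbles.

    In the coordinates [t] and [u = x + 2 t] the acoustical metric is a
    positive multiple of [du (du - w dt)], where [w = 4 + Psi].  Where [w] is
    positive, timelike curves are therefore the graphs [u = f t] with
    [0 < f' < w], and the null directions are the slopes [0] and [w].  Since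
    second derivatives commute, the wave equation says that [Psi] is constant
    along [L]; hence the integral curves of [L] are straight lines, the
    characteristics.

    Containment.  Global hyperbolicity speaks of timelike curves only, but the
    argument needs that the two null segments from a point of a development to
    the line [t = 0] stay in the development ([vertical_segment],
    [characteristic_segment]).  If such a segment left the development, a
    timelike graph could follow it at a distance which decays fast enough to
    fit in the shrinking room around it ([decaying_function]) and would tend
    to the point of exit.  Continued in the other time direction without an
    endpoint ([past_extension]), this graph is inextendible and misses
    [t = 0], which is absurd ([no_early_exit]).  It follows that
    [Psi = - atan Y], where [Y] is the foot of the characteristic.
    Differentiating this in [x] gives [Psi_x * (1 + Y^2 - t) = -1], so that
    the time of focusing [1 + Y^2] is never reached; and a point with
    [Y <= 0] and [u >= 4] is excluded because its line [u = const] would meet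
    the characteristic of foot [0] at or after its focusing time [1].  So the
    development lies in [explicit_domain], and integrating [Psi] along the
    lines [u = const] determines the potential
    ([development_sub_explicit], [development_potential]).

    Existence.  On the explicit domain the foot is smooth, by implicit
    differentiation, and the potential is given by a formula in the foot.  A
    timelike curve which misses [t = 0] is bounded when it is followed towards
    [t = 0]; its limit point is again in the domain, because the foot
    increases towards the past on the part of the domain near the singular
    boundary ([explicit_development]).

    Bubble.  Write [fold z] for the point of the singular boundary with foot
    [z].  The derivative of [fold] at [z] is [2 z] times [L]: the singular
    boundary is itself a null curve of the extended metric.  From [fold z] one
    can thus go down along the boundary to [fold y], for [0 < y < z], and then
    down the characteristic of foot [y]; hence every point whose foot lies in
    [(0, z)] is in the causal past of [fold z] ([causal_past_below]).  A past
    timelike curve from [fold z], however, leaves the characteristic of foot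
    [z] to the right and cannot cross it again, since [Psi = - atan z] on it
    ([chronological_past_right]).  The points with foot in [(0, z)] are to its
    left, and they form a nonempty open set. *)

Set Implicit Arguments.
Unset Strict Implicit.
Unset Printing Implicit Defensive.

Import Order.TTheory GRing.Theory Num.Theory.
Import numFieldNormedType.Exports.

Local Open Scope classical_set_scope.
Local Open Scope ring_scope.

(** * Calculus on the line and in the plane *)

Section OneVariable.
Variable R : realType.
Implicit Types (f g : R -> R) (a b t : R).

Lemma is_derive1_continuous f t d : is_derive t 1 f d -> {for t, continuous f}.
Proof.
by move=> fd; apply/differentiable_continuous/derivable1_diffP/ex_derive.
Qed.

Lemma mean_value f (d : R -> R) a b : a < b ->
  (forall x, a <= x <= b -> is_derive x 1 f (d x)) ->
  exists2 c, a < c < b & f b - f a = d c * (b - a).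
Proof.
move=> ab fd.
have [||c cab ->] := @MVT R f d a b ab.
- by move=> x; rewrite in_itv /= => /andP[ax xb]; apply: fd; rewrite !ltW.
- apply: continuous_in_subspaceT => x; rewrite inE /= in_itv /= => xab.
  exact: is_derive1_continuous (fd x xab).
by exists c => //; move: cab; rewrite in_itv.
Qed.

Lemma derive_ge0_le f (d : R -> R) a b : a <= b ->
  (forall x, a <= x <= b -> is_derive x 1 f (d x)) ->
  (forall x, a <= x <= b -> 0 <= d x) -> f a <= f b.
Proof.
rewrite le_eqVlt => /predU1P[-> //|ab] fd d0.
have [c /andP[ac cb]] := mean_value ab fd.
move=> e; rewrite -subr_ge0 e mulr_ge0 ?d0 ?subr_ge0 ?(ltW ab)//.
by rewrite !ltW.
Qed.

Lemma derive_gt0_lt f (d : R -> R) a b : a < b ->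
  (forall x, a <= x <= b -> is_derive x 1 f (d x)) ->
  (forall x, a < x < b -> 0 < d x) -> f a < f b.
Proof.
move=> ab fd d0.
have [c cab] := mean_value ab fd.
by move=> e; rewrite -subr_gt0 e mulr_gt0 ?d0 ?subr_gt0.
Qed.

Lemma derive_eq0_const f a b : a <= b ->
  (forall x, a <= x <= b -> is_derive x 1 f 0) -> f a = f b.
Proof.
rewrite le_eqVlt => /predU1P[-> //|ab] fd.
have [c _] := mean_value ab fd.
by rewrite mul0r => /eqP; rewrite subr_eq0 => /eqP.
Qed.

Lemma near_eq_is_derive1 f g t (d : R) : (\near t, f t = g t) ->
  is_derive t 1 f d -> is_derive t 1 g d.
Proof.
by move=> e; apply: near_eq_is_derive; rewrite ?oner_eq0.
Qed.

Lemma antiderivative_right f a : continuous f ->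
  exists F : R -> R, forall x : R, a < x -> is_derive x 1 F (f x).
Proof.
move=> cf.
exists (fun x => (\int[lebesgue_measure]_(t in [set` `[a, x]]) (f t))%R).
move=> x ax.
have xu : x < x + 1 by rewrite ltrDl.
have [|dF <-] := @continuous_FTC1_closed R f a x (x + 1) xu _ ax (cf x).
  apply: continuous_compact_integrable => //; first exact: segment_compact.
  exact: continuous_subspaceT.
by rewrite derive1E; apply: derivableP.
Qed.

(** An integral with lower limit [a] is a primitive on the right of [a] only;
    normalized to vanish at [0], the primitives for different negative [a] agree
    where both are defined, and at [x] the one for [- |x| - 1] can be used. *)
Lemma antiderivative f : continuous f ->
  exists F : R -> R, F 0 = 0 /\ forall x : R, is_derive x 1 F (f x).
Proof.
move=> cf.
have /choice[F FP] : forall a : R, exists F : R -> R, F 0 = 0 /\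
    forall x : R, a < x -> is_derive x 1 F (f x).
  move=> a; have [F FP] := antiderivative_right a cf.
  exists (fun x => F x - F 0); split; first by rewrite subrr.
  move=> x ax; have := FP x ax => ?.
  by apply: is_derive_eq; rewrite subr0.
have FE a b x : a < 0 -> b < 0 -> a < x -> b < x -> F a x = F b x.
  move=> a0 b0 ax bx.
  have [Fa0 Fa] := FP a; have [Fb0 Fb] := FP b.
  have D y : a < y -> b < y -> is_derive y 1 (fun z => F a z - F b z) 0.
    move=> ay by_; have := Fa y ay; have := Fb y by_ => ? ?.
    by apply: is_derive_eq; rewrite subrr.
  apply/eqP; rewrite -subr_eq0.
  have -> : 0 = F a 0 - F b 0 by rewrite Fa0 Fb0 subrr.
  have [x0|x0] := leP x 0.
    apply/eqP; apply: (@derive_eq0_const (fun z => F a z - F b z) x 0) => // y.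
    by move=> /andP[xy _]; apply: D; apply: lt_le_trans xy.
  apply/eqP; symmetry; apply: (@derive_eq0_const (fun z => F a z - F b z) 0 x).
    exact: ltW.
  by move=> y /andP[xy _]; apply: D; apply: lt_le_trans xy.
exists (fun x => F (- `|x| - 1) x); split; first by case: (FP (- `|0 : R| - 1)).
move=> x.
have x0 : - `|x| <= x by rewrite lerNl ler_normr lexx orbT.
have n0 : - `|x| <= 0 by rewrite oppr_le0.
apply: (@near_eq_is_derive1 (F (- `|x| - 2))); last first.
  by have [_] := FP (- `|x| - 2); apply; lra.
near=> y.
have y0 : - `|y| <= y by rewrite lerNl ler_normr lexx orbT.
have yn0 : - `|y| <= 0 by rewrite oppr_le0.
have xy : `|x - y| < 1 by near: y; apply: nbhsx_ballx.
have : `|y| < `|x| + 1.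
  have -> : y = x - (x - y) by ring.
  by apply: le_lt_trans (ler_normB _ _) _; rewrite ltrD2l.
move=> ?; apply: FE; lra.
Unshelve. all: by end_near. Qed.

Lemma near_ball1 t (P : R -> Prop) : (\forall s \near t, P s) <->
  exists2 e, 0 < e & forall s, `|s - t| < e -> P s.
Proof.
split=> [/nbhs_ballP[e e0 eP]|[e e0 eP]].
  by exists e => // s st; apply: eP; rewrite /ball /= distrC.
by apply/nbhs_ballP; exists e => // s; rewrite /ball /= distrC; exact: eP.
Qed.

Lemma nbhs_box (p : R * R) (A : set (R * R)) : nbhs p A <->
  exists2 e, 0 < e & forall s x, `|s - p.1| < e -> `|x - p.2| < e -> A (s, x).
Proof.
split=> [/nbhs_ballP[e e0 eP]|[e e0 eP]].
  by exists e => // s x sp xp; apply: eP; split; rewrite /ball /= distrC.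
apply/nbhs_ballP; exists e => // -[s x] [] /=; rewrite /ball /= distrC.
by move=> sp; rewrite distrC; exact: eP.
Qed.

Lemma continuous_eps {T : topologicalType} (f : T -> R) (t : T) :
  {for t, continuous f} <->
  forall e, 0 < e -> \forall s \near t, `|f s - f t| < e.
Proof.
split=> [/cvgrPdist_lt fc e e0|fc]; last apply/cvgrPdist_lt => e e0.
  by near=> s; rewrite distrC; near: s; exact: fc.
by near=> s; rewrite distrC; near: s; exact: fc.
Unshelve. all: by end_near. Qed.

Lemma continuous_box (f : R * R -> R) (p : R * R) : {for p, continuous f} <->
  forall e, 0 < e -> exists2 d, 0 < d &
    forall s x, `|s - p.1| < d -> `|x - p.2| < d -> `|f (s, x) - f p| < e.
Proof.
split=> [fc e e0|fc].
  have /nbhs_box[d d0 dP] : nbhs p (f @^-1` ball (f p) e).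
    exact: (fc _ (nbhsx_ballx _ _ e0)).
  by exists d => // s x sp xp; have := dP s x sp xp; rewrite /ball /= distrC.
move=> A /nbhs_ballP[e e0 eA]; apply/nbhs_box.
have [d d0 dP] := fc e e0; exists d => // s x sp xp.
by apply: eA; rewrite /ball /= distrC; exact: dP.
Qed.

Lemma open_box (A : set (R * R)) (p : R * R) : open A -> A p ->
  exists2 e, 0 < e & forall s x, `|s - p.1| < e -> `|x - p.2| < e -> A (s, x).
Proof. by move=> oA Ap; apply/nbhs_box/open_nbhs_nbhs. Qed.

End OneVariable.

Lemma differentiable_of_linear_approx (K : numFieldType) (V W : normedModType K)
    (f : V -> W) (df : {linear V -> W}) (x : V) : continuous df ->
  (forall e, 0 < e -> \forall y \near x,
     `|f y - f x - df (y - x)| <= e * `|y - x|) ->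
  differentiable f x /\ 'd f x = df :> (V -> W).
Proof.
move=> cdf fE.
have H : f \o shift x = cst (f x) + df +o_ 0 id.
  apply/eqaddoP => e e0; have := fE e e0.
  rewrite [X in X -> _](near_shift 0) /= => {}fE.
  move: fE; apply: filterS => h.
  by rewrite !fctE /= subr0 addrK opprD addrA.
have E := diff_unique cdf H.
by split; [apply/diff_locallyP; rewrite E|].
Qed.

Section TwoVariables.
Variable R : realType.
Implicit Types (f g : R * R -> R) (p q : R * R) (a b : R).

Definition linear_form a b : R * R -> R := fun v => a * v.1 + b * v.2.

Lemma linear_form_is_linear a b : linear (linear_form a b).
Proof.
by move=> k [x y] [x' y']; rewrite /linear_form /= /GRing.scale /=; ring.
Qed.

HB.instance Definition _ a b := GRing.isLinear.Build R (R * R)%type R _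
  (linear_form a b) (@linear_form_is_linear a b).

Lemma continuous_linear_form a b : continuous (linear_form a b).
Proof.
move=> p; apply: cvgD; apply: cvgM; try exact: cvg_cst.
  exact: cvg_fst.
exact: cvg_snd.
Qed.

(** The plane version of the form of Caratheodory of a derivative: the
    coefficients of the increment are functions continuous at [p], with values
    [a] and [b] there. The rules of differentiation become algebraic identities,
    without estimates. *)
Definition has_grad f p a b :=
  exists al be : R * R -> R,
    [/\ {for p, continuous al} /\ al p = a, {for p, continuous be} /\ be p = b
      & \forall q \near p, f q - f p = al q * (q.1 - p.1) + be q * (q.2 - p.2)].

Lemma has_grad_diff f p a b : has_grad f p a b ->
  differentiable f p /\ 'd f p = linear_form a b :> (R * R -> R).
Proof.
move=> [al [be [[cal ala] [cbe beb] fE]]].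
apply: differentiable_of_linear_approx => [|e e0].
  exact: continuous_linear_form.
have e20 : 0 < e / 2 by rewrite divr_gt0.
have /continuous_eps/(_ _ e20) Hal := cal.
have /continuous_eps/(_ _ e20) Hbe := cbe.
near=> q.
have -> : f q - f p = al q * (q.1 - p.1) + be q * (q.2 - p.2).
  by near: q.
rewrite /linear_form /= prod_normE /=.
have -> : al q * (q.1 - p.1) + be q * (q.2 - p.2) -
   (a * (q.1 - p.1) + b * (q.2 - p.2)) =
   (al q - al p) * (q.1 - p.1) + (be q - be p) * (q.2 - p.2).
  by rewrite ala beb; ring.
set m := Num.max _ _.
have m1 : `|q.1 - p.1| <= m by rewrite le_max lexx.
have m2 : `|q.2 - p.2| <= m by rewrite le_max lexx orbT.
apply: le_trans (ler_normD _ _) _; rewrite !normrM.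
have -> : e * m = e / 2 * m + e / 2 * m by field.
by apply: lerD; apply: ler_pM => //; apply: ltW; near: q.
Unshelve. all: by end_near. Qed.

Lemma has_grad_partials f p a b : has_grad f p a b ->
  dt f p = a /\ dx f p = b.
Proof.
move=> /has_grad_diff[df dE]; rewrite /dt /dx !deriveE// dE /linear_form /=.
by rewrite !mulr1 !mulr0 addr0 add0r.
Qed.

(** The remainder [r] of the linear approximation is shared between the
    coordinates as [r = r * (h1^2 + h2^2) / (h1^2 + h2^2)]: each share is a
    coefficient [r * hi / (h1^2 + h2^2)] times [hi], and the coefficient tends
    to [0] since [r] is small compared with the larger of [|h1|] and [|h2|]. *)
Lemma differentiable_has_grad f p : differentiable f p ->
  has_grad f p (dt f p) (dx f p).
Proof.
move=> fp.
have dE v : 'd f p v = dt f p * v.1 + dx f p * v.2.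
  rewrite /dt /dx !deriveE//.
  have {1}-> : v = v.1 *: ((1, 0) : R * R) + v.2 *: ((0, 1) : R * R).
    case: v => x y; apply/eqP; rewrite xpair_eqE /= !scaler0 addr0 add0r.
    by rewrite /GRing.scale /= !mulr1 !eqxx.
  by rewrite linearD !linearZ /=; congr (_ + _); exact: mulrC.
pose r q := f q - f p - 'd f p (q - p).
pose N q := (q.1 - p.1) ^+ 2 + (q.2 - p.2) ^+ 2.
have rE e : 0 < e -> \forall q \near p,
    `|r q| <= e * Num.max `|q.1 - p.1| `|q.2 - p.2|.
  move=> e0; have /diff_locally := fp => /eqaddoP/(_ _ e0).
  rewrite [X in _ -> X](near_shift 0) /= => H.
  move: H; apply: filterS => h; rewrite !fctE /= subr0 /r addrK opprD addrA.
  by rewrite prod_normE !subr0 !addrK.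
have bnd q x e : x <= Num.max `|q.1 - p.1| `|q.2 - p.2| -> 0 <= x -> 0 <= e ->
   `|r q| <= e * Num.max `|q.1 - p.1| `|q.2 - p.2| -> `|r q| * x / N q <= e.
  set m := Num.max _ _ => xm x0 e0 rm.
  have m0 : 0 <= m by apply: le_trans xm.
  have [N0|N0] := eqVneq (N q) 0; first by rewrite N0 invr0 mulr0.
  have Np : 0 < N q by rewrite lt_def N0 /= addr_ge0 // sqr_ge0.
  rewrite ler_pdivrMr //; apply: (@le_trans _ _ (e * m * m)).
    by apply: ler_pM.
  rewrite -mulrA ler_wpM2l // -expr2 /m.
  by case: (leP `|q.1 - p.1|) => _; rewrite real_normK ?num_real // /N ?lerDr ?lerDl sqr_ge0.
have ctn (d : R * R -> R) c : (forall q, `|d q| <=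
    Num.max `|q.1 - p.1| `|q.2 - p.2|) -> d p = 0 ->
    {for p, continuous (fun q => c + r q * d q / N q)}.
  move=> dm d0; apply/continuous_eps => e e0.
  have e20 : 0 < e / 2 by rewrite divr_gt0.
  have := rE _ e20; apply: filterS => q rq.
  rewrite d0 mulr0 mul0r addr0 addrAC subrr add0r.
  apply: le_lt_trans (_ : e / 2 < e); last lra.
  rewrite !normrM normfV (ger0_norm (_ : 0 <= N q)) ?addr_ge0 ?sqr_ge0//.
  by apply: bnd => //; exact: ltW.
have pp : p.1 - p.1 = 0 /\ p.2 - p.2 = 0 by rewrite !subrr.
exists (fun q => dt f p + r q * (q.1 - p.1) / N q),
  (fun q => dx f p + r q * (q.2 - p.2) / N q).
split.
- split; last by rewrite pp.1 mulr0 mul0r addr0.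
  apply: (ctn (fun q => q.1 - p.1)); last by rewrite pp.1.
  by move=> q; rewrite le_max lexx.
- split; last by rewrite pp.2 mulr0 mul0r addr0.
  apply: (ctn (fun q => q.2 - p.2)); last by rewrite pp.2.
  by move=> q; rewrite le_max lexx orbT.
near=> q.
have [N0|N0] := eqVneq (N q) 0.
  have : (q.1 - p.1) ^+ 2 == 0 /\ (q.2 - p.2) ^+ 2 == 0.
    apply/andP; rewrite -paddr_eq0 ?sqr_ge0//; exact/eqP.
  rewrite !sqrf_eq0 !subr_eq0 => -[/eqP q1 /eqP q2].
  have -> : q = p by case: (q) (p) q1 q2 => ? ? [? ?] /= -> ->.
  by rewrite pp.1 pp.2 !mulr0 subrr addr0.
have -> : f q - f p = r q + (dt f p * (q - p).1 + dx f p * (q - p).2).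
  by rewrite -dE /r subrK.
have {1}-> : r q = r q * ((q.1 - p.1) ^+ 2 + (q.2 - p.2) ^+ 2) / N q.
  by rewrite mulfK.
by rewrite /=; field.
Unshelve. all: by end_near. Qed.

Lemma has_grad_continuous f p a b : has_grad f p a b -> {for p, continuous f}.
Proof.
by move=> /has_grad_diff[fp _]; exact: differentiable_continuous.
Qed.

Lemma near_eq_has_grad f g p a b : (\forall q \near p, f q = g q) ->
  has_grad f p a b -> has_grad g p a b.
Proof.
move=> fg [al [be [ca cb fE]]]; exists al, be; split => //.
have fgp : f p = g p := nbhs_singleton fg.
near=> q; rewrite -fgp -(near fg q)//; near: q; exact: fE.
Unshelve. all: by end_near. Qed.

Lemma has_grad_cst (c : R) p : has_grad (fun=> c) p 0 0.
Proof.
exists (fun=> 0), (fun=> 0); split; try by split => //; exact: cvg_cst.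
by near=> q; rewrite subrr; ring.
Unshelve. all: by end_near. Qed.

Lemma has_grad_fst p : has_grad fst p 1 0.
Proof.
exists (fun=> 1), (fun=> 0); split; try by split => //; exact: cvg_cst.
by near=> q; ring.
Unshelve. all: by end_near. Qed.

Lemma has_grad_snd p : has_grad snd p 0 1.
Proof.
exists (fun=> 0), (fun=> 1); split; try by split => //; exact: cvg_cst.
by near=> q; ring.
Unshelve. all: by end_near. Qed.

Lemma has_gradD f g p a b a' b' : has_grad f p a b -> has_grad g p a' b' ->
  has_grad (fun q => f q + g q) p (a + a') (b + b').
Proof.
move=> [al [be [[ca ea] [cb eb] fE]]] [al' [be' [[ca' ea'] [cb' eb'] gE]]].
exists (fun q => al q + al' q), (fun q => be q + be' q); split.
- by rewrite ea ea'; split => //; exact: continuousD.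
- by rewrite eb eb'; split => //; exact: continuousD.
near=> q.
have -> : f q + g q - (f p + g p) = (f q - f p) + (g q - g p) by ring.
have -> : f q - f p = al q * (q.1 - p.1) + be q * (q.2 - p.2) by near: q.
have -> : g q - g p = al' q * (q.1 - p.1) + be' q * (q.2 - p.2) by near: q.
by ring.
Unshelve. all: by end_near. Qed.

Lemma has_gradM f g p a b a' b' : has_grad f p a b -> has_grad g p a' b' ->
  has_grad (fun q => f q * g q) p (a * g p + f p * a') (b * g p + f p * b').
Proof.
move=> hf hg; have cg := has_grad_continuous hg.
move: hf hg => [al [be [[ca ea] [cb eb] fE]]].
move=> [al' [be' [[ca' ea'] [cb' eb'] gE]]].
exists (fun q => al q * g q + f p * al' q), (fun q => be q * g q + f p * be' q).
split.
- rewrite ea ea'; split => //; apply: continuousD; first exact: continuousM.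
  by apply: continuousM => //; exact: cvg_cst.
- rewrite eb eb'; split => //; apply: continuousD; first exact: continuousM.
  by apply: continuousM => //; exact: cvg_cst.
near=> q.
have -> : f q * g q - f p * g p = (f q - f p) * g q + f p * (g q - g p) by ring.
have -> : f q - f p = al q * (q.1 - p.1) + be q * (q.2 - p.2) by near: q.
have -> : g q - g p = al' q * (q.1 - p.1) + be' q * (q.2 - p.2) by near: q.
by ring.
Unshelve. all: by end_near. Qed.

Lemma has_grad_comp (h : R -> R) (d : R) f p a b : is_derive (f p) 1 h d ->
  has_grad f p a b -> has_grad (fun q => h (f q)) p (d * a) (d * b).
Proof.
move=> /is_derive1_caratheodory[k [kE ck kd]] hf.
have cf := has_grad_continuous hf.
have ckf : {for p, continuous (k \o f)} by exact: continuous_comp.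
move: hf => [al [be [[ca ea] [cb eb] fE]]].
exists (fun q => k (f q) * al q), (fun q => k (f q) * be q); split.
- by rewrite kd ea; split => //; exact: (continuousM ckf).
- by rewrite kd eb; split => //; exact: (continuousM ckf).
near=> q.
rewrite kE.
have -> : f q - f p = al q * (q.1 - p.1) + be q * (q.2 - p.2) by near: q.
by ring.
Unshelve. all: by end_near. Qed.

Lemma has_grad_curve f (x y : R -> R) (t x' y' a b : R) :
  has_grad f (x t, y t) a b -> is_derive t 1 x x' -> is_derive t 1 y y' ->
  is_derive t 1 (fun s => f (x s, y s)) (a * x' + b * y').
Proof.
move=> [al [be [[ca ea] [cb eb] fE]]] dx dy.
have cx := is_derive1_continuous dx; have cy := is_derive1_continuous dy.
have cxy : {for t, continuous (fun s => (x s, y s))}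
  by move=> A; exact: (cvg_pair cx cy).
move: dx dy => /is_derive1_caratheodory[kx [kxE ckx kxt]].
move=> /is_derive1_caratheodory[ky [kyE cky kyt]].
pose g s := al (x s, y s) * kx s + be (x s, y s) * ky s.
pose F s := f (x t, y t) + g s * (s - t).
apply: (@near_eq_is_derive1 _ F).
  near=> s.
  have E : f (x s, y s) - f (x t, y t) = al (x s, y s) * (x s - x t) +
     be (x s, y s) * (y s - y t).
    by near: s; exact: (cxy _ fE).
  by rewrite /F /g -[RHS](subrK (f (x t, y t))) E kxE kyE; ring.
apply/is_derive1_caratheodory; exists g; split.
- by move=> s; rewrite /F subrr mulr0; ring.
- have cal : {for t, continuous (fun s => al (x s, y s))}.
    exact: (@continuous_comp _ _ _ (fun s => (x s, y s)) al).
  have cbe : {for t, continuous (fun s => be (x s, y s))}.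
    exact: (@continuous_comp _ _ _ (fun s => (x s, y s)) be).
  by apply: continuousD; exact: continuousM.
by rewrite /g kxt kyt ea eb.
Unshelve. all: by end_near. Qed.

End TwoVariables.

(** * Equality of mixed partial derivatives *)

Section Schwarz.
Variable R : realType.
Implicit Types (f : R * R -> R) (p : R * R).

Lemma differentiable_dt f (s x : R) : differentiable f (s, x) ->
  is_derive s 1 (fun s => f (s, x)) (dt f (s, x)).
Proof.
move=> fp; have hf := differentiable_has_grad fp.
have d1 : is_derive s 1 (fun s : R => s) 1 by exact: is_derive_id.
have d2 : is_derive s 1 (fun _ : R => x) 0 by exact: is_derive_cst.
by have := has_grad_curve hf d1 d2; rewrite mulr1 mulr0 addr0.
Qed.

Lemma differentiable_dx f (s x : R) : differentiable f (s, x) ->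
  is_derive x 1 (fun x => f (s, x)) (dx f (s, x)).
Proof.
move=> fp; have hf := differentiable_has_grad fp.
have d1 : is_derive x 1 (fun s : R => s) 1 by exact: is_derive_id.
have d2 : is_derive x 1 (fun _ : R => s) 0 by exact: is_derive_cst.
by have := has_grad_curve hf d2 d1; rewrite mulr1 mulr0 add0r.
Qed.

Local Opaque dt dx.

Lemma subr_swap (a b c d : R) : a - b - (c - d) = a - c - (b - d).
Proof. by ring. Qed.

Lemma subr_via (a b c : R) : a - b = (c - b) - (c - a).
Proof. by ring. Qed.

(** The second difference of [f] on a small square is, by the mean value theorem
    applied in either order, the area of the square times a value of either
    mixed derivative in the square. *)
Lemma mixed_partials_eq (A : set (R * R)) f p : open A -> A p ->
  (forall q, A q -> differentiable f q) ->
  (forall q, A q -> differentiable (dt f) q) ->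
  (forall q, A q -> differentiable (dx f) q) ->
  {for p, continuous (dt (dx f))} -> {for p, continuous (dx (dt f))} ->
  dt (dx f) p = dx (dt f) p.
Proof.
move=> oA Ap f0 f1 f2 /continuous_box c1 /continuous_box c2.
apply/eqP; apply/negP => /negP ne.
set D := `|dt (dx f) p - dx (dt f) p|.
have D0 : 0 < D / 2 by rewrite divr_gt0// normr_gt0 subr_eq0.
have [e1 e10 c1'] := c1 _ D0; have [e2 e20 c2'] := c2 _ D0.
have [e3 e30 c3'] := open_box oA Ap.
have [e e0 eP] : exists2 e, 0 < e & forall s x,
   `|s - p.1| < e -> `|x - p.2| < e ->
   [/\ differentiable f (s, x), differentiable (dt f) (s, x),
     differentiable (dx f) (s, x), `|dt (dx f) (s, x) - dt (dx f) p| < D / 2 &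
    `|dx (dt f) (s, x) - dx (dt f) p| < D / 2].
  exists (Num.min e1 (Num.min e2 e3)); first by rewrite !lt_min e10 e20.
  move=> s x; rewrite !lt_min => /and3P[s1 s2 s3] /and3P[x1 x2 x3].
  have Asx := c3' _ _ s3 x3.
  by split; [exact: f0|exact: f1|exact: f2|exact: c1'|exact: c2'].
move: eP; set t := p.1; set x := p.2 => eP.
pose h := e / 2; have h0 : 0 < h by rewrite divr_gt0.
have he : h < e by rewrite /h; lra.
have B s y : t <= s <= t + h -> x <= y <= x + h ->
   `|s - t| < e /\ `|y - x| < e.
  by move=> /andP[s1 s2] /andP[y1 y2]; rewrite !ger0_norm ?subr_ge0//;
    move: h0 he s1 s2 y1 y2; clear; split; lra.
clearbody t x h.
have th : t < t + h by rewrite ltrDl.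
have xh : x < x + h by rewrite ltrDl.
have xi : x <= x + h <= x + h by rewrite lexx ltW.
have xi' : x <= x <= x + h by rewrite lexx ltW.
have ti : t <= t + h <= t + h by rewrite lexx ltW.
have ti' : t <= t <= t + h by rewrite lexx ltW.
have [s sI E1] : exists2 s, t < s < t + h &
   (f (t + h, x + h) - f (t + h, x)) - (f (t, x + h) - f (t, x)) =
   (dt f (s, x + h) - dt f (s, x)) * (t + h - t).
  apply: (@mean_value _ (fun s => f (s, x + h) - f (s, x))
    (fun s => dt f (s, x + h) - dt f (s, x)) t (t + h) th) => s sI.
  have [A1 A2] := B _ _ sI xi; have [A3 A4] := B _ _ sI xi'.
  have [B1 _ _ _ _] := eP _ _ A1 A2; have [B2 _ _ _ _] := eP _ _ A3 A4.
  exact: (is_deriveB (differentiable_dt B1) (differentiable_dt B2)).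
have sI' : t <= s <= t + h by case/andP: sI => ? ?; rewrite !ltW.
have [y yI E2] : exists2 y, x < y < x + h &
   dt f (s, x + h) - dt f (s, x) = dx (dt f) (s, y) * (x + h - x).
  apply: (@mean_value _ (fun y => dt f (s, y))
    (fun y => dx (dt f) (s, y)) x (x + h) xh) => y yI.
  have [A1 A2] := B _ _ sI' yI; have [_ ? _ _ _] := eP _ _ A1 A2.
  exact: differentiable_dx.
have yI' : x <= y <= x + h by case/andP: yI => ? ?; rewrite !ltW.
have [z zI E3] : exists2 z, x < z < x + h &
   (f (t + h, x + h) - f (t, x + h)) - (f (t + h, x) - f (t, x)) =
   (dx f (t + h, z) - dx f (t, z)) * (x + h - x).
  apply: (@mean_value _ (fun s => f (t + h, s) - f (t, s))
    (fun s => dx f (t + h, s) - dx f (t, s)) x (x + h) xh) => z zI.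
  have [A1 A2] := B _ _ ti zI; have [A3 A4] := B _ _ ti' zI.
  have [B1 _ _ _ _] := eP _ _ A1 A2; have [B2 _ _ _ _] := eP _ _ A3 A4.
  exact: (is_deriveB (differentiable_dx B1) (differentiable_dx B2)).
have zI' : x <= z <= x + h by case/andP: zI => ? ?; rewrite !ltW.
have [r rI E4] : exists2 r, t < r < t + h &
   dx f (t + h, z) - dx f (t, z) = dt (dx f) (r, z) * (t + h - t).
  apply: (@mean_value _ (fun r => dx f (r, z))
    (fun r => dt (dx f) (r, z)) t (t + h) th) => r rI.
  have [A1 A2] := B _ _ rI zI'; have [_ _ ? _ _] := eP _ _ A1 A2.
  exact: differentiable_dt.
have rI' : t <= r <= t + h by case/andP: rI => ? ?; rewrite !ltW.
have E : dx (dt f) (s, y) = dt (dx f) (r, z).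
  have hh : h * h != 0 by rewrite mulf_neq0 // gt_eqF.
  rewrite {}E2 in E1; rewrite {}E4 in E3; move: E1 E3.
  move: (f (t + h, x + h)) (f (t + h, x)) (f (t, x + h)) (f (t, x)).
  move: (dx (dt f) (s, y)) (dt (dx f) (r, z)) => a b k1 k2 k3 k4 E1 E3.
  apply: (mulIf hh); move: E1 E3; clear => E1 E3.
  have -> : a * (h * h) = a * (x + h - x) * (t + h - t) by ring.
  by rewrite -E1 subr_swap E3; ring.
have [A1 A2] := B _ _ sI' yI'; have [A3 A4] := B _ _ rI' zI'.
have [_ _ _ _ B1] := eP _ _ A1 A2; have [_ _ _ B2 _] := eP _ _ A3 A4.
have : D < D.
  rewrite {1}/D.
  have -> : dt (dx f) p - dx (dt f) p =
    (dx (dt f) (s, y) - dx (dt f) p) - (dt (dx f) (r, z) - dt (dx f) p).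
    rewrite E; exact: subr_via.
  apply: le_lt_trans (ler_normB _ _) _.
  by rewrite [ltRHS]splitr; exact: (ltrD B1 B2).
by rewrite ltxx.
Qed.

End Schwarz.

(** * Room around a line, and distances that decay within it *)

Section SafeRadius.
Variable R : realType.
Variable P : R -> R -> R -> Prop.
Hypothesis P_anti : forall r r' s h, 0 < r' -> r' <= r -> P r s h -> P r' s h.
Variable t0 : R.

(** In the applications [P r s h] says that the point at time [s] and signed
    distance [h] from a fixed line is in the domain, with a margin measured by
    [r]. A radius that is safe at [t] works from time [t0] on, which makes the
    safe radius nonincreasing. *)
Definition safe (t : R) : set R := [set r | 0 <= r <= 1 /\
  forall s h, t0 - r < s -> s < t + r -> `|h| < r -> P r s h].

(** The supremum need not be attained; its half is safe as soon as it is
    positive. *)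
Definition safe_radius (t : R) : R := sup (safe t) / 2.

Lemma safe0 t : safe t 0.
Proof.
split; first by rewrite lexx ler01.
by move=> s h _ _; rewrite ltNge normr_ge0.
Qed.

Lemma safe_has_sup t : has_sup (safe t).
Proof. by split; [exists 0; exact: safe0|exists 1 => r [/andP[]]]. Qed.

Lemma safe_down t r r' : 0 < r' -> r' <= r -> safe t r -> safe t r'.
Proof.
move=> r0 rr [/andP[r1 r2] rP]; split; first by rewrite ltW //= (le_trans rr).
move=> s h s1 s2 hr; apply: (P_anti r0 rr); apply: rP.
- by apply: le_lt_trans s1; rewrite lerD2l lerN2.
- by apply: lt_le_trans s2 _; rewrite lerD2l.
exact: lt_le_trans rr.
Qed.

Lemma safe_lt t r : 0 < r -> r < sup (safe t) -> safe t r.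
Proof.
move=> r0 rs; have [r' r'S rr'] := sup_gt (safe_has_sup t).1 rs.
exact: safe_down r0 (ltW rr') r'S.
Qed.

Lemma safe_radius_ge0 t : 0 <= safe_radius t.
Proof.
rewrite /safe_radius divr_ge0//.
by apply: (ub_le_sup (safe_has_sup t).2); exact: safe0.
Qed.

Lemma safe_radius_le1 t : safe_radius t <= 1.
Proof.
rewrite /safe_radius; have : sup (safe t) <= 1; last lra.
by apply: ge_sup; [exists 0; exact: safe0|move=> r [/andP[]]].
Qed.

Lemma safe_radius_nincr t t' : t <= t' -> safe_radius t' <= safe_radius t.
Proof.
move=> tt; rewrite ler_pM2r ?invr_gt0//; apply: le_sup.
- move=> r [r01 rP]; exists r; split => //; split => // s h s1 s2.
  by apply: rP => //; apply: lt_le_trans s2 _; rewrite lerD2r.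
- by exists 0; exact: safe0.
- exact: safe_has_sup.
Qed.

Lemma safe_radius_lipschitz t t' : t <= t' ->
  safe_radius t - (t' - t) <= safe_radius t'.
Proof.
move=> tt; have : sup (safe t) - (t' - t) <= sup (safe t'); last first.
  rewrite /safe_radius; lra.
rewrite lerBlDr; apply: ge_sup; first by exists 0; exact: safe0.
move=> r rS; rewrite -lerBlDr.
have [r0|r0] := leP (r - (t' - t)) 0.
  by apply: le_trans r0 _; apply: (ub_le_sup (safe_has_sup t').2); exact: safe0.
apply: ub_le_sup; first exact: (safe_has_sup t').2.
have rr : r - (t' - t) <= r by lra.
have [_ rP] := rS.
split; first by rewrite ltW//=; case: rS => /andP[_ r1] _; lra.
move=> s h s1 s2 hr; apply: (P_anti r0 rr); apply: rP; lra.
Qed.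

Lemma continuous_safe_radius : continuous safe_radius.
Proof.
move=> t; apply/continuous_eps => e e0; apply/near_ball1; exists e => // s.
have [st|ts] := leP s t.
  have := safe_radius_lipschitz st; have := safe_radius_nincr st.
  by move=> A B C; rewrite ger0_norm ?subr_ge0//; move: C;
    rewrite ler0_norm ?subr_le0//; lra.
have := safe_radius_lipschitz (ltW ts); have := safe_radius_nincr (ltW ts).
by move=> A B C; rewrite ler0_norm ?subr_le0//; move: C;
  rewrite gtr0_norm ?subr_gt0//; lra.
Qed.

Lemma safe_radiusP t h : t0 <= t -> 0 < safe_radius t ->
  `|h| < safe_radius t -> P (safe_radius t) t h.
Proof.
move=> tt r0 hr; have rs : safe_radius t < sup (safe t).
  by rewrite /safe_radius in r0 *; lra.
by have [_ +] := safe_lt r0 rs; apply => //; lra.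
Qed.

(** When [t'] is close to [t], the times at which the radius at [t'] works and
    those at which [r] works around [t] overlap, so that together they reach
    beyond [t]. *)
Lemma safe_radius_extend t t' r : 0 < r -> r <= 1 -> t - r < t' ->
  (forall s h, `|s - t| < r -> `|h| < r -> P r s h) ->
  0 < safe_radius t' -> 0 < safe_radius (t + r / 2).
Proof.
move=> r0 r1 tt' rP r'0.
have rs : safe_radius t' < sup (safe t').
  by rewrite /safe_radius in r'0 *; lra.
have [_ rP'] := safe_lt r'0 rs.
pose q := Num.min (safe_radius t') (r / 2).
have q0 : 0 < q by rewrite lt_min r'0 divr_gt0.
have qr : q <= r / 2 by rewrite ge_min lexx orbT.
have qr' : q <= safe_radius t' by rewrite ge_min lexx.
suff qS : safe (t + r / 2) q.
  rewrite /safe_radius divr_gt0//; apply: lt_le_trans q0 _.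
  by apply: ub_le_sup => //; exact: (safe_has_sup (t + r / 2)).2.
split; first by rewrite ltW//=; lra.
move=> s h s1 s2 hq.
have [st|st] := ltP s (t' + q).
  by apply: (P_anti q0 qr'); apply: rP'; lra.
have qr2 : q <= r by lra.
apply: (P_anti q0 qr2); apply: rP; last lra.
by rewrite ltr_norml; apply/andP; split; lra.
Qed.

Lemma safe_radius_init r : 0 < r -> r <= 1 ->
  (forall s h, `|s - t0| < 2 * r -> `|h| < r -> P r s h) ->
  r / 2 <= safe_radius (t0 + r).
Proof.
move=> r0 r1 rP; rewrite ler_pM2r ?invr_gt0//.
apply: ub_le_sup; first exact: (safe_has_sup (t0 + r)).2.
split; first by rewrite ltW.
by move=> s h s1 s2 hr; apply: rP => //; rewrite ltr_norml; apply/andP; split; lra.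
Qed.

End SafeRadius.

Section Decay.
Variable R : realType.

Lemma mul_expRN_lt1 (x : R) : 0 < x -> x * expR (- x) < 1.
Proof.
move=> x0; rewrite expRN ltr_pdivrMr ?expR_gt0// mul1r.
by have := expR_ge1Dx x; move: (expR x) => y; lra.
Qed.

Lemma sqr_expRN_lt4 (x : R) : 0 < x -> x ^+ 2 * expR (- x) < 4.
Proof.
move=> x0.
have -> : x ^+ 2 * expR (- x) = 4 * ((x / 2) * expR (- (x / 2))) ^+ 2.
  have -> : - x = - (x / 2) + - (x / 2) by field.
  by rewrite expRD; move: (expR _) => y; field.
have x20 : 0 < x / 2 by rewrite divr_gt0.
have := mul_expRN_lt1 x20.
have : 0 < x / 2 * expR (- (x / 2)) by rewrite mulr_gt0 ?expR_gt0.
move: (x / 2 * _) => y y0 y1; have : y ^+ 2 < 1 by rewrite exprn_ilt1// ltW.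
by move: (y ^+ 2) => z; lra.
Qed.

(** The function is [eta = expR (- C / A)], where [A t] is the integral of [rho]
    from [t] to [e]; since [rho] is nonincreasing, [A <= L * rho] with [L = e -
    t0]. With [x = C / A] the three bounds are [eta = x * expR (- x) * (A / C) <
    rho], then [- eta' = x^2 * expR (- x) * (rho / C) < rho] because [4 <= C],
    and [- eta' / eta = C * rho / A^2 > 1 / rho] because [L^2 < C]. *)
Lemma decaying_function (rho : R -> R) (t0 e : R) :
  continuous rho -> (forall s t, s <= t -> rho t <= rho s) ->
  (forall t, t0 <= t < e -> 0 < rho t) -> t0 < e ->
  exists eta deta : R -> R, forall t, t0 <= t < e ->
    [/\ is_derive t 1 eta (- deta t), {for t, continuous deta},
        0 < eta t < rho t, 0 < deta t < rho t & eta t / rho t < deta t].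
Proof.
move=> cr rmon rpos t0e.
have [F [_ FD]] := antiderivative cr.
pose L := e - t0; pose C := 4 + L ^+ 2.
have L0 : 0 < L by rewrite subr_gt0.
have C4 : 4 <= C by rewrite lerDl sqr_ge0.
have C0 : 0 < C by apply: lt_le_trans C4.
have LC : L < C by rewrite /C; move: L L0 {C C4 C0}; clear => L L0; nra.
pose A t := F e - F t.
have AP t : t0 <= t < e -> 0 < A t <= L * rho t.
  move=> /andP[tt te].
  have [c /andP[c1 c2] E] := mean_value te (fun x _ => FD x).
  have rc : 0 < rho c by apply: rpos; rewrite c2 andbT ltW// (le_lt_trans tt).
  rewrite /A E mulr_gt0 ?subr_gt0//= mulrC ler_pM ?subr_ge0 ?(ltW te) ?(ltW rc)//.
    by rewrite lerD2l lerN2.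
  exact/rmon/ltW.
pose eta t := expR (- (C / A t)).
exists eta, (fun t => eta t * (C * rho t / A t ^+ 2)) => t tI.
have /andP[A0 AL] := AP t tI; have r0 := rpos _ tI.
have etaD : is_derive t 1 eta (- (eta t * (C * rho t / A t ^+ 2))).
  have AD : is_derive t 1 A (- rho t).
    exact: (is_derive_eq (is_deriveB (is_derive_cst (F e) t 1) (FD t)) (sub0r _)).
  have AV : is_derive t 1 (fun t => (A t)^-1) (- (A t) ^- 2 *: - rho t).
    by apply: is_deriveV => //; rewrite gt_eqF.
  have ZD : is_derive t 1 (fun t => - (C / A t)) (- (C * (rho t / A t ^+ 2))).
    have -> : (fun t => - (C / A t)) = - (C *: (fun t => (A t)^-1)).
      by apply/funext => s.
    apply: is_derive_eq; rewrite /GRing.scale /=.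
    by field; rewrite gt_eqF.
  have H : is_derive t 1 eta _ :=
    @is_derive1_comp R expR _ t _ _ (is_derive_expR (- (C / A t))) ZD.
  apply: (is_derive_eq H).
  by rewrite /eta; move: (expR _) => y; field; rewrite gt_eqF.
have x0 : 0 < C / A t by rewrite divr_gt0.
have e0 : 0 < eta t by rewrite expR_gt0.
split => //.
- have ceta := is_derive1_continuous etaD.
  have cA : {for t, continuous A}.
    apply: (@continuousB _ _ _ (fun=> F e) F); first exact: cvg_cst.
    exact: is_derive1_continuous (FD t).
  apply: continuousM => //; apply: continuousM.
    by apply: continuousM; [exact: cvg_cst|exact: cr].
  apply: (@continuousV _ _ (fun t => A t ^+ 2)).
    by rewrite expf_neq0 // gt_eqF.
  by rewrite (_ : (fun t => A t ^+ 2) = A * A); [exact: continuousM|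
    apply/funext => s; rewrite expr2].
- rewrite e0 /=.
  have : eta t < A t / C.
    have := mul_expRN_lt1 x0; rewrite -/(eta t) => H.
    have -> : eta t = (C / A t * eta t) * (A t / C).
      by field; rewrite !gt_eqF.
    by rewrite gtr_pMl // divr_gt0.
  move/lt_le_trans; apply; rewrite ler_pdivrMr//.
  by rewrite (le_trans AL)// mulrC ler_pM2l// ltW.
- have d0 : 0 < C * rho t / A t ^+ 2.
    by rewrite divr_gt0 ?mulr_gt0// exprn_gt0.
  rewrite mulr_gt0//=.
  have -> : eta t * (C * rho t / A t ^+ 2) =
    ((C / A t) ^+ 2 * eta t) * (rho t / C) by field; rewrite !gt_eqF.
  have rC : 0 < rho t / C by rewrite divr_gt0.
  apply: (@lt_le_trans _ _ (4 * (rho t / C))).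
    by rewrite ltr_pM2r// sqr_expRN_lt4.
  by rewrite mulrA ler_pdivrMr// mulrC ler_pM2l.
rewrite ltr_pM2l// ltr_pdivlMr ?exprn_gt0// mulrC ltr_pdivrMr// -mulrA -expr2.
have : A t ^+ 2 <= (L * rho t) ^+ 2 by rewrite ler_pXn2r ?nnegrE ?mulr_ge0 // ltW.
move/le_lt_trans; apply; rewrite exprMn ltr_pM2r ?exprn_gt0//.
by rewrite /C ltrDr.
Qed.

End Decay.

(** * Extension of a timelike graph to the future *)

Section TimelikeGraphs.
Variable R : realType.
Implicit Types (O : set (R * R)) (w : R * R -> R).

(** In the coordinates [t] and [u = x + 2 t] the null directions of the
    acoustical metric are the slopes [0] and [w = 4 + Psi]. *)
Definition timelike_graph O w (E : set R) (f g : R -> R) := forall t, E t ->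
  [/\ is_derive t 1 f (g t), {for t, continuous g}, O (t, f t) &
      0 < g t < w (t, f t)].

Definition graph (f : R -> R) : R -> R * R := fun t => (t, f t).

(** The square of the positive part is a cutoff of class C1; it lets a graph
    start with a prescribed slope and become, after a short time, a curve of
    another family. *)
Lemma is_derive_pos_sqr (x : R) :
  is_derive x 1 (fun y => Num.max 0 y ^+ 2) (2 * Num.max 0 x).
Proof.
have [x0|x0|->] := ltgtP x 0.
- apply: (@near_eq_is_derive1 _ (fun=> 0)).
    near=> y; rewrite max_l ?expr0n//.
    by apply: ltW; near: y; exact: lt_nbhsl.
  by rewrite mulr0; exact: is_derive_cst.
- apply: (@near_eq_is_derive1 _ (fun y => y ^+ 2)).
    near=> y; rewrite max_r//.
    by apply: ltW; near: y; exact: lt_nbhsr.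
  apply/is_derive1_caratheodory.
  exists (fun y => y + x); split; last by ring.
    by move=> y; ring.
  by apply: continuousD; [exact: cvg_id|exact: cvg_cst].
rewrite mulr0; apply/is_derive1_caratheodory; exists (Num.max 0); split.
- by move=> z; rewrite maxxx expr0n /= !subr0; case: (leP 0 z) => _;
    rewrite expr2 ?mul0r.
- by apply: continuous_max; [exact: cvg_cst|exact: cvg_id].
- by rewrite maxxx.
Unshelve. all: by end_near. Qed.

Lemma continuous_pos (c a t0 t : R) :
  {for t, continuous (fun s : R => c * Num.max 0 (1 - (s - t0) / a))}.
Proof.
apply: continuousM; first exact: cvg_cst.
apply: (@continuous_max _ _ (fun=> 0) (fun s : R => 1 - (s - t0) / a)).
  exact: cvg_cst.
apply: (@is_derive1_continuous _ (fun s : R => 1 - (s - t0) / a) t (- a^-1)).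
have H := is_deriveB (is_derive_id t (1 : R)) (is_derive_cst t0 t (1 : R)).
have K := is_deriveB (is_derive_cst (1 : R) t (1 : R)) (is_deriveZ a^-1 H).
have -> : (fun s : R => 1 - (s - t0) / a) = cst 1 - a^-1 *: (id - cst t0).
  by apply/funext => s; rewrite /= mulrC.
by apply: (is_derive_eq K); rewrite subr0 sub0r /GRing.scale /= mulr1.
Qed.

Section Extension.
Variables (O : set (R * R)) (w : R * R -> R).
Hypothesis openO : open O.
Hypothesis cw : forall q, O q -> {for q, continuous w}.
Hypothesis w0 : forall q, O q -> 0 < w q.

Lemma local_box (q : R * R) (m : R) : O q -> m < w q ->
  exists r, [/\ 0 < r, r <= 1 & forall s h, `|s - q.1| < r -> `|h| < r ->
    O (s, q.2 + h) /\ m + r < w (s, q.2 + h)].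
Proof.
move=> Oq mw.
have [e1 e10 e1P] := open_box openO Oq.
have d0 : 0 < (w q - m) / 2 by rewrite divr_gt0// subr_gt0.
have [e2 e20 e2P] := (continuous_box w q).1 (cw Oq) _ d0.
pose r := Num.min (Num.min 1 ((w q - m) / 2)) (Num.min e1 e2).
exists r; split.
- by rewrite !lt_min ltr01 d0 e10 e20.
- by rewrite !ge_min lexx.
move=> s h; rewrite {1 2}/r !lt_min => /andP[_ /andP[s1 s2]] /andP[_ /andP[h1 h2]].
have E : q.2 + h - q.2 = h by rewrite addrC addKr.
split; first by apply: e1P => //=; rewrite E.
have : `|w (s, q.2 + h) - w q| < (w q - m) / 2 by apply: e2P => //=; rewrite E.
rewrite ltr_norml => /andP[+ _].
have rm : r <= (w q - m) / 2 by rewrite /r !ge_min lexx !orbT.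
by move: rm; move: (w (s, _)) (w q) r => a b c; clear; lra.
Qed.

Definition vertical_safe (u : R) : R -> R -> R -> Prop :=
  fun r s h => O (s, u + h) /\ r < w (s, u + h).

Lemma vertical_safe_anti u r r' s h : 0 < r' -> r' <= r ->
  vertical_safe u r s h -> vertical_safe u r' s h.
Proof. by move=> _ rr [? rw]; split => //; exact: le_lt_trans rw. Qed.

Lemma vertical_safe_local q : O q -> exists r, [/\ 0 < r, r <= 1 &
  forall s h, `|s - q.1| < r -> `|h| < r -> vertical_safe q.2 r s h].
Proof.
move=> Oq; have [r [r0 r1 rP]] := local_box Oq (w0 Oq).
by exists r; split => // s h sq hr; have [A B] := rP s h sq hr; split => //;
  rewrite -[r]add0r.
Qed.

(** The line that is shadowed passes at distance [d] from the starting point,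
    and [k] is the weight of the shadowing profile. The last equation says that
    the curve of initial slope [m] starts at distance [d] from the line; it is
    linear in [k], with solution [k = d / (2 T - k0 d / m)]. As [T] is bounded
    below before [d] is chosen, a small [d] makes [k] small. *)
Lemma future_extension_parameters (r m : R) : 0 < r -> 0 < m ->
  exists d, [/\ 0 < d, d < r, d / m < r &
   forall T k0, r * (expR (- 1) * (r / 2)) <= T -> 0 <= k0 <= 1 ->
    exists k, [/\ 0 < k, k < r, k <= m, k < 1 &
      k * T + (m - k * k0) * (d / m / 2) = d]].
Proof.
move=> r0 m0; set b := r * _.
have b0 : 0 < b by rewrite /b !mulr_gt0 ?expR_gt0// divr_gt0.
clearbody b.
pose d := Num.min (Num.min r (m * r)) (Num.min (Num.min (m * b) (b * r))
  (Num.min (b * m) b)) / 2.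
have d0 : 0 < d by rewrite divr_gt0// !lt_min !mulr_gt0// r0 b0.
have d2 : 2 * d = Num.min (Num.min r (m * r)) (Num.min (Num.min (m * b) (b * r))
  (Num.min (b * m) b)) by rewrite /d mulrC divfK.
have [d3 [d4 [d5 [d6 [d7 d8]]]]] : 2 * d <= r /\ 2 * d <= m * r /\
   2 * d <= m * b /\ 2 * d <= b * r /\ 2 * d <= b * m /\ 2 * d <= b.
  by rewrite d2 !ge_min !lexx ?orbT.
clearbody d; clear d2; exists d; split => //.
- by lra.
- by rewrite ltr_pdivrMr// mulrC; lra.
move=> T k0 bT /andP[k00 k01].
have am : d / m <= b / 2 by rewrite ler_pdivrMr//; move: (mulrC b m); lra.
have a0 : 0 < d / m by rewrite divr_gt0.
have ad : m * (d / m) = d by rewrite mulrC divfK// gt_eqF.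
move: (d / m) am a0 ad => a am a0 ad.
have ka : k0 * a <= a by rewrite ger_pMl.
have D : b < 2 * T - k0 * a by lra.
have D0 : 0 < 2 * T - k0 * a by apply: lt_trans D.
exists (d / (2 * T - k0 * a)).
have K0 : 0 < d / (2 * T - k0 * a) by rewrite divr_gt0.
have Kb c : 0 < c -> 2 * d <= b * c -> d / (2 * T - k0 * a) < c.
  move=> c0 dc; rewrite ltr_pdivrMr//.
  have : c * b < c * (2 * T - k0 * a) by rewrite ltr_pM2l.
  by move: (c * (2 * T - _)) => x; rewrite mulrC; lra.
split => //; first exact: Kb.
- exact/ltW/Kb.
- by apply: Kb; rewrite ?ltr01// mulr1.
have E : (2 * T - k0 * a) != 0 by rewrite gt_eqF.
rewrite -ad; field.
by [].
Qed.

End Extension.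

End TimelikeGraphs.

Section FutureExtension.
Variable R : realType.
Variables (O : set (R * R)) (w : R * R -> R).
Hypothesis openO : open O.
Hypothesis cw : forall q, O q -> {for q, continuous w}.
Hypothesis w0 : forall q, O q -> 0 < w q.

(** [T] is the limit of [A] at infinity. The exponential weight makes it finite,
    and keeps the tail [T - A t] below [rho t], even when [rho] does not tend to
    [0]. *)
Lemma weighted_antiderivative (rho : R -> R) (t0 : R) : continuous rho ->
  (forall s t, s <= t -> rho t <= rho s) -> (forall t, 0 <= rho t <= 1) ->
  exists (A : R -> R) (T : R),
   [/\ forall t : R, is_derive t 1 A (expR (- (t - t0)) * rho t),
       continuous (fun t => expR (- (t - t0)) * rho t),
       forall t, t0 <= t -> 0 <= T - A t <= expR (- (t - t0)) * rho t &
       forall r c, 0 < r -> r <= 1 -> c <= rho (t0 + r) -> 0 <= c ->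
         r * (expR (- 1) * c) <= T - A t0].
Proof.
move=> cr rmon r01.
pose K t := expR (- (t - t0)) * rho t.
have eD (t : R) : is_derive t 1 (fun t => expR (- (t - t0))) (- expR (- (t - t0))).
  have H := is_deriveN (is_deriveB (is_derive_id t (1 : R)) (is_derive_cst t0 t (1 : R))).
  have H2 : is_derive t 1 (fun t => expR (- (t - t0))) _ :=
    @is_derive1_comp R expR _ t _ _ (is_derive_expR (- (t - t0))) H.
  by apply: (is_derive_eq H2); rewrite subr0 mulrN1.
have cK : continuous K.
  move=> t; apply: (@continuousM _ _ (fun t => expR (- (t - t0))) rho); last exact: cr.
  exact: is_derive1_continuous (eD t).
have [A [_ AD]] := antiderivative cK.
have K0 t : 0 <= K t by rewrite mulr_ge0 ?expR_ge0//; case/andP: (r01 t).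
have AB s t : s <= t -> A t - A s <= rho s * (expR (- (s - t0)) - expR (- (t - t0))).
  move=> st.
  have := @derive_ge0_le R (fun x => - (rho s * expR (- (x - t0))) - A x)
    (fun x => (rho s - rho x) * expR (- (x - t0))) s t st _ _.
  have H : forall x, s <= x <= t -> is_derive x 1
      (fun x => - (rho s * expR (- (x - t0))) - A x)
      ((rho s - rho x) * expR (- (x - t0))).
    move=> x _.
    have E := is_deriveB (is_deriveN (is_deriveZ (rho s) (eD x))) (AD x).
    apply: (is_derive_eq E); rewrite /K /GRing.scale /=.
    by move: (expR _) (rho s) (rho x) => a b c; ring.
  have H2 : forall x, s <= x <= t -> 0 <= (rho s - rho x) * expR (- (x - t0)).
    by move=> x /andP[sx _]; rewrite mulr_ge0 ?expR_ge0// subr_ge0 rmon.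
  move=> /(_ H H2).
  move: (expR _) (expR _) (A s) (A t) (rho s) => a b c d e; lra.
have AB' s t : s <= t -> A t - A s <= K s.
  move=> st; apply: le_trans (AB s t st) _; rewrite /K mulrC.
  rewrite ler_wpM2r //; first by case/andP: (r01 s).
  by rewrite gerBl expR_ge0.
pose SS := [set A t | t in [set t | t0 <= t]].
have SS0 : SS !=set0 by exists (A t0); exists t0 => //=.
have SSb : has_ubound SS.
  exists (A t0 + K t0) => _ [t tt <-]; have := AB' _ _ tt.
  by move: (A t) (A t0) (K t0) => a b c; lra.
exists A, (sup SS); split => //.
- move=> t tt; rewrite subr_ge0; apply/andP; split.
    by apply: (ub_le_sup SSb); exists t.
  rewrite lerBlDr; apply: ge_sup => // _ [s ts <-].
  have [st|st] := leP s t; last first.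
    have := AB' _ _ (ltW st).
    by rewrite -/(K t); move: (A s) (A t) (K t) => a b c; lra.
  have : A s <= A t.
    by apply: (@derive_ge0_le _ A K) => // *; exact: AD.
  by have := K0 t; rewrite -/(K t); move: (A s) (A t) (K t) => a b c; lra.
move=> r c r0 r1 cr' c0.
have tr : t0 < t0 + r by rewrite ltrDl.
have [x /andP[x1 x2] E] := mean_value tr (fun x _ => AD x).
have Ar : A (t0 + r) <= sup SS.
  by apply: (ub_le_sup SSb); exists (t0 + r) => //=; exact: ltW.
apply: (@le_trans _ _ (A (t0 + r) - A t0)); last by rewrite lerD2r.
rewrite E (addrC t0) addrK mulrC ler_pM2r//.
apply: ler_pM; rewrite ?expR_ge0//.
  by rewrite ler_expR lerN2; move: x2; lra.
by apply: le_trans cr' _; apply: rmon; exact: ltW.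
Qed.

(** The graph shadows the line [u = u1], with [u1] slightly larger than [u0],
    from the left and within the safe radius [rho] of that line, for as long as
    [rho] is positive. If this is forever, there is no endpoint. If [rho]
    vanishes from a time [e] on, an endpoint in [O] could only be the point [(e,
    u1)] of the line, and around a point of [O] the safe radius stays positive a
    little longer. *)
Lemma future_extension (t0 u0 m : R) : O (t0, u0) -> 0 < m < w (t0, u0) ->
  exists (E : set R) (f g : R -> R),
  [/\ E t0 /\ (forall t, E t -> t0 <= t),
      (forall s t, E t -> t0 <= s <= t -> E s) /\
      (forall t, E t -> exists2 t', t < t' & E t'),
      f t0 = u0 /\ g t0 = m, timelike_graph O w E f g &
      forall q, O q -> ~ upper_endpoint E (graph f) q].
Proof.
move=> Oq /andP[m0 mw].
have [r0 [r00 r01 r0P]] := local_box openO cw Oq mw.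
pose r := r0 / 2; have rr : 0 < r by rewrite divr_gt0.
have r1 : r <= 1 by rewrite /r; lra.
have rr0 : 2 * r = r0 by rewrite /r; field.
clearbody r.
have [d [d0 dr dmr dP]] := future_extension_parameters rr m0.
have dr0 : d < r0 by move: dr rr rr0; lra.
pose u1 := u0 + d; pose P := vertical_safe O w u1.
have Panti := @vertical_safe_anti R O w u1.
have P0 : forall s h, `|s - t0| < 2 * r -> `|h| < r -> P r s h.
  move=> s h; rewrite rr0 => sr hr.
  have [|A B] := r0P s (d + h) sr.
    by apply: le_lt_trans (ler_normD _ _) _; rewrite gtr0_norm//; lra.
  rewrite /P /vertical_safe /u1 -addrA; split => //.
  by apply: lt_trans B; lra.
pose rho := safe_radius P t0.
have rho_r : r / 2 <= rho (t0 + r) := safe_radius_init rr r1 P0.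
have rho01 t : 0 <= rho t <= 1 by rewrite safe_radius_ge0 safe_radius_le1.
have rmon s t : s <= t -> rho t <= rho s by apply: safe_radius_nincr.
have rlip s t : s <= t -> rho s - (t - s) <= rho t.
  by apply: safe_radius_lipschitz.
have crho : continuous rho by apply: continuous_safe_radius.
have rhoP t h : t0 <= t -> 0 < rho t -> `|h| < rho t -> P (rho t) t h.
  by apply: safe_radiusP.
have rext t t' e : 0 < e -> e <= 1 -> t - e < t' ->
  (forall s h, `|s - t| < e -> `|h| < e -> P e s h) ->
  0 < rho t' -> 0 < rho (t + e / 2).
  by apply: safe_radius_extend.
clearbody rho.
have [A [T [AD cK AT Tge]]] := weighted_antiderivative t0 crho rmon rho01.
have r20 : 0 < r / 2 by rewrite divr_gt0.
have Tr := Tge r (r / 2) rr r1 rho_r (ltW r20).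
have [k [k0 kr km k1 kE]] := dP _ _ Tr (rho01 t0).
pose K (t : R) : R := expR (- (t - t0)) * rho t.
have Kt0 : K t0 = rho t0 by rewrite /K subrr oppr0 expR0 mul1r.
have Krho t : t0 <= t -> K t <= rho t.
  move=> tt; rewrite ler_piMl//; first by case/andP: (rho01 t).
  by rewrite -expR0 ler_expR oppr_le0 subr_ge0.
pose a := d / m; have a0 : 0 < a by rewrite divr_gt0.
pose b := m - k * rho t0.
have b0 : 0 <= b.
  rewrite subr_ge0; apply: le_trans km; rewrite ger_pMr//.
  by case/andP: (rho01 t0).
have bm : b <= m.
  by rewrite gerBl mulr_ge0 ?(ltW k0)//; case/andP: (rho01 t0).
pose pos (t : R) : R := Num.max 0 (1 - (t - t0) / a).
have pos0 t : 0 <= pos t by rewrite le_max lexx.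
have pos1 t : t0 <= t -> pos t <= 1.
  move=> tt; rewrite ge_max ler01 /= gerBl.
  by rewrite divr_ge0 ?subr_ge0// ltW.
have pos_t0 : pos t0 = 1 by rewrite /pos subrr mul0r subr0 max_r.
have pos_far t : t0 + a <= t -> pos t = 0.
  move=> tt; rewrite /pos max_l// subr_le0 ler_pdivlMr// mul1r.
  by rewrite lerBrDl.
pose f (t : R) : R := u1 - k * (T - A t) - b * (a / 2) * pos t ^+ 2.
pose g (t : R) : R := k * K t + b * pos t.
have fD (t : R) : is_derive t 1 f (g t).
  have H := is_deriveB (is_derive_id t (1 : R)) (is_derive_cst t0 t (1 : R)).
  have L : is_derive t 1 (fun s : R => 1 - (s - t0) / a) (- a^-1).
    have L := is_deriveB (is_derive_cst (1 : R) t (1 : R)) (is_deriveZ a^-1 H).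
    have -> : (fun s : R => 1 - (s - t0) / a) = cst 1 - a^-1 *: (id - cst t0).
      by apply/funext => s; rewrite /= mulrC.
    by apply: (is_derive_eq L); rewrite subr0 sub0r /GRing.scale /= mulr1.
  have M : is_derive t 1 (fun s => pos s ^+ 2) _ :=
    @is_derive1_comp R (fun y => Num.max 0 y ^+ 2)
      (fun s : R => 1 - (s - t0) / a) t _ _ (is_derive_pos_sqr _) L.
  have N := is_deriveB (is_derive_cst (u1 - k * T) t (1 : R))
    (is_deriveZ (- k) (AD t)).
  have Q := is_deriveB N (is_deriveZ (b * (a / 2)) M).
  have -> : f = cst (u1 - k * T) - (- k) *: A - (b * (a / 2)) *: (fun s => pos s ^+ 2).
    apply/funext => s; rewrite /f /GRing.scale /= !fctE /=.
    by move: (pos s ^+ 2) (A s) => x y; rewrite /GRing.scale /=; ring.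
  apply: (is_derive_eq Q); rewrite /g /K /GRing.scale /= -/(pos t).
  by move: (pos t) (expR _) => x y; field; rewrite gt_eqF.
have cg (t : R) : {for t, continuous g}.
  apply: (@continuousD _ _ _ (fun t => k * K t) (fun t => b * pos t)).
    by apply: (@continuousM _ _ (fun=> k) K); [exact: cvg_cst|exact: cK].
  exact: continuous_pos.
have ft0 : f t0 = u0.
  rewrite /f pos_t0 expr1n mulr1 /u1; move: kE; rewrite -/a -/b.
  by move: (k * _) (b * _) => x y <-; ring.
have gt0 : g t0 = m by rewrite /g pos_t0 mulr1 Kt0 /b addrC subrK.
have Kge0 t : 0 <= K t by rewrite mulr_ge0 ?expR_ge0//; case/andP: (rho01 t).
have gge0 t : 0 <= g t by rewrite addr_ge0// mulr_ge0// ltW.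
have fu1 t : t0 <= t -> f t <= u1.
  move=> tt; have /andP[TA _] := AT t tt.
  rewrite /f -addrA gerDl -opprD oppr_le0 addr_ge0//.
    by rewrite mulr_ge0// ltW.
  apply: mulr_ge0; last exact: sqr_ge0.
  by apply: mulr_ge0 => //; rewrite divr_ge0// ltW.
have fu0 t : t0 <= t -> u0 <= f t.
  move=> tt; rewrite -ft0; apply: (@derive_ge0_le _ f g) => // *; exact: fD.
have far t : t0 + a <= t -> f t = u1 - k * (T - A t) /\ g t = k * K t.
  by move=> tt; rewrite /f /g pos_far// expr0n /= !mulr0 subr0 addr0.
have dev t : t0 <= t -> 0 <= k * (T - A t) <= k * rho t.
  move=> tt; have /andP[TA TK] := AT t tt.
  rewrite mulr_ge0 ?(ltW k0)//= ler_pM2l//.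
  by apply: le_trans TK _; exact: Krho.
pose E := [set t | t0 <= t /\ 0 < rho t].
have rt0 : 0 < rho (t0 + r) by apply: lt_le_trans rho_r.
have tr : t0 <= t0 + r by rewrite lerDl ltW.
have Et0 : E t0 by split => //; apply: lt_le_trans (rmon _ _ tr).
have Eopen t : E t -> exists2 t', t < t' & E t'.
  move=> [tt rt]; exists (t + rho t / 2); first by rewrite ltrDl divr_gt0.
  have tt' : t <= t + rho t / 2 by rewrite lerDl divr_ge0// ltW.
  split; first by apply: le_trans tt'.
  by have := rlip _ _ tt'; rewrite (addrC t) addrK; move: rt; lra.
exists E, f, g; split => //.
- by split => // t [].
- split => // s t [tt rt] /andP[s1 s2]; split => //.
  by apply: lt_le_trans rt _; exact: rmon.
- move=> t [tt rt]; split => //.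
    have [ta|ta] := ltP t (t0 + a).
      have [||+ _] := r0P t (f t - u0).
      + rewrite /= ger0_norm ?subr_ge0// ltrBlDl; apply: (lt_trans ta).
        by rewrite ltrD2l (lt_trans dmr)// -rr0 mulr_natl mulr2n ltrDl.
      + rewrite ger0_norm ?subr_ge0 ?fu0//.
        apply: le_lt_trans dr0; rewrite lerBlDl; exact: fu1.
      + by rewrite /= addrC subrK.
    have [fE _] := far t ta; have /andP[d1 d2] := dev t tt.
    have [|+ _] := rhoP t (- (k * (T - A t))) tt rt.
      rewrite normrN ger0_norm//; apply: le_lt_trans d2 _.
      by rewrite gtr_pMl.
    by rewrite fE.
  have Kt : 0 < K t by rewrite mulr_gt0 ?expR_gt0.
  have kK : k * K t < rho t.
    apply: (@le_lt_trans _ _ (k * rho t)); first by rewrite ler_pM2l// Krho.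
    by rewrite gtr_pMl.
  apply/andP; split; first by rewrite ltr_wpDr ?mulr_ge0// mulr_gt0.
  have [ta|ta] := ltP t (t0 + a).
    have [||_ +] := r0P t (f t - u0).
    + rewrite /= ger0_norm ?subr_ge0// ltrBlDl; apply: (lt_trans ta).
        by rewrite ltrD2l (lt_trans dmr)// -rr0 mulr_natl mulr2n ltrDl.
    + rewrite ger0_norm ?subr_ge0 ?fu0//.
      apply: le_lt_trans dr0; rewrite lerBlDl; exact: fu1.
    rewrite /= (addrC u0) subrK; apply: lt_trans.
    have kK' : k * K t <= k.
      rewrite ger_pMr//; apply: le_trans (Krho t tt) _.
      by case/andP: (rho01 t).
    have bp : b * pos t <= m.
      by apply: le_trans bm; rewrite ler_piMr// pos1.
    by rewrite /g; move: (k * K t) (b * pos t) kK' bp => x y; lra.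
  have [fE gE] := far t ta; have /andP[d1 d2] := dev t tt.
  have [|_ +] := rhoP t (- (k * (T - A t))) tt rt.
    rewrite normrN ger0_norm//; apply: le_lt_trans d2 _.
    by rewrite gtr_pMl.
  by rewrite fE gE; apply: lt_trans.
move=> q Oq' qend.
have Eq s : E s -> s <= q.1.
  move=> Es; rewrite leNgt; apply/negP => qs.
  have [|s0 Es0 /(_ (Num.max s s0))] := qend [set p | `|p.1 - q.1| < s - q.1].
    apply/nbhs_box; exists (s - q.1); first by rewrite subr_gt0.
    by move=> *.
  have Em : E (Num.max s s0) by case: (leP s s0).
  have ms : s <= Num.max s s0 by rewrite le_max lexx.
  have ms0 : s0 <= Num.max s s0 by rewrite le_max lexx orbT.
  move=> /(_ Em ms0) /=; rewrite ger0_norm; last first.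
    by rewrite subr_ge0; apply: le_trans ms; exact: ltW.
  by rewrite ltrD2r ltNge ms.
have q0 : t0 + r <= q.1 by apply: Eq; split.
have rq : rho q.1 = 0.
  apply/eqP; rewrite eq_le; have /andP[-> _] := rho01 q.1; rewrite andbT leNgt.
  apply/negP => rq; have [|t' qt' Et'] := Eopen q.1.
    by split => //; apply: le_trans q0.
  by have := Eq _ Et'; rewrite leNgt qt'.
have q2 : q.2 = u1.
  apply/eqP; rewrite -subr_eq0 -normr_eq0; apply/negP => /negP qu.
  have e0 : 0 < `|q.2 - u1| / 2 by rewrite divr_gt0// lt_def qu normr_ge0.
  have /continuous_eps/(_ _ e0)/near_ball1[e1 e10 e1P] := crho q.1.
  pose e := Num.min (Num.min e1 (r - a)) (`|q.2 - u1| / 2).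
  have [|s0 Es0 /(_ s0 Es0 (lexx _)) /= [S1 S2]] :=
     qend [set p | `|p.1 - q.1| < e /\ `|p.2 - q.2| < e].
    apply/nbhs_box; exists e; last by move=> *.
    by rewrite !lt_min e10 e0 subr_gt0 dmr.
  move: S1 S2; rewrite !lt_min => /andP[/andP[S11 S12] S13] /andP[_ S2].
  have s0t : t0 <= s0 by case: Es0.
  have s0a : t0 + a <= s0.
    move: S12; rewrite distrC ltr_norml => /andP[_]; move: q0; lra.
  have [fE _] := far _ s0a; have /andP[d1 d2] := dev _ s0t.
  have := e1P _ S11; rewrite rq subr0 => rs.
  have : k * rho s0 <= rho s0.
    by rewrite ger_pMl ?(ltW k1)//; case: Es0.
  have : rho s0 <= `|rho s0| by rewrite ler_norm.
  have E0 : q.2 - u1 = - (f s0 - q.2) - k * (T - A s0) by rewrite fE; ring.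
  have : `|q.2 - u1| <= `|f s0 - q.2| + k * (T - A s0).
    rewrite {1}E0; apply: le_trans (ler_normB _ _) _.
    by rewrite normrN (ger0_norm d1).
  set x1 := `|q.2 - u1| in rs S2 *; set x2 := `|f s0 - q.2| in S2 *.
  set x3 := `|rho s0| in rs *; set x4 := k * (T - _) in d2 *.
  set x5 := k * rho s0 in d2 *; set x6 := rho s0.
  clearbody x1 x2 x3 x4 x5 x6; move: S2 rs d2; lra.
have [e [e0 e1 eP]] := vertical_safe_local openO cw w0 Oq'.
have [|s0 Es0 /(_ s0 Es0 (lexx _)) /= S1] := qend [set p | `|p.1 - q.1| < e].
  by apply/nbhs_box; exists e.
have : 0 < rho (q.1 + e / 2).
  apply: (rext _ s0) => //; last by case: Es0.
    by move: S1; rewrite distrC ltr_norml => /andP[_]; lra.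
  by move=> s h sq hr; have := eP s h sq hr; rewrite q2.
have qe : q.1 <= q.1 + e / 2 by rewrite lerDl divr_ge0// ltW.
by move/lt_le_trans/(_ (rmon _ _ qe)); rewrite rq ltxx.
Qed.

End FutureExtension.

(** * Time reversal, and extension to the past *)

Section Reflection.
Variable R : realType.
Implicit Types (O : set (R * R)) (w : R * R -> R) (q : R * R).

(** The map [(t, u) |-> (- t, - u)] keeps the slopes of graphs, hence exchanges
    future and past without changing which graphs are timelike. *)
Definition rfl q : R * R := (- q.1, - q.2).

Lemma rflK q : rfl (rfl q) = q.
Proof. by case: q => a b; rewrite /rfl /= !opprK. Qed.

Lemma rfl_near (s x : R) q (e : R) : `|s - (rfl q).1| < e -> `|x - (rfl q).2| < e ->
  `|- s - q.1| < e /\ `|- x - q.2| < e.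
Proof. by rewrite /= !opprK -normrN opprD -[`|x + _|]normrN opprD. Qed.

Lemma open_boxes (A : set (R * R)) :
  (forall q, A q -> exists2 e, 0 < e &
    forall s x, `|s - q.1| < e -> `|x - q.2| < e -> A (s, x)) -> open A.
Proof. by move=> H; rewrite openE => q /H/nbhs_box. Qed.

Lemma open_rfl O : open O -> open [set q | O (rfl q)].
Proof.
move=> oO; apply: open_boxes => q /= Oq; have [e e0 eP] := open_box oO Oq.
exists e => // s x sq xq; apply: eP; rewrite /= opprK addrC -normrN opprD opprK addrC//.
Qed.

Lemma continuous_rfl O w : (forall q, O q -> {for q, continuous w}) ->
  forall q, O (rfl q) -> {for q, continuous (w \o rfl)}.
Proof.
move=> cw q Oq; apply/continuous_box => e e0.
have [d d0 dP] := (continuous_box w (rfl q)).1 (cw _ Oq) e e0.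
exists d => // s x sq xq; apply: dP; rewrite /= opprK addrC -normrN opprD opprK addrC//.
Qed.

Lemma is_derive_rfl (f : R -> R) (t d : R) : is_derive (- t) 1 f d ->
  is_derive t 1 (fun s => - f (- s)) d.
Proof.
move=> fd; have H := is_deriveN (is_derive_id t (1 : R)).
have K := is_deriveN (@is_derive1_comp R f (fun s => - s) t _ _ fd H).
by apply: (is_derive_eq K); rewrite mulrN1 opprK.
Qed.

Lemma upper_endpoint_rfl (I : set R) (c c' : R -> R * R) q :
  (forall t, I t -> c' (- t) = rfl (c t)) ->
  upper_endpoint [set t | I (- t)] c' (rfl q) -> lower_endpoint I c q.
Proof.
move=> cc' ue U /nbhs_box[e e0 eU].
have [|s0 /= Is0 sP] := ue [set p | U (rfl p)].
  apply/nbhs_box; exists e => // s x sq xq.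
  by have [A B] := rfl_near sq xq; exact: eU.
exists (- s0) => // s Is ss0.
have := sP (- s); rewrite /= opprK => /(_ Is).
by rewrite lerNr => /(_ ss0); rewrite cc'// rflK.
Qed.

Lemma lower_endpoint_rfl (I : set R) (c c' : R -> R * R) q :
  (forall t, I t -> c' (- t) = rfl (c t)) ->
  lower_endpoint [set t | I (- t)] c' (rfl q) -> upper_endpoint I c q.
Proof.
move=> cc' ue U /nbhs_box[e e0 eU].
have [|s0 /= Is0 sP] := ue [set p | U (rfl p)].
  apply/nbhs_box; exists e => // s x sq xq.
  by have [A B] := rfl_near sq xq; exact: eU.
exists (- s0) => // s Is ss0.
have := sP (- s); rewrite /= opprK => /(_ Is).
by rewrite lerNl => /(_ ss0); rewrite cc'// rflK.
Qed.

Lemma open_oppr (I : set R) : open I -> open [set t | I (- t)].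
Proof. by move=> oI; apply: open_comp => // t _; exact: opp_continuous. Qed.

(** A graph meets the line [t = 0] at most once, so global hyperbolicity for
    graphs only says that it does meet it. *)
Definition abstract_gh O w := forall (I : set R) (f g : R -> R),
  I !=set0 -> open I -> is_interval I -> timelike_graph O w I f g ->
  (forall q, O q -> ~ upper_endpoint I (graph f) q /\
                    ~ lower_endpoint I (graph f) q) -> I 0.

Lemma timelike_graph_rfl O w (I : set R) (f g : R -> R) :
  timelike_graph [set q | O (rfl q)] (w \o rfl) I f g ->
  timelike_graph O w [set t | I (- t)] (fun s => - f (- s)) (fun s => g (- s)).
Proof.
move=> tg t /= It; have [fD cg Of gw] := tg _ It; split.
- exact: is_derive_rfl.
- by apply: (@continuous_comp _ _ _ (fun s => - s) g) => //; exact: opp_continuous.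
- by move: Of; rewrite /= /rfl /= opprK.
- by move: gw; rewrite /= /rfl /= opprK.
Qed.

Lemma abstract_gh_rfl O w : abstract_gh O w ->
  abstract_gh [set q | O (rfl q)] (w \o rfl).
Proof.
move=> gh I f g [t0 It0] oI iI tg noend.
have : [set t | I (- t)] 0; last by rewrite /= oppr0.
apply: (gh _ (fun s => - f (- s)) (fun s => g (- s))).
- by exists (- t0); rewrite /= opprK.
- exact: open_oppr.
- move=> x y Ix Iy z /andP[xz zy]; apply: (iI _ _ Iy Ix).
  by rewrite !lerN2 zy xz.
- exact: timelike_graph_rfl.
move=> q Oq; have [|A B] := noend (rfl q); first by rewrite /= rflK.
have E (t : R) : I t -> graph (fun s => - f (- s)) (- t) = rfl (graph f t).
  by rewrite /graph /rfl /= opprK.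
split=> H; [apply: B; apply: (upper_endpoint_rfl E); rewrite rflK//|
            apply: A; apply: (lower_endpoint_rfl E); rewrite rflK//].
Qed.

Lemma past_extension O w (t0 u0 m : R) : open O ->
  (forall q, O q -> {for q, continuous w}) -> (forall q, O q -> 0 < w q) ->
  O (t0, u0) -> 0 < m < w (t0, u0) ->
  exists (E : set R) (f g : R -> R),
  [/\ E t0 /\ (forall t, E t -> t <= t0),
      (forall s t, E t -> t <= s <= t0 -> E s) /\
      (forall t, E t -> exists2 t', t' < t & E t'),
      f t0 = u0 /\ g t0 = m, timelike_graph O w E f g &
      forall q, O q -> ~ lower_endpoint E (graph f) q].
Proof.
move=> oO cw w0 Oq mw.
have [|q Oq'||||E [f [g [[Et0 Ege] [Edn Eopen] [ft0 gt0] tg noend]]]] :=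
    @future_extension R [set q | O (rfl q)] (w \o rfl) _ _ _ (- t0) (- u0) m.
- exact: open_rfl.
- exact: continuous_rfl cw _ _.
- by move=> q /= /w0.
- by rewrite /= /rfl /= !opprK.
- by rewrite /= /rfl /= !opprK.
exists [set t | E (- t)], (fun s => - f (- s)), (fun s => g (- s)); split.
- by split => // t /= /Ege; rewrite lerN2.
- split=> [s t /= Et /andP[ts st]|t /= /Eopen[t' tt' Et']].
    by apply: (Edn _ (- t)); rewrite // !lerN2 ts st.
  by exists (- t'); rewrite /= ?opprK// ltrNl.
- by rewrite ft0 gt0 opprK.
- exact: timelike_graph_rfl.
move=> q Oq' le; apply: (noend (rfl q)); first by rewrite /= rflK.
apply: (@lower_endpoint_rfl _ _ (graph (fun s => - f (- s)))).
  by move=> t _; rewrite /graph /rfl /= opprK.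
by rewrite rflK.
Qed.

Lemma is_derive_glue (f1 f2 : R -> R) (t0 d : R) : f1 t0 = f2 t0 ->
  is_derive t0 1 f1 d -> is_derive t0 1 f2 d ->
  is_derive t0 1 (fun s => if s < t0 then f1 s else f2 s) d.
Proof.
move=> ff /is_derive1_caratheodory[q1 [E1 /continuous_eps c1 d1]].
move=> /is_derive1_caratheodory[q2 [E2 /continuous_eps c2 d2]].
apply/is_derive1_caratheodory; exists (fun s => if s < t0 then q1 s else q2 s).
split; last by rewrite ltxx.
  by move=> z; rewrite ltxx; case: ifP => _ //; rewrite -ff.
apply/continuous_eps => e e0; near=> s.
rewrite ltxx; case: ifP => _.
  by rewrite d2 -d1; near: s; exact: c1.
by near: s; exact: c2.
Unshelve. all: by end_near. Qed.

Lemma continuous_glue (f1 f2 : R -> R) (t0 : R) : f1 t0 = f2 t0 ->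
  {for t0, continuous f1} -> {for t0, continuous f2} ->
  {for t0, continuous (fun s => if s < t0 then f1 s else f2 s)}.
Proof.
move=> ff /continuous_eps c1 /continuous_eps c2.
apply/continuous_eps => e e0; near=> s.
rewrite ltxx; case: ifP => _; last by near: s; exact: c2.
by rewrite -ff; near: s; exact: c1.
Unshelve. all: by end_near. Qed.

End Reflection.

Lemma near_eq_continuous (R : realType) (f g : R -> R) (t : R) :
  (\forall s \near t, f s = g s) -> {for t, continuous f} ->
  {for t, continuous g}.
Proof.
move=> fg /continuous_eps cf; apply/continuous_eps => e e0.
have E : f t = g t := nbhs_singleton fg.
by near=> s; rewrite -E -(near fg s)//; near: s; exact: cf.
Unshelve. all: by end_near. Qed.

(** * Null segments of a globally hyperbolic domain *)

Section Shadowing.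
Variable R : realType.
Variables (O : set (R * R)) (w : R * R -> R).
Hypothesis openO : open O.
Hypothesis cw : forall q, O q -> {for q, continuous w}.
Hypothesis w0 : forall q, O q -> 0 < w q.
Hypothesis gh : abstract_gh O w.

(** Continued without endpoint to the past, the graph would be inextendible if
    its limit [(e, ue)] were outside [O]; but all its times are smaller than
    [e], hence negative. *)
Lemma no_early_exit (t0 e ue : R) (f g : R -> R) : t0 < e -> e <= 0 ->
  timelike_graph O w [set t | t0 <= t < e] f g ->
  (forall d, 0 < d -> exists s0, t0 <= s0 < e /\
     forall s, s0 <= s < e -> `|f s - ue| < d) ->
  O (e, ue).
Proof.
move=> t0e e0 tg flim; apply: contrapT => nOe.
have t0I : t0 <= t0 < e by rewrite lexx.
have [fD0 cg0 Of0 gw0] := tg t0 t0I.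
have [E [f1 [g1 [[Et0 Ele] [Eup Eopen] [f1t0 g1t0] tg1 noend]]]] :=
  past_extension openO cw w0 Of0 gw0.
pose I := [set t | (t < t0 /\ E t) \/ t0 <= t < e].
pose F s := if s < t0 then f1 s else f s.
pose G s := if s < t0 then g1 s else g s.
have FE s : E s -> F s = f1 s.
  move=> Es; rewrite /F; case: ltP => // ts.
  by have -> : s = t0 by apply/eqP; rewrite eq_le ts Ele.
have Fe s : t0 <= s -> F s = f s by move=> ts; rewrite /F ltNge ts.
have EI s : E s -> I s.
  move=> Es; have := Ele s Es; rewrite le_eqVlt => /predU1P[->|st0].
    by right.
  by left.
have Ie s : I s -> s < e.
  by move=> [[st _]|/andP[_ //]]; exact: lt_trans t0e.
have ItE s : I s -> s <= t0 -> E s.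
  move=> [[_ //]|/andP[ts _]] st.
  by have -> : s = t0 by apply/eqP; rewrite eq_le ts st.
have I0 : I 0; last by have := Ie _ I0; rewrite ltNge e0.
apply: (gh (f := F) (g := G)).
- by exists t0; right.
- rewrite openE => t It; apply/near_ball1.
  have te := Ie _ It.
  have [st|ts] := ltP t t0.
    have [t' tt' Et'] := Eopen t (ItE _ It (ltW st)).
    exists (Num.min (t - t') (t0 - t)); first by rewrite lt_min !subr_gt0 tt' st.
    move=> s; rewrite lt_min !ltr_norml => /andP[/andP[A _] /andP[_ B]].
    have t's : t' < s by move: A; lra.
    have st0 : s < t0 by move: B; lra.
    left; split => //; apply: (Eup _ t') => //.
    by rewrite ltW//= ltW.
  have [t' tt' Et'] := Eopen t0 Et0.
  exists (Num.min (t0 - t') (e - t)); first by rewrite lt_min !subr_gt0 tt' te.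
  move=> s; rewrite lt_min !ltr_norml => /andP[/andP[A _] /andP[_ B]].
  have t's : t' < s by move: A ts; lra.
  have se : s < e by move: B; lra.
  have [st|st] := ltP s t0; last by right; rewrite st.
  by left; split => //; apply: (Eup _ t') => //; rewrite ltW//= ltW.
- move=> x y Ix Iy z /andP[xz zy].
  have [zt|tz] := ltP z t0; last by right; rewrite tz (le_lt_trans zy)// Ie.
  left; split => //; apply: (Eup _ x); last by rewrite xz ltW.
  by apply: ItE => //; apply: le_trans xz (ltW zt).
- move=> t It; have [tt|tt|tt] := ltgtP t t0.
  + have Et := ItE _ It (ltW tt); have [fD cg Of gw] := tg1 _ Et.
    split; rewrite ?FE//.
    * rewrite /G tt; apply: near_eq_is_derive1 fD; near=> s.
      rewrite /F ifT//; near: s; exact: lt_nbhsl.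
    * apply: near_eq_continuous cg; near=> s.
      rewrite /G ifT//; near: s; exact: lt_nbhsl.
    * by rewrite /G tt.
  + have [|fD cg Of gw] := tg t; first by rewrite /= (ltW tt) Ie.
    have tn : (t < t0) = false by rewrite ltNge (ltW tt).
    split; rewrite ?(Fe t (ltW tt))//.
    * rewrite /G tn; apply: near_eq_is_derive1 fD; near=> s.
      rewrite Fe//; apply: ltW; near: s; exact: lt_nbhsr.
    * apply: near_eq_continuous cg; near=> s.
      rewrite /G ifF//; apply/negbTE; rewrite -leNgt; apply: ltW.
      near: s; exact: lt_nbhsr.
    * by rewrite /G tn.
  + have [f1D cg1 _ _] := tg1 _ Et0.
    have ff : f1 t0 = f t0 by [].
    rewrite tt Fe//; split => //.
    * rewrite /G ltxx; apply: is_derive_glue => //.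
      by move: f1D; rewrite g1t0.
    * exact: continuous_glue.
    * by rewrite /G ltxx.
move=> q Oq; split=> qend.
  have Iq s : I s -> s <= q.1.
    move=> Is; rewrite leNgt; apply/negP => qs.
    have [|s0 Is0 /(_ (Num.max s s0))] := qend [set p | `|p.1 - q.1| < s - q.1].
      by apply/nbhs_box; exists (s - q.1); rewrite ?subr_gt0.
    have Im : I (Num.max s s0) by case: (leP s s0).
    have ms : s <= Num.max s s0 by rewrite le_max lexx.
    have ms0 : s0 <= Num.max s s0 by rewrite le_max lexx orbT.
    move=> /(_ Im ms0) /=; rewrite ger0_norm; last first.
      by rewrite subr_ge0; apply: le_trans ms; exact: ltW.
    by rewrite ltrD2r ltNge ms.
  have q1 : q.1 = e.
    apply/eqP; rewrite eq_le; apply/andP; split; rewrite leNgt; apply/negP => qe.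
      have [|s0 Is0 /(_ s0 Is0 (lexx _))] := qend [set p | `|p.1 - q.1| < q.1 - e].
        by apply/nbhs_box; exists (q.1 - e); rewrite ?subr_gt0.
      have s0e := Ie _ Is0.
      by rewrite /= ltr_norml => /andP[+ _]; move: s0e; lra.
    have [qt|qt] := ltP q.1 t0.
      have : I t0 by right.
      by move/Iq; rewrite leNgt qt.
    have : I ((q.1 + e) / 2) by right; apply/andP; split; move: qt qe; lra.
    by move/Iq; move: qe; lra.
  have q2 : q.2 = ue.
    apply/eqP; rewrite -subr_eq0 -normr_eq0; apply/negP => /negP qu.
    have d0 : 0 < `|q.2 - ue| / 2 by rewrite divr_gt0// lt_def qu normr_ge0.
    have [s0 [/andP[s0t s0e] s0P]] := flim _ d0.
    have [|s1 Is1 s1P] := qend [set p | `|p.2 - q.2| < `|q.2 - ue| / 2].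
      by apply/nbhs_box; exists (`|q.2 - ue| / 2).
    pose s := Num.max s0 s1.
    have s0s : s0 <= s by rewrite le_max lexx.
    have s1s : s1 <= s by rewrite le_max lexx orbT.
    have se : s < e by rewrite gt_max s0e Ie.
    have ts : t0 <= s by apply: le_trans s0s.
    have Is : I s by right; rewrite ts.
    have A := s1P _ Is s1s; have := s0P s; rewrite s0s se => /(_ isT).
    move: A; rewrite /= Fe// => A B.
    have : `|q.2 - ue| <= `|f s - q.2| + `|f s - ue|.
      by rewrite (distrC (f s) q.2) ler_distD.
    by apply/negP; rewrite -ltNge [ltRHS]splitr; exact: ltrD.
  by apply: nOe; move: Oq; rewrite (surjective_pairing q) q1 q2.
apply: (noend q) => // U /qend[s0 Is0 s0P].
have [st|st] := ltP s0 t0.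
  exists s0; first exact: ItE (ltW st).
  by move=> s Es ss; have := s0P s (EI s Es) ss; rewrite /graph FE.
exists t0 => // s Es ss; have := s0P s (EI s Es) (le_trans ss st).
by rewrite /graph FE.
Unshelve. all: by end_near. Qed.

End Shadowing.

Section ExitTime.
Variable R : realType.
Variable P : R -> R -> R -> Prop.
Hypothesis P_anti : forall r r' s h, 0 < r' -> r' <= r -> P r s h -> P r' s h.

Definition locally_safe (t : R) := exists r, [/\ 0 < r, r <= 1 &
  forall s h, `|s - t| < r -> `|h| < r -> P r s h].

(** [OK e] will say that the point of the line at time [e] is in the domain.
    Where the safe radius first vanishes this must fail, since room around that
    point would extend the safe radius. *)
Lemma exit_time (OK : set R) (t0 : R) : t0 < 0 -> locally_safe t0 ->
  (forall e, t0 < e <= 0 -> (forall s, t0 <= s < e -> 0 < safe_radius P t0 s) ->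
    OK e -> locally_safe e) ->
  0 < safe_radius P t0 0 \/
  exists e, [/\ t0 < e <= 0, safe_radius P t0 e = 0,
    forall s, t0 <= s < e -> 0 < safe_radius P t0 s & ~ OK e].
Proof.
move=> t00 [r [r0 r1 rP]] ext.
set rho := safe_radius P t0.
have rge t : 0 <= rho t := safe_radius_ge0 P t0 t.
have rmon s t : s <= t -> rho t <= rho s by apply: safe_radius_nincr.
have crho : continuous rho by apply: continuous_safe_radius.
have [|r00] := ltP 0 (rho 0); [by left|right].
have rho_0 : rho 0 = 0 by apply/eqP; rewrite eq_le r00 rge.
have r20 : 0 < r / 2 by rewrite divr_gt0.
have rt0 : 0 < rho (t0 + r / 2).
  apply: (@lt_le_trans _ _ (r / 2 / 2)); first by rewrite divr_gt0.
  apply: safe_radius_init => //; first by move: r1 r0; lra.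
  move=> s h; rewrite mulrC divfK// => sr hr; apply: (@P_anti r) => //.
    by move: r0; lra.
  by apply: rP => //; apply: lt_trans hr _; move: r0; lra.
pose Z := [set s | t0 <= s /\ rho s = 0].
have Z0 : Z 0 by split => //; exact: ltW.
have Zne : Z !=set0 by exists 0.
have Zlb : has_lbound Z by exists t0 => s [].
have infP s : t0 <= s -> s < inf Z -> 0 < rho s.
  move=> ts sZ; rewrite lt_def rge andbT; apply/eqP => rs.
  by have := ge_inf Zlb (conj ts rs : Z s); rewrite leNgt sZ.
pose e := inf Z.
have te : t0 + r / 2 <= e.
  apply: lb_le_inf => // s [ts rs]; rewrite leNgt; apply/negP => /ltW/rmon.
  by rewrite rs leNgt rt0.
have te' : t0 < e by apply: lt_le_trans te; rewrite ltrDl.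
have e0 : e <= 0 by apply: ge_inf.
have re : rho e = 0.
  apply/eqP; rewrite eq_le rge andbT leNgt; apply/negP => re.
  have /continuous_eps/(_ _ re)/near_ball1[d d0 dP] := crho e.
  have [s [ts rs] sd] := inf_adherent d0 (conj Zne Zlb).
  have es : e <= s := ge_inf Zlb (conj ts rs : Z s).
  have /dP : `|s - e| < d by rewrite ger0_norm ?subr_ge0// ltrBlDl.
  by rewrite rs sub0r normrN gtr0_norm// ltxx.
exists e; split=> //; first by rewrite te'.
  by move=> s /andP[ts se]; exact: infP.
move=> OKe; have [||d [d0 d1 dP]] := ext e _ _ OKe; first by rewrite te'.
  by move=> s /andP[ts se]; exact: infP.
pose t' := Num.max t0 (e - d / 2).
have : 0 < rho (e + d / 2).
  apply: (@safe_radius_extend R P P_anti t0 e t' d d0 d1) => //.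
    by rewrite lt_max; apply/orP; right; move: d0; lra.
  apply: infP; first by rewrite le_max lexx.
  by rewrite gt_max te'/=; move: d0; rewrite -/e; lra.
have ed : e <= e + d / 2 by rewrite lerDl divr_ge0// ltW.
by move/lt_le_trans/(_ (rmon _ _ ed)); rewrite re ltxx.
Qed.

End ExitTime.

Section NullSegments.
Variable R : realType.

(** If the segment left [O] at time [e], the graph [u0 - eta t], where [eta]
    decays within the safe radius, would tend to the point of exit. Its slope
    lies between [0] and the safe radius, which is smaller than [w] around the
    segment. *)
Lemma vertical_segment_future (O : set (R * R)) (w : R * R -> R) (t0 u0 : R) :
  open O -> (forall q, O q -> {for q, continuous w}) ->
  (forall q, O q -> 0 < w q) -> abstract_gh O w ->
  O (t0, u0) -> t0 < 0 -> forall s, t0 <= s <= 0 -> O (s, u0).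
Proof.
move=> oO cw w0 gh Oq t00.
pose P := vertical_safe O w u0.
have Panti := @vertical_safe_anti R O w u0.
have Ploc (e : R) : O (e, u0) -> locally_safe P e.
  by move=> /(vertical_safe_local oO cw w0).
set rho := safe_radius P t0.
have rmon s t : s <= t -> rho t <= rho s by apply: safe_radius_nincr.
have crho : continuous rho by apply: continuous_safe_radius.
have rhoP t h : t0 <= t -> 0 < rho t -> `|h| < rho t -> P (rho t) t h.
  by apply: safe_radiusP.
have [r0|[e [/andP[te e0] re rpos nOe]]] :=
    @exit_time R P Panti [set e | O (e, u0)] t0 t00 (Ploc _ Oq)
      (fun e _ _ Oe => Ploc e Oe).
  move=> s /andP[ts s0].
  have rs : 0 < rho s by apply: lt_le_trans r0 _; exact: rmon.
  have [|+ _] := rhoP s 0 ts rs; first by rewrite normr0.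
  by rewrite addr0.
rewrite -/rho in re rpos.
have [eta [deta H]] := decaying_function crho rmon rpos te.
exfalso; apply: nOe.
apply: (@no_early_exit R O w oO cw w0 gh t0 e u0 (fun t => u0 - eta t) deta te e0).
  move=> t tI; have [eD cd /andP[e1 e2] /andP[d1 d2] _] := H t tI.
  have /andP[ts _] := tI.
  have [|A B] := rhoP t (- eta t) ts (rpos _ tI).
    by rewrite normrN gtr0_norm.
  split => //; last by rewrite d1; exact: lt_trans B.
  have K := is_deriveB (is_derive_cst u0 t (1 : R)) eD.
  by apply: (is_derive_eq K); rewrite sub0r opprK.
move=> d d0; have /continuous_eps/(_ _ d0)/near_ball1[b b0 bP] := crho e.
exists (Num.max t0 (e - b / 2)); split.
  by rewrite le_max lexx gt_max te /=; move: b0; lra.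
move=> s; rewrite ge_max => /andP[/andP[ts se] se'].
have sI : t0 <= s < e by rewrite ts.
have [_ _ /andP[e1 e2] _ _] := H s sI.
have := bP s; rewrite re subr0 => K.
have {K} : `|rho s| < d.
  by apply: K; rewrite ltr_norml; apply/andP; split; move: se se' b0; lra.
rewrite gtr0_norm ?rpos// => K.
rewrite addrAC subrr sub0r normrN gtr0_norm//; exact: lt_trans K.
Qed.

(** The last clause is a Lipschitz bound: [w] differs from its value [a] on the
    line by at most [|h| / r] at distance [h]. *)
Definition line_safe (O : set (R * R)) (w : R * R -> R) (l : R -> R) (a : R)
    (r s h : R) :=
  [/\ O (s, l s + h), r <= a & `|w (s, l s + h) - a| * r <= `|h|].

Definition locally_lipschitz_along_lines (O : set (R * R)) (w : R * R -> R) :=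
  forall q, O q -> exists r, [/\ 0 < r, r <= 1 & forall s h,
    `|s - q.1| < r -> `|h| < r ->
    O (s, q.2 + w q * (s - q.1) + h) /\
    `|w (s, q.2 + w q * (s - q.1) + h) - w q| * r <= `|h|].

(** The point of exit is shadowed by [l + eta], of slope [a - deta]. It is
    timelike because [w] is at least [a - eta / rho] on it, and [eta / rho <
    deta]: the distance to the line decays faster than the Lipschitz bound lets
    [w] decrease. *)
Lemma characteristic_segment_future (O : set (R * R)) (w : R * R -> R)
    (t0 u0 : R) :
  open O -> (forall q, O q -> {for q, continuous w}) ->
  (forall q, O q -> 0 < w q) -> abstract_gh O w ->
  locally_lipschitz_along_lines O w ->
  O (t0, u0) -> t0 < 0 -> forall s, t0 <= s <= 0 ->
  O (s, u0 + w (t0, u0) * (s - t0)) /\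
  w (s, u0 + w (t0, u0) * (s - t0)) = w (t0, u0).
Proof.
move=> oO cw w0 gh lip Oq t00.
set a := w (t0, u0); have a0 : 0 < a by exact: w0.
pose l s : R := u0 + a * (s - t0).
pose P := line_safe O w l a.
have Panti r r' s h : 0 < r' -> r' <= r -> P r s h -> P r' s h.
  move=> r0 rr [A B C]; split => //; first exact: le_trans B.
  by apply: le_trans C; rewrite ler_wpM2l.
have Ploc (e : R) : O (e, l e) -> w (e, l e) = a -> locally_safe P e.
  move=> /lip[r [r0 r1 rP]] we.
  have m0 : 0 < Num.min r a by rewrite lt_min r0.
  have mr : Num.min r a <= r by rewrite ge_min lexx.
  exists (Num.min r a); split => //; first exact: le_trans r1.
  move=> s h; rewrite !lt_min => /andP[sr _] /andP[hr _].
  have [] := rP s h sr hr; rewrite we /=.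
  have -> : l e + a * (s - e) = l s by rewrite /l; ring.
  move=> A B; split => //; first by rewrite ge_min lexx orbT.
  by apply: le_trans B; rewrite ler_wpM2l.
have lt0 : l t0 = u0 by rewrite /l subrr mulr0 addr0.
set rho := safe_radius P t0.
have rmon s t : s <= t -> rho t <= rho s by apply: safe_radius_nincr.
have crho : continuous rho by apply: continuous_safe_radius.
have rhoP t h : t0 <= t -> 0 < rho t -> `|h| < rho t -> P (rho t) t h.
  by apply: safe_radiusP.
have on_line s : t0 <= s -> 0 < rho s -> O (s, l s) /\ w (s, l s) = a.
  move=> ts rs; have [|+ _ +] := rhoP s 0 ts rs; first by rewrite normr0.
  rewrite addr0 normr0 => Os H; split => //.
  apply/eqP; rewrite -subr_eq0 -normr_eq0 eq_le normr_ge0 andbT leNgt.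
  by apply/negP => K; move: (mulr_gt0 K rs); rewrite ltNge H.
have lD (s : R) : is_derive s 1 l a.
  have H := is_deriveB (is_derive_id s (1 : R)) (is_derive_cst t0 s (1 : R)).
  have K := is_deriveD (is_derive_cst u0 s (1 : R)) (is_deriveZ a H).
  by apply: (is_derive_eq K); rewrite subr0 add0r /GRing.scale /= mulr1.
have cl s : O (s, l s) -> {for s, continuous (fun s => w (s, l s))}.
  move=> Os; apply: (@continuous_comp _ _ _ (fun s => (s, l s)) w).
    have ci : {for s, continuous (fun x : R => x)} by exact: cvg_id.
    by move=> A; exact: (cvg_pair ci (is_derive1_continuous (lD s))).
  exact: cw.
have L0 : locally_safe P t0 by apply: Ploc; rewrite lt0.
have ext e : t0 < e <= 0 -> (forall s, t0 <= s < e -> 0 < rho s) ->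
    O (e, l e) -> locally_safe P e.
  move=> /andP[te e0] rpos Oe; apply: Ploc => //.
  apply/eqP; rewrite -subr_eq0 -normr_eq0; apply/negP => /negP ne.
  have n0 : 0 < `|w (e, l e) - a| by rewrite lt_def ne normr_ge0.
  have /continuous_eps/(_ _ n0)/near_ball1[d d0 dP] := cl _ Oe.
  pose s := Num.max t0 (e - d / 2).
  have ts : t0 <= s by rewrite le_max lexx.
  have es : e - d / 2 <= s by rewrite le_max lexx orbT.
  have se : s < e by rewrite gt_max te/=; move: d0; lra.
  have [|_ ws] := on_line s ts; first by apply: rpos; rewrite ts.
  have /dP : `|s - e| < d.
    by rewrite ltr_norml; apply/andP; split; move: se es d0; lra.
  by rewrite ws distrC ltxx.
have [r0|[e [/andP[te e0] re rpos nOe]]] :=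
    @exit_time R P Panti [set e | O (e, l e)] t0 t00 L0 ext.
  move=> s /andP[ts s0]; apply: on_line => //.
  by apply: lt_le_trans r0 _; exact: rmon.
rewrite -/rho in re rpos.
have [eta [deta H]] := decaying_function crho rmon rpos te.
exfalso; apply: nOe.
apply: (@no_early_exit R O w oO cw w0 gh t0 e (l e) (fun t => l t + eta t)
  (fun t => a - deta t) te e0).
  move=> t tI; have [eD cd /andP[e1 e2] /andP[d1 d2] d3] := H t tI.
  have /andP[ts _] := tI; have rt := rpos _ tI.
  have [|A B C] := rhoP t (eta t) ts rt; first by rewrite gtr0_norm.
  split => //.
  - exact: (is_deriveD (lD t) eD).
  - by apply: (@continuousB _ _ _ (fun=> a)) => //; exact: cvg_cst.
  - rewrite subr_gt0 (lt_le_trans d2)//=.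
    have : `|w (t, l t + eta t) - a| <= eta t / rho t.
      by rewrite ler_pdivlMr//; move: C; rewrite (gtr0_norm e1).
    rewrite ler_norml => /andP[+ _].
    move: (w _) (eta t / rho t) (deta t) d3 => x y z; lra.
move=> d d0; have d20 : 0 < d / 2 by rewrite divr_gt0.
have /continuous_eps/(_ _ d20)/near_ball1[b b0 bP] := crho e.
have /continuous_eps/(_ _ d20)/near_ball1[b' b0' bP'] :=
  is_derive1_continuous (lD e).
pose b1 := Num.min b b'; have b10 : 0 < b1 by rewrite lt_min b0.
exists (Num.max t0 (e - b1 / 2)); split.
  by rewrite le_max lexx gt_max te /=; move: b10; lra.
move=> s; rewrite ge_max => /andP[/andP[ts se] se'].
have sI : t0 <= s < e by rewrite ts.
have [_ _ /andP[e1 e2] _ _] := H s sI.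
have : `|s - e| < b1.
  by rewrite ltr_norml; apply/andP; split; move: se se' b10; lra.
rewrite lt_min => /andP[/bP + /bP'].
rewrite re subr0 gtr0_norm ?rpos// => K1 K2.
rewrite addrAC; apply: le_lt_trans (ler_normD _ _) _.
by rewrite [ltRHS]splitr ltrD// gtr0_norm//; exact: lt_trans K1.
Qed.

Lemma vertical_segment (O : set (R * R)) (w : R * R -> R) (t0 u0 : R) :
  open O -> (forall q, O q -> {for q, continuous w}) ->
  (forall q, O q -> 0 < w q) -> abstract_gh O w ->
  O (t0, u0) ->
  forall s, Num.min t0 0 <= s <= Num.max t0 0 -> O (s, u0).
Proof.
move=> oO cw w0 gh Oq s; have [t00|t00|E] := ltgtP t0 0.
- exact: (@vertical_segment_future _ w).
- move=> /andP[s0 st].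
  have w0' q : [set q | O (rfl q)] q -> 0 < (w \o @rfl R) q by move=> /= /w0.
  have Oq' : [set q | O (rfl q)] (- t0, - u0) by rewrite /= /rfl /= !opprK.
  have t00' : - t0 < 0 by rewrite oppr_lt0.
  have sI : - t0 <= - s <= 0 by rewrite lerN2 st oppr_le0 s0.
  have := vertical_segment_future (open_rfl oO) (continuous_rfl cw) w0'
    (abstract_gh_rfl gh) Oq' t00' sI.
  by rewrite /= /rfl /= !opprK.
- by rewrite -eq_le => /eqP <-.
Qed.

Lemma characteristic_segment (O : set (R * R)) (w : R * R -> R)
    (t0 u0 : R) :
  open O -> (forall q, O q -> {for q, continuous w}) ->
  (forall q, O q -> 0 < w q) -> abstract_gh O w ->
  locally_lipschitz_along_lines O w ->
  O (t0, u0) -> forall s, Num.min t0 0 <= s <= Num.max t0 0 ->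
  O (s, u0 + w (t0, u0) * (s - t0)) /\
  w (s, u0 + w (t0, u0) * (s - t0)) = w (t0, u0).
Proof.
move=> oO cw w0 gh lip Oq s; have [t00|t00|E] := ltgtP t0 0.
- exact: characteristic_segment_future.
- move=> /andP[s0 st].
  have w0' q : [set q | O (rfl q)] q -> 0 < (w \o @rfl R) q by move=> /= /w0.
  have Oq' : [set q | O (rfl q)] (- t0, - u0) by rewrite /= /rfl /= !opprK.
  have t00' : - t0 < 0 by rewrite oppr_lt0.
  have sI : - t0 <= - s <= 0 by rewrite lerN2 st oppr_le0 s0.
  have lip' : locally_lipschitz_along_lines [set q | O (rfl q)] (w \o @rfl R).
    move=> q /lip[r [r0 r1 rP]]; exists r; split => // s' h sq hr.
    have [||] := rP (- s') (- h); rewrite ?normrN//.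
      by rewrite /= opprK addrC -normrN opprD opprK addrC.
    rewrite /= /rfl /= => A B.
    have E : - (q.2 + w (- q.1, - q.2) * (s' - q.1) + h) =
      - q.2 + w (- q.1, - q.2) * (- s' - - q.1) - h by move: (w _) => x; ring.
    by rewrite E.
  have := characteristic_segment_future (open_rfl oO) (continuous_rfl cw) w0'
    (abstract_gh_rfl gh) lip' Oq' t00' sI.
  by rewrite /= /rfl /= !opprK opprD -mulrN opprD !opprK.
- by rewrite -eq_le => /eqP <-; rewrite subrr mulr0 addr0.
Qed.

End NullSegments.

(** Gronwall: [expR (2 K s) * G^2] is nondecreasing and [expR (- 2 K s) * G^2]
    is nonincreasing. *)
Lemma linear_ode_zero (R : realType) (G a : R -> R) (s0 r K : R) :
  G s0 = 0 -> (forall s, `|s - s0| < r -> is_derive s 1 G (a s * G s)) ->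
  (forall s, `|s - s0| < r -> `|a s| <= K) ->
  forall s, `|s - s0| < r -> G s = 0.
Proof.
move=> G0 GD aK s sr.
have near_s x : Num.min s s0 <= x <= Num.max s s0 -> `|x - s0| < r.
  move: sr; have [ss|ss] := leP s s0; rewrite !ltr_norml => /andP[A B] /andP[C D];
    apply/andP; split; lra.
have ED (c x : R) : `|x - s0| < r -> is_derive x 1
    (fun y => expR (c * (y - s0)) * (G y * G y))
    (expR (c * (x - s0)) * ((c + 2 * a x) * (G x * G x))).
  move=> xr; have H := is_deriveZ c (is_deriveB (is_derive_id x (1 : R))
    (is_derive_cst s0 x (1 : R))).
  have K1 : is_derive x 1 (fun y => expR (c * (y - s0))) _ :=
    @is_derive1_comp R expR (fun y => c * (y - s0)) x _ _
      (is_derive_expR (c * (x - s0))) H.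
  have K2 := is_deriveM K1 (is_deriveM (GD x xr) (GD x xr)).
  apply: (is_derive_eq K2); rewrite /GRing.scale /= subr0 mulr1 !fctE.
  by move: (expR _) (G x) (a x) => y z t; ring.
have aK' x : `|x - s0| < r -> - K <= a x <= K.
  by move=> /aK; rewrite ler_norml.
suff : G s * G s <= 0.
  by rewrite -expr2 => H; apply/eqP; rewrite -sqrf_eq0 eq_le H sqr_ge0.
have [ss|ss] := leP s s0.
  have : expR (2 * K * (s - s0)) * (G s * G s) <=
         expR (2 * K * (s0 - s0)) * (G s0 * G s0).
    apply: (@derive_ge0_le _ _ _ s s0 ss (fun x xI => ED (2 * K) x (near_s x _))).
      by rewrite min_l// max_r.
    move=> x xI; have /aK'/andP[A B] : `|x - s0| < r.
      by apply: near_s; rewrite min_l// max_r.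
    rewrite mulr_ge0 ?expR_ge0// mulr_ge0//; last by rewrite -expr2 sqr_ge0.
    by move: A; lra.
  by rewrite G0 !mulr0 pmulr_rle0// expR_gt0.
have : - (expR (- (2 * K) * (s0 - s0)) * (G s0 * G s0)) <=
       - (expR (- (2 * K) * (s - s0)) * (G s * G s)).
  apply: (@derive_ge0_le _ _ _ s0 s (ltW ss)
     (fun x xI => is_deriveN (ED (- (2 * K)) x (near_s x _)))).
    by rewrite min_r ?max_l// ltW.
  move=> x xI; have /aK'/andP[A B] : `|x - s0| < r.
    by apply: near_s; rewrite min_r ?max_l// ltW.
  rewrite -mulrN mulr_ge0 ?expR_ge0// -mulNr mulr_ge0//; last by rewrite -expr2 sqr_ge0.
  by move: B; lra.
by rewrite G0 !mulr0 oppr0 oppr_ge0 pmulr_rle0// expR_gt0.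
Qed.

(** * Null segments of a solution of the transport equation *)

Section BurgersSegments.
Variable R : realType.
Variables (Om : set (R * R)) (ps px : R * R -> R).
Hypothesis oOm : open Om.
Hypothesis burgers : forall p, Om p -> has_grad ps p (- (2 + ps p) * px p) (px p).
Hypothesis cpx : forall p, Om p -> {for p, continuous px}.
Hypothesis nz : forall p, Om p -> 4 + ps p != 0.
Hypothesis slice : forall x, Om (0, x) /\ 0 < 4 + ps (0, x).

(** From the coordinates [(t, u)] back to [(t, x)]. *)
Definition unshear (q : R * R) : R * R := (q.1, q.2 - 2 * q.1).

Hypothesis gh : forall (I : set R) (f g : R -> R),
  I !=set0 -> open I -> is_interval I ->
  (forall t, I t -> [/\ is_derive t 1 f (g t), {for t, continuous g},
     Om (unshear (graph f t)) &
     g t * (g t - (4 + ps (unshear (graph f t)))) < 0]) ->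
  (forall q, Om (unshear q) -> ~ upper_endpoint I (graph f) q /\
                               ~ lower_endpoint I (graph f) q) -> I 0.

Let w (q : R * R) : R := 4 + ps (unshear q).

Lemma unshear_near (q : R * R) (e s x : R) : 
  `|s - q.1| < e / 3 -> `|x - q.2| < e / 3 ->
  `|(unshear (s, x)).1 - (unshear q).1| < e /\
  `|(unshear (s, x)).2 - (unshear q).2| < e.
Proof.
rewrite /= !ltr_norml => /andP[a b] /andP[c d].
by split; apply/andP; split; lra.
Qed.

Lemma continuous_comp_unshear (f : R * R -> R) q :
  {for unshear q, continuous f} -> {for q, continuous (f \o unshear)}.
Proof.
move=> /continuous_box cf; apply/continuous_box => e /cf[d d0 dP].
exists (d / 3); first by rewrite divr_gt0.
by move=> s x sq xq; have [A B] := unshear_near sq xq; exact: dP.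
Qed.

Lemma open_preimage_unshear (A : set (R * R)) : open A ->
  open [set q | A (unshear q)].
Proof.
move=> oA; apply: open_boxes => q Aq; have [e e0 eP] := open_box oA Aq.
exists (e / 3); first by rewrite divr_gt0.
by move=> s x sq xq; have [C B] := unshear_near sq xq; exact: eP.
Qed.

Lemma continuous_w q : Om (unshear q) -> {for q, continuous w}.
Proof.
move=> Oq; apply/continuous_box => e e0.
have [d d0 dP] := (continuous_box _ q).1
  (continuous_comp_unshear (has_grad_continuous (burgers Oq))) e e0.
by exists d => // s x sq xq; rewrite /w opprD addrACA subrr add0r; exact: dP.
Qed.

Lemma sign_box q : Om (unshear q) -> exists2 e, 0 < e & forall s x,
  `|s - q.1| < e -> `|x - q.2| < e -> 0 < w q * w (s, x).
Proof.
move=> Oq; have wq : w q != 0 by exact: nz.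
have n0 : 0 < `|w q| by rewrite normr_gt0.
have [d d0 dP] := (continuous_box w q).1 (continuous_w Oq) _ n0.
exists d => // s x sq xq; have := dP s x sq xq.
move: (w q) (w (s, x)) wq n0 => a b a0 _.
have [an|ap|e] := ltgtP a 0; last by rewrite e eqxx in a0.
  rewrite (ltr0_norm an) ltr_norml opprK => /andP[_ H].
  by rewrite nmulr_rgt0//; lra.
rewrite (gtr0_norm ap) ltr_norml => /andP[H _].
by rewrite pmulr_rgt0//; lra.
Qed.

Let O : set (R * R) := [set q | Om (unshear q) /\ 0 < w q].

Lemma open_pos : open O.
Proof.
apply: open_boxes => q [Oq wq].
have [e e0 eP] := open_box (open_preimage_unshear oOm) Oq.
have [d d0 dP] := sign_box Oq.
exists (Num.min e d); first by rewrite lt_min e0.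
move=> s x; rewrite !lt_min => /andP[s1 s2] /andP[x1 x2]; split; first exact: eP.
by have := dP s x s2 x2; rewrite pmulr_rgt0.
Qed.

(** An endpoint where [w] is negative is impossible for a curve along which [w]
    is positive, so that having no endpoint in the part where [w] is positive is
    the same as having none at all. *)
Lemma gh_pos : abstract_gh O w.
Proof.
move=> I f g I0 oI iI tg noend; apply: (gh I0 oI iI (f := f) (g := g)).
  move=> t It; have [fD cg [Of wf] /andP[g0 gw]] := tg t It.
  by split => //; rewrite pmulr_rlt0// subr_lt0.
move=> q Oq; have [|wq] := ltP 0 (w q); first by move=> ?; exact: noend.
have wq0 : w q < 0 by rewrite lt_neqAle wq andbT; exact: nz.
have [e e0 eP] := sign_box Oq.
have nbh : nbhs q [set p | 0 < w q * w p].
  by apply/nbhs_box; exists e => // s x; exact: eP.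
split => /(_ _ nbh)[s0 Is0 /(_ s0 Is0 (lexx _))] /=.
  by have [_ _ [_ w0] _] := tg s0 Is0; rewrite nmulr_rgt0// ltNge ltW.
by have [_ _ [_ w0] _] := tg s0 Is0; rewrite nmulr_rgt0// ltNge ltW.
Qed.

(** Where [w] is negative the timelike graphs have slopes between [w] and [0];
    changing the sign of [u] makes [- w] play the role of [w]. *)
Let flip (q : R * R) : R * R := (q.1, - q.2).
Let On : set (R * R) := [set q | Om (unshear (flip q)) /\ w (flip q) < 0].
Let wn (q : R * R) := - w (flip q).

Lemma flip_near (q : R * R) (e s x : R) :
  `|s - q.1| < e -> `|x - q.2| < e ->
  `|s - (flip q).1| < e /\ `|- x - (flip q).2| < e.
Proof. by move=> ? H; split => //=; rewrite -opprD normrN. Qed.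

Lemma open_neg : open On.
Proof.
apply: open_boxes => q [Oq wq].
have [e e0 eP] := open_box (open_preimage_unshear oOm) Oq.
have [d d0 dP] := sign_box Oq.
exists (Num.min e d); first by rewrite lt_min e0.
move=> s x; rewrite !lt_min => /andP[s1 s2] /andP[x1 x2].
have [A1 A2] := flip_near s1 x1; have [B1 B2] := flip_near s2 x2.
split; first exact: eP.
by have := dP _ _ B1 B2; rewrite nmulr_rgt0.
Qed.

Lemma continuous_neg q : On q -> {for q, continuous wn}.
Proof.
move=> [Oq _]; apply/continuous_box => e e0.
have [d d0 dP] := (continuous_box w (flip q)).1 (continuous_w Oq) e e0.
exists d => // s x sq xq; have [A B] := flip_near sq xq.
by rewrite /wn -opprD normrN; exact: dP.
Qed.

Lemma gh_neg : abstract_gh On wn.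
Proof.
move=> I f g I0 oI iI tg noend.
have E t : flip (graph f t) = graph (fun s => - f s) t by [].
apply: (gh I0 oI iI (f := fun s => - f s) (g := fun s => - g s)).
  move=> t It; have [fD cg [Of wf] /andP[g0 gw]] := tg t It.
  split => //.
  - exact: is_deriveN.
  - exact: continuousN.
  have gw' : g t < - (4 + ps (unshear (graph (fun s => - f s) t))) by [].
  rewrite mulNr -mulrN opprD !opprK pmulr_rlt0//.
  by move: (4 + _) gw' => x; lra.
have Eend (q : R * R) (P : set (R * R)) : nbhs (flip q) P -> nbhs q [set p | P (flip p)].
  move=> /nbhs_box[e e0 eP]; apply/nbhs_box; exists e => // s x sq xq.
  have [|A B] := @flip_near (flip q) e s (- x) sq.
    by rewrite /= opprK addrC -normrN opprD opprK addrC.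
  by apply: eP => //; rewrite /= -opprD normrN.
move=> q Oq; have [wq|wq] := ltP (w q) 0.
  have [|A B] := noend (flip q).
    by split; rewrite /flip /= opprK -surjective_pairing.
  split=> H; [apply: A|apply: B] => U /Eend/H [s0 Is0 s0P];
    by exists s0 => // s Is ss; have := s0P s Is ss; rewrite /= /flip /graph /= opprK.
have wq0 : 0 < w q by rewrite lt_neqAle wq andbT eq_sym; exact: nz.
have [e e0 eP] := sign_box Oq.
have nbh : nbhs q [set p | 0 < w q * w p].
  by apply/nbhs_box; exists e => // s x; exact: eP.
split => /(_ _ nbh)[s0 Is0 /(_ s0 Is0 (lexx _))] /=;
  have [_ _ [_ w0] _] := tg s0 Is0; rewrite pmulr_rgt0// ltNge ltW//.
Qed.

(** If [w] were negative at a point, it would be negative on the line [u =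
    const] through it down to the time [0], where it is positive. *)
Lemma w_pos q : Om (unshear q) -> 0 < w q.
Proof.
move=> Oq; rewrite ltNge le_eqVlt; apply/negP => /orP[/eqP wq|wq].
  by have := nz Oq; rewrite -/(w q) wq eqxx.
have Oq' : On (q.1, - q.2).
  by split; rewrite /flip /= opprK -surjective_pairing.
have wn0 p : On p -> 0 < wn p by move=> [_ ?]; rewrite oppr_gt0.
have [|_] := vertical_segment open_neg continuous_neg wn0 gh_neg Oq' (s := 0).
  by rewrite ge_min le_max lexx !orbT.
have [_] := slice (q.2).
by rewrite /flip /w /unshear /= opprK mulr0 subr0 ltNge => /negP H /ltW.
Qed.

Lemma OmE q : Om q -> O (q.1, q.2 + 2 * q.1).
Proof.
move=> Oq; have Oq' : Om (unshear (q.1, q.2 + 2 * q.1)).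
  by rewrite /unshear /= addrK -surjective_pairing.
by split => //; exact: w_pos.
Qed.

Lemma Lbar_segment (q : R * R) (s : R) : Om q ->
  Num.min q.1 0 <= s <= Num.max q.1 0 -> Om (s, q.2 - 2 * (s - q.1)).
Proof.
move=> /OmE Oq sI.
have cO p : O p -> {for p, continuous w} by move=> [? _]; exact: continuous_w.
have [+ _] := vertical_segment open_pos cO (fun p => @proj2 _ _) gh_pos Oq sI.
by rewrite /unshear /= mulrBr opprB addrA addrAC.
Qed.

(** On the line of slope [2 + c], where [c] is the value at [q], the difference
    [ps - c] solves a homogeneous linear equation with zero initial value, so it
    vanishes; off the line, [ps] is Lipschitz because [px] is bounded near [q]. *)
Lemma lipschitz_along_lines : locally_lipschitz_along_lines O w.
Proof.
move=> q [Oq wq].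
pose p := unshear q; set c := ps p; have wE : w q = 4 + c by [].
have [e e0 eP] := open_box oOm Oq.
have [d d0 dP] := (continuous_box px p).1 (cpx Oq) 1 ltr01.
pose K := `|px p| + 1; have K0 : 0 < K by rewrite ltr_wpDl.
have pK s x : `|s - p.1| < d -> `|x - p.2| < d -> `|px (s, x)| <= K.
  move=> sp xp; have := dP s x sp xp.
  rewrite -[px (s, x)](subrK (px p)) => H.
  apply: le_trans (ler_normD _ _) _; rewrite addrC lerD2l.
  by move: H; rewrite subrK => /ltW.
pose M := 3 + `|2 + c|; have M0 : 0 < M by rewrite ltr_wpDr.
have M1 : 1 <= M by rewrite /M; move: (normr_ge0 (2 + c)); lra.
pose r := Num.min (Num.min 1 K^-1) (Num.min e d / M).
have r0 : 0 < r by rewrite !lt_min ltr01 invr_gt0 K0 divr_gt0// lt_min e0.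
have r1 : r <= 1 by rewrite !ge_min lexx.
have rK : K * r <= 1.
  by rewrite mulrC -ler_pdivlMr// div1r /r !ge_min lexx orbT.
have rM : r * M <= Num.min e d.
  by rewrite -ler_pdivlMr// /r !ge_min lexx !orbT.
clearbody r.
pose b (s : R) : R := q.2 + (4 + c) * (s - q.1) - 2 * s.
have bq : b q.1 = p.2 by rewrite /b subrr mulr0 addr0.
have near_line s h : `|s - q.1| < r -> `|h| < r ->
    [/\ `|s - p.1| < e, `|b s + h - p.2| < e, `|s - p.1| < d &
       `|b s + h - p.2| < d].
  move=> sr hr.
  have sM : `|s - q.1| < Num.min e d.
    apply: lt_le_trans rM; apply: (lt_le_trans sr).
    by rewrite ler_peMr ?(ltW r0).
  have bM : `|b s + h - p.2| < Num.min e d.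
    apply: lt_le_trans rM.
    have -> : b s + h - p.2 = (2 + c) * (s - q.1) + h by rewrite /b /p /=; ring.
    apply: le_lt_trans (ler_normD _ _) _; rewrite normrM.
    have : `|2 + c| * `|s - q.1| <= `|2 + c| * r by rewrite ler_wpM2l// ltW.
    have -> : r * M = `|2 + c| * r + 3 * r by rewrite /M; ring.
    move=> H; apply: ler_ltD => //; apply: (lt_trans hr).
    by move: r0; lra.
  by move: sM bM; rewrite !lt_min => /andP[? ?] /andP[? ?].
exists r; split => // s h sr hr.
have [A1 A2 A3 A4] := near_line s h sr hr.
have bD (x : R) : is_derive x 1 b (2 + c).
  have H := is_deriveB (is_derive_id x (1 : R)) (is_derive_cst q.1 x (1 : R)).
  have H2 := is_deriveB (is_deriveD (is_derive_cst q.2 x (1 : R)) (is_deriveZ (4 + c) H))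
    (is_deriveZ 2 (is_derive_id x (1 : R))).
  apply: (is_derive_eq H2); rewrite subr0 add0r /GRing.scale /= !mulr1; ring.
have z0 : `|0 : R| < r by rewrite normr0.
have onl : ps (s, b s) = c.
  apply/eqP; rewrite -subr_eq0; apply/eqP.
  apply: (@linear_ode_zero R (fun s => ps (s, b s) - c)
    (fun s => - px (s, b s)) q.1 r K) sr.
  - by rewrite bq -[(q.1, p.2)]/p subrr.
  - move=> x xr; have [B1 B2 _ _] := near_line x 0 xr z0.
    have {B1 B2} Ox : Om (x, b x).
      by apply: eP => //; rewrite -[b x]addr0.
    have H := has_grad_curve (burgers Ox) (is_derive_id x (1 : R)) (bD x).
    apply: (is_derive_eq (is_deriveB H (is_derive_cst c x (1 : R)))).
    rewrite subr0 mulr1; move: (ps _) (px _) => y z; ring.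
  - move=> x xr; rewrite normrN.
    have [_ _ B3 B4] := near_line x 0 xr z0.
    by apply: pK => //; rewrite -[b x]addr0.
have E : unshear (s, q.2 + w q * (s - q.1) + h) = (s, b s + h).
  by rewrite /unshear /b wE /=; congr pair; ring.
have Osh : Om (s, b s + h) by exact: eP.
rewrite {2}/w E; split.
  by split; [rewrite E|apply: w_pos; rewrite E].
rewrite wE opprD addrACA subrr add0r -onl.
have psD h' : `|h'| < r -> is_derive (b s + h') 1 (fun x => ps (s, x)) (px (s, b s + h')).
  move=> h'r; have [B1 B2 _ _] := near_line s h' sr h'r.
  have H := @has_grad_curve R ps (fun=> s) (fun x => x) (b s + h') 0 1 _ _
    (burgers (eP _ _ B1 B2)) (is_derive_cst s (b s + h') (1 : R))
    (is_derive_id (b s + h') (1 : R)).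
  by apply: (is_derive_eq H); rewrite mulr0 add0r mulr1.
have psK h' : `|h'| < r -> `|px (s, b s + h')| <= K.
  by move=> h'r; have [_ _ B3 B4] := near_line s h' sr h'r; exact: pK.
apply: (@le_trans _ _ (K * `|h| * r)); last first.
  by rewrite mulrAC ler_piMl.
rewrite ler_wpM2r ?(ltW r0)//.
have [h0|h0|->] := ltgtP h 0; last by rewrite addr0 subrr normr0 mulr0.
- have bh : b s + h < b s by rewrite gtrDl.
  have [|x xI E2] := @mean_value R (fun x => ps (s, x)) (fun x => px (s, x)) _ _ bh.
    move=> x /andP[x1 x2]; have := psD (x - b s); rewrite (addrC (b s)) subrK; apply.
    by move: hr; rewrite ltr0_norm// ler0_norm ?subr_le0//; lra.
  rewrite distrC E2 opprD addrA subrr sub0r normrM normrN ler_wpM2r//.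
  have := psK (x - b s); rewrite (addrC (b s)) subrK; apply.
  move: xI => /andP[x1 x2].
  by move: hr; rewrite ltr0_norm// ltr0_norm ?subr_lt0//; lra.
- have bh : b s < b s + h by rewrite ltrDl.
  have [|x xI ->] := @mean_value R (fun x => ps (s, x)) (fun x => px (s, x)) _ _ bh.
    move=> x /andP[x1 x2]; have := psD (x - b s); rewrite (addrC (b s)) subrK; apply.
    by move: hr; rewrite gtr0_norm// ger0_norm ?subr_ge0//; lra.
  rewrite addrAC subrr add0r normrM ler_wpM2r//.
  have := psK (x - b s); rewrite (addrC (b s)) subrK; apply.
  move: xI => /andP[x1 x2].
  by move: hr; rewrite gtr0_norm// gtr0_norm ?subr_gt0//; lra.
Qed.

Lemma L_segment (q : R * R) (s : R) : Om q ->
  Num.min q.1 0 <= s <= Num.max q.1 0 ->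
  Om (s, q.2 + (2 + ps q) * (s - q.1)) /\
  ps (s, q.2 + (2 + ps q) * (s - q.1)) = ps q.
Proof.
move=> /OmE Oq sI.
have cO p : O p -> {for p, continuous w} by move=> [? _]; exact: continuous_w.
have [[+ _] +] := characteristic_segment open_pos cO (fun p => @proj2 _ _) gh_pos
  lipschitz_along_lines Oq sI.
rewrite /w /unshear /= addrK -surjective_pairing.
have -> : q.2 + 2 * q.1 + (4 + ps q) * (s - q.1) - 2 * s =
  q.2 + (2 + ps q) * (s - q.1) by move: (ps q) => x; ring.
by move=> A /addrI.
Qed.

End BurgersSegments.

(** * The explicit domain and the foot of a characteristic *)

Section ExplicitDomain.
Variable R : realType.
Implicit Types (t x y z : R) (p q : R * R).

Lemma atan_lt2 y : - 2 < atan y < 2.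
Proof.
have /andP[_ p2] := pihalf_02 R.
have := atan_gtNpi2 y; have := atan_ltpi2 y; lra.
Qed.

Lemma atan_le_id y : 0 <= y -> 0 <= atan y <= y.
Proof.
move=> y0; rewrite -{1}(@atan0 R) le_atan//=.
have : y - atan y >= 0 - atan 0.
  apply: (@derive_ge0_le _ (fun x => x - atan x) (fun x => 1 - (1 + x ^+ 2)^-1)
    0 y y0) => x _.
  by rewrite subr_ge0 invf_le1 ?ltr_wpDr ?sqr_ge0// lerDl sqr_ge0.
by rewrite atan0; lra.
Qed.

Lemma atan_ge_frac y : 0 <= y -> y <= (1 + y ^+ 2) * atan y.
Proof.
rewrite le_eqVlt => /predU1P[<-|y0]; first by rewrite atan0 mulr0.
have [c /andP[c0 cy]] := mean_value y0 (fun x _ => is_derive1_atan x).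
rewrite atan0 !subr0 => ->.
have c1 : 0 < 1 + c ^+ 2 by rewrite ltr_wpDr ?sqr_ge0.
rewrite mulrA; apply: ler_peMl; first exact: ltW.
rewrite ler_pdivlMr// mul1r lerD2l.
by rewrite ler_pXn2r ?nnegrE ?ltW//.
Qed.

(** The position at time [t] on the integral curve of [L] issued from the point
    [y] of the line [t = 0], where [Psi] is [- atan y]. *)
Definition char_map t y : R := y + t * (2 - atan y).

(** A characteristic exists until the time [1 + y^2] at which it meets its
    neighbours; those with [y <= 0] end earlier, on the Cauchy horizon [u = 4]
    issued from the point [(1, 2)]. *)
Definition admissible t y :=
  t < 1 + y ^+ 2 /\ (0 < y \/ t * (4 - atan y) < 4 - y).

Definition explicit_domain : set (R * R) :=
  [set p | exists y, admissible p.1 y /\ char_map p.1 y = p.2].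

Definition foot p : R :=
  xget 0 [set y | admissible p.1 y /\ char_map p.1 y = p.2].

Lemma footP p : explicit_domain p ->
  admissible p.1 (foot p) /\ char_map p.1 (foot p) = p.2.
Proof.
move=> [y yP].
exact: (@xgetPex _ 0 [set y | admissible p.1 y /\ char_map p.1 y = p.2]
  (ex_intro _ y yP)).
Qed.

Lemma is_derive_char_map t y :
  is_derive y 1 (char_map t) (1 - t / (1 + y ^+ 2)).
Proof.
have H := is_deriveD (is_derive_id y (1 : R))
  (is_deriveZ t (is_deriveB (is_derive_cst (2 : R) y (1 : R)) (is_derive1_atan y))).
by apply: (is_derive_eq H); rewrite sub0r /GRing.scale /= mulrN.
Qed.

Lemma continuous_char_map t : continuous (char_map t).
Proof. by move=> y; exact: is_derive1_continuous (is_derive_char_map t y). Qed.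

Lemma char_map_lt t y1 y2 : y1 < y2 ->
  (forall y, y1 < y < y2 -> t < 1 + y ^+ 2) -> char_map t y1 < char_map t y2.
Proof.
move=> y12 H; apply: (@derive_gt0_lt _ _ (fun y => 1 - t / (1 + y ^+ 2)) _ _ y12) => y yI.
  exact: is_derive_char_map.
by rewrite subr_gt0 ltr_pdivrMr ?mul1r ?H// ltr_wpDr ?sqr_ge0.
Qed.

Lemma char_map_u t y : char_map t y + 2 * t = y + t * (4 - atan y).
Proof. by rewrite /char_map; ring. Qed.

(** At time [1] the value of [u] exceeds [4] by [y - atan y], and it increases
    with [t]. *)
Lemma right_branch_u t y : 1 <= t -> 0 < y -> 4 < char_map t y + 2 * t.
Proof.
move=> t1 y0; rewrite char_map_u.
have /andP[a0 ay] := atan_le_id (ltW y0); have /andP[_ a2] := atan_lt2 y.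
have ay' : atan y < y.
  have [c /andP[c0 cy]] := mean_value y0 (fun x _ => is_derive1_atan x).
  rewrite atan0 !subr0 => ->; rewrite gtr_pMl// invf_lt1; first by rewrite ltrDl exprn_gt0.
  by rewrite ltr_wpDr ?sqr_ge0.
have : 4 - atan y <= t * (4 - atan y) by rewrite ler_peMl//; lra.
lra.
Qed.

Lemma left_branch_u t y : admissible t y -> y <= 0 -> char_map t y + 2 * t < 4.
Proof. by move=> [_ [|H]] y0; rewrite ?ltNge ?y0// char_map_u; lra. Qed.

(** For [y <= 0] the horizon comes first: [4 - y <= (1 + y^2) * (4 - atan y)],
    by [atan_ge_frac] at [- y]. *)
Lemma admissible_neg t y : y <= 0 -> t * (4 - atan y) < 4 - y -> admissible t y.
Proof.
move=> y0 H; split; last by right.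
have k0 : 0 <= - y by rewrite oppr_ge0.
have := atan_ge_frac k0; rewrite atanN sqrrN => A.
have /andP[a1 a2] := atan_lt2 y.
have a4 : 0 < 4 - atan y by lra.
rewrite -(ltr_pM2r a4); apply: (lt_le_trans H).
have : 0 <= y ^+ 2 by rewrite sqr_ge0.
by move: A; move: (atan y) (y ^+ 2) => a b A b0; lra.
Qed.

(** Up to time [1] the map [char_map t] is increasing everywhere; later it is
    increasing on the admissible [y] of each sign, and the line [u = 4]
    separates the two images. *)
Lemma admissible_inj t y1 y2 : admissible t y1 -> admissible t y2 ->
  char_map t y1 = char_map t y2 -> y1 = y2.
Proof.
wlog y12 : y1 y2 / y1 < y2.
  move=> H A1 A2 E; have [l|l|//] := ltgtP y1 y2; first exact: H.
  exact: (esym (H _ _ l A2 A1 (esym E))).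
move=> A1 A2 E; exfalso; suff : char_map t y1 < char_map t y2 by rewrite E ltxx.
have [t1|t1] := ltP t 1.
  apply: char_map_lt => // y _; apply: (lt_le_trans t1).
  by rewrite lerDl sqr_ge0.
have [y20|y20] := leP y2 0.
  apply: char_map_lt => // y /andP[_ yy2]; apply: lt_le_trans (proj1 A2) _.
  by rewrite lerD2l -subr_ge0 subr_sqr mulr_le0//; move: yy2 y20; lra.
have [y10|y10] := leP y1 0.
  have := left_branch_u A1 y10; have := right_branch_u t1 y20.
  by rewrite E; lra.
apply: char_map_lt => // y /andP[yy1 _]; apply: lt_trans (proj1 A1) _.
by rewrite ltrD2l ltr_pXn2r ?nnegrE ?ltW//; exact: lt_trans yy1.
Qed.

Lemma footE p y : admissible p.1 y -> char_map p.1 y = p.2 -> foot p = y.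
Proof.
move=> Ay Ey; have [|A E] := @footP p; first by exists y.
by apply: (admissible_inj A Ay); rewrite E.
Qed.

Lemma explicit_domain_early p : p.1 < 1 -> explicit_domain p.
Proof.
case: p => t x /= t1.
pose M := `|x| + 4 * `|t| + 1.
have cb y : `|t * (2 - atan y)| <= 4 * `|t|.
  rewrite normrM mulrC ler_wpM2r// ler_norml.
  by have /andP[a b] := atan_lt2 y; lra.
have M0 : 0 < M by rewrite ltr_wpDl// addr_ge0// mulr_ge0.
have [|||y _ yE] := @IVT R (char_map t) (- M) M x.
  by move: M0; lra.
  exact/continuous_subspaceT/continuous_char_map.
  apply/andP; split.
    rewrite ge_min; apply/orP; left; rewrite /char_map /M.
    have := cb (- M); rewrite ler_norml => /andP[_]; rewrite /M.
    have : - x <= `|x| by rewrite -normrN ler_norm.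
    move: (t * _) => z; lra.
  rewrite le_max; apply/orP; right; rewrite /char_map /M.
  have := cb M; rewrite ler_norml => /andP[+ _]; rewrite /M.
  have : x <= `|x| by rewrite ler_norm.
  move: (t * _) => z; lra.
exists y; split => //; split.
  by apply: (lt_le_trans t1); rewrite lerDl sqr_ge0.
have [|y0] := ltP 0 y; [by left|right].
have := @atan_le_id (- y); rewrite oppr_ge0 atanN => /(_ y0)/andP[_ ay].
have /andP[a1 a2] := atan_lt2 y.
have a4 : 0 < 4 - atan y by rewrite subr_gt0 (lt_trans a2)// ltr_nat.
have : t * (4 - atan y) < 1 * (4 - atan y) by rewrite ltr_pM2r.
by rewrite mul1r => /lt_le_trans; apply; rewrite lerD2l.
Qed.

Lemma explicit_domain_left p : 1 <= p.1 -> p.2 + 2 * p.1 < 4 ->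
  explicit_domain p.
Proof.
case: p => t x /= t1 u4.
pose M := `|x| + 4 * t + 1.
have M0 : 0 < M by rewrite ltr_wpDl// addr_ge0// mulr_ge0//; lra.
have [|||y] := @IVT R (char_map t) (- M) 0 x.
  by move: M0; lra.
  exact/continuous_subspaceT/continuous_char_map.
  apply/andP; split.
    rewrite ge_min; apply/orP; left; rewrite /char_map /M.
    have /andP[a b] := atan_lt2 (- M).
    have : t * (2 - atan (- M)) <= t * 4 by rewrite ler_pM2l//; lra.
    have : - x <= `|x| by rewrite -normrN ler_norm.
    rewrite /M; move: (t * _) => z; lra.
  rewrite le_max; apply/orP; right; rewrite /char_map atan0.
  by move: u4; lra.
rewrite in_itv /= => /andP[_ y0] yE.
exists y; split => //; apply: admissible_neg => //.
by rewrite ltrBrDl -char_map_u yE.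
Qed.

End ExplicitDomain.

Section Foot.
Variable R : realType.
Implicit Types (t x y z : R) (p q : R * R).

Lemma positive_box (f : R * R -> R) p : {for p, continuous f} -> 0 < f p ->
  exists2 e, 0 < e & forall s x, `|s - p.1| < e -> `|x - p.2| < e -> 0 < f (s, x).
Proof.
move=> /continuous_box cf fp; have [d d0 dP] := cf _ fp.
exists d => // s x sp xp; have := dP s x sp xp.
by rewrite ltr_norml => /andP[+ _]; move: (f _) (f p) => a b; lra.
Qed.

Lemma admissible_box t y : admissible t y -> exists2 e, 0 < e &
  forall s z, `|s - t| < e -> `|z - y| < e -> admissible s z.
Proof.
move=> [ty Hy].
have D0 : has_grad (fun p : R * R => atan p.2) (t, y) _ _ :=
  has_grad_comp (is_derive1_atan y) (has_grad_snd (t, y)).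
have c1 : {for (t, y), continuous (fun p : R * R => 1 + p.2 * p.2 + -1 * p.1)}.
  exact: (has_grad_continuous (has_gradD (has_gradD (has_grad_cst 1 (t, y))
    (has_gradM (has_grad_snd (t, y)) (has_grad_snd (t, y))))
    (has_gradM (has_grad_cst (-1) (t, y)) (has_grad_fst (t, y))))).
have c2 : {for (t, y), continuous (fun p : R * R =>
    4 + -1 * p.2 + p.1 * (-4 + atan p.2))}.
  exact: (has_grad_continuous (has_gradD (has_gradD (has_grad_cst 4 (t, y))
    (has_gradM (has_grad_cst (-1) (t, y)) (has_grad_snd (t, y))))
    (has_gradM (has_grad_fst (t, y)) (has_gradD (has_grad_cst (-4) (t, y)) D0)))).
have [|e1 e10 e1P] := positive_box c1.
  by move: ty; rewrite /= expr2; move: (y * y) => a; lra.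
have [e2 e20 e2P] : exists2 e, 0 < e & forall s z, `|s - t| < e -> `|z - y| < e ->
    0 < z \/ s * (4 - atan z) < 4 - z.
  case: Hy => [y0|Hy].
    exists y => // s z _; rewrite ltr_norml => /andP[+ _] => ?; left; lra.
  have [|e2 e20 e2P] := positive_box c2.
    by move: Hy; rewrite /=; move: (atan y) => a; lra.
  exists e2 => // s z st zy; right; have := e2P s z st zy.
  by rewrite /=; move: (atan z) => a; lra.
exists (Num.min e1 e2); first by rewrite lt_min e10.
move=> s z; rewrite !lt_min => /andP[s1 s2] /andP[z1 z2]; split; last exact: e2P.
by have := e1P s z s1 z1; rewrite /= expr2; move: (z * z) => a; lra.
Qed.

(** The point stays between the characteristics issued from [foot p - d1] and
    [foot p + d1] when it moves a little. *)
Lemma foot_near p : explicit_domain p -> forall e, 0 < e ->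
  exists2 d, 0 < d & forall s x, `|s - p.1| < d -> `|x - p.2| < d ->
    explicit_domain (s, x) /\ `|foot (s, x) - foot p| < e.
Proof.
move=> pO e e0; have [Ay Ey] := footP pO.
set y0 := foot p in Ay Ey *; set t0 := p.1 in Ay Ey *; set x0 := p.2 in Ey *.
have [e1 e10 e1P] := admissible_box Ay.
pose d1 := Num.min e1 e / 2; have d10 : 0 < d1 by rewrite divr_gt0// lt_min e10.
have d1e1 : d1 < e1.
  have : Num.min e1 e <= e1 by rewrite ge_min lexx.
  by rewrite /d1; move: e10; move: (Num.min _ _) => m; lra.
have d1e : d1 < e.
  have : Num.min e1 e <= e by rewrite ge_min lexx orbT.
  by rewrite /d1; move: e0; move: (Num.min _ _) => m; lra.
clearbody d1.
have adm s z : `|s - t0| < e1 -> y0 - d1 <= z <= y0 + d1 -> admissible s z.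
  move=> sr /andP[z1 z2]; apply: e1P => //.
  by rewrite ltr_norml; apply/andP; split; lra.
have t00 : `|t0 - t0| < e1 by rewrite subrr normr0.
have L : char_map t0 (y0 - d1) < x0.
  rewrite -Ey; apply: char_map_lt; first by lra.
  by move=> y /andP[a b]; apply: (proj1 (adm t0 y t00 _)); apply/andP; split; lra.
have U : x0 < char_map t0 (y0 + d1).
  rewrite -Ey; apply: char_map_lt; first by lra.
  by move=> y /andP[a b]; apply: (proj1 (adm t0 y t00 _)); apply/andP; split; lra.
(* Moving by less than [gap / 5] in [t] and in [x] changes the position of a
   characteristic, whose speed is at most [4], relative to the point by less
   than [gap]. *)
pose gap := Num.min (x0 - char_map t0 (y0 - d1)) (char_map t0 (y0 + d1) - x0).
have gap0 : 0 < gap by rewrite lt_min !subr_gt0 L.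
have gapL : gap <= x0 - char_map t0 (y0 - d1) by rewrite ge_min lexx.
have gapU : gap <= char_map t0 (y0 + d1) - x0 by rewrite ge_min lexx orbT.
clearbody gap.
exists (Num.min e1 (gap / 5)); first by rewrite lt_min e10 divr_gt0.
move=> s x; rewrite !lt_min => /andP[s1 s2] /andP[_ x2].
have cm y : `|char_map s y - char_map t0 y| <= 4 * `|s - t0|.
  have -> : char_map s y - char_map t0 y = (s - t0) * (2 - atan y).
    by rewrite /char_map; move: (atan y) => a; ring.
  rewrite normrM mulrC ler_wpM2r// ler_norml.
  by have /andP[a b] := atan_lt2 y; apply/andP; split; lra.
have [|||y yI yE] := @IVT R (char_map s) (y0 - d1) (y0 + d1) x.
- by lra.
- exact/continuous_subspaceT/continuous_char_map.
- have := cm (y0 - d1); have := cm (y0 + d1).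
  rewrite !ler_norml => /andP[U1 U2] /andP[L1 L2].
  move: x2; rewrite ltr_norml => /andP[x3 x4].
  rewrite ge_min le_max; apply/andP; split; apply/orP; [left|right].
    move: (char_map _ _) (char_map _ _) (`|s - t0|) s2 L1 L2 gapL x3 => a b c.
    lra.
  move: (char_map _ _) (char_map _ _) (`|s - t0|) s2 U1 U2 gapU x4 => a b c.
  lra.
have yI' : y0 - d1 <= y <= y0 + d1 by move: yI; rewrite in_itv.
have As : admissible s y by exact: adm.
split; first by exists y.
rewrite (@footE R (s, x) y)//; move/andP: yI' => [a b].
by rewrite ltr_norml; apply/andP; split; lra.
Qed.

Lemma open_explicit_domain : open (@explicit_domain R).
Proof.
apply: open_boxes => p /foot_near/(_ 1 ltr01)[d d0 dP].
by exists d => // s x sp xp; case: (dP s x sp xp).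
Qed.

Lemma continuous_foot p : explicit_domain p -> {for p, continuous (@foot R)}.
Proof.
move=> pO; apply/continuous_box => e e0; have [d d0 dP] := foot_near pO e0.
by exists d => // s x sp xp; case: (dP s x sp xp).
Qed.

(** Implicit differentiation of [char_map t (foot p) = x], done on difference
    quotients: with [atan y - atan y0 = q y * (y - y0)] the increment of the
    foot is the quotient of a linear form by [D], whose limit is [1 - t / (1 +
    y0^2)]. *)
Lemma has_grad_foot p : explicit_domain p ->
  let J := (1 + foot p ^+ 2) / (1 + foot p ^+ 2 - p.1) in
  has_grad (@foot R) p (- (2 - atan (foot p)) * J) J.
Proof.
move=> pO J; have [[ty _] Ey] := footP pO.
set y0 := foot p in J ty Ey *.
have /is_derive1_caratheodory[q [qE cq q0]] := is_derive1_atan y0.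
have cf := continuous_foot pO.
pose D r := 1 - p.1 * q (foot r).
have cqf : {for p, continuous (fun r => q (foot r))}.
  exact: (@continuous_comp _ _ _ (@foot R) q).
have caf : {for p, continuous (fun r => atan (foot r))}.
  by apply: (@continuous_comp _ _ _ (@foot R) atan) => //; exact: continuous_atan.
have cD : {for p, continuous D}.
  apply: (@continuous_comp _ _ _ (fun r => q (foot r)) (fun z => 1 - p.1 * z)).
    exact: cqf.
  exact: (continuousB (@cvg_cst _ _ _ _ _) (continuousM (@cvg_cst _ _ _ _ _) (@cvg_id _ _))).
have y1 : 0 < 1 + y0 ^+ 2 by rewrite ltr_wpDr ?sqr_ge0.
have Dp : D p = (1 + y0 ^+ 2 - p.1) / (1 + y0 ^+ 2).
  by rewrite /D q0; field; rewrite gt_eqF.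
have D0 : 0 < D p by rewrite Dp divr_gt0// subr_gt0.
have JE : J = (D p)^-1 by rewrite Dp invf_div.
have [e1 e10 e1P] := positive_box cD D0.
have [e2 e20 e2P] := open_box open_explicit_domain pO.
exists (fun r => - (2 - atan (foot r)) / D r), (fun r => (D r)^-1); split.
- split; last by rewrite JE.
  have c1 : {for p, continuous (fun r => - (2 - atan (foot r)))}.
    apply: (@continuous_comp _ _ _ (fun r => atan (foot r)) (fun z => - (2 - z))).
      exact: caf.
    exact: (continuousN (continuousB (@cvg_cst _ _ _ _ _) (@cvg_id _ _))).
  have c2 : {for p, continuous (fun r => (D r)^-1)}.
    by apply: continuousV => //; rewrite gt_eqF.
  exact: (continuousM c1 c2).
- split; last by rewrite JE.
  by apply: continuousV => //; rewrite gt_eqF.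
apply/nbhs_box; exists (Num.min e1 e2); first by rewrite lt_min e10.
move=> s x; rewrite !lt_min => /andP[s1 s2] /andP[x1 x2] /=.
have [_ E] := footP (e2P s x s2 x2); rewrite /= in E.
have Dsx := e1P s x s1 x1.
have := qE (foot (s, x)).
have : D (s, x) = 1 - p.1 * q (foot (s, x)) by [].
move: E; rewrite -{}Ey /char_map -/y0.
move: (D (s, x)) Dsx => d d0; move: (foot (s, x)) => y; move: (q y) => k.
move: (atan y) (atan y0) => a a0 <- dE qyE.
have dn : d != 0 by rewrite gt_eqF.
apply: (mulIf dn).
have cancel (A B : R) : (- (2 - a) / d * A + d^-1 * B) * d = - (2 - a) * A + B.
  by field.
rewrite cancel.
have -> : a = a0 + k * (y - y0) by rewrite -qyE; ring.
by rewrite dE; ring.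
Qed.

End Foot.

(** * The explicit potential *)

Section ExplicitPotential.
Variable R : realType.
Implicit Types (t x y z : R) (p q : R * R).

Definition log_speed y : R := ln (4 - atan y).

Lemma speed_gt0 y : 0 < 4 - atan y.
Proof. by have /andP[_ a2] := atan_lt2 y; lra. Qed.

Definition log_speed' y : R := - ((1 + y ^+ 2)^-1 / (4 - atan y)).

Lemma is_derive_log_speed y : is_derive y 1 log_speed (log_speed' y).
Proof.
have H := is_deriveB (is_derive_cst (4 : R) y (1 : R)) (is_derive1_atan y).
have K : is_derive y 1 log_speed _ :=
  @is_derive1_comp R (@ln R) (fun y => 4 - atan y) y _ _
    (is_derive1_ln (speed_gt0 y)) H.
by apply: (is_derive_eq K); rewrite sub0r mulrN mulrC.
Qed.

Variable H : R -> R.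
Hypothesis H' : forall y, is_derive y 1 H (log_speed y).

(** The function with [Psi = - atan foot] which vanishes on [t = 0], found by
    integration along the lines [u = const]; [H] is a primitive of [log_speed],
    the logarithm of [4 + Psi]. *)
Definition explicit_potential p : R :=
  H (p.2 + 2 * p.1) - H (foot p) - p.1 * atan (foot p)
  - (p.2 + 2 * p.1 - foot p) * log_speed (foot p).

Definition potential_dx p : R := log_speed (p.2 + 2 * p.1) - log_speed (foot p).
Definition potential_dt p : R := - atan (foot p) + 2 * potential_dx p.

Lemma has_grad_u p : has_grad (fun q => q.2 + 2 * q.1) p 2 1.
Proof.
have := has_gradD (has_grad_snd p) (has_gradM (has_grad_cst 2 p) (has_grad_fst p)).
by rewrite mul0r !add0r mulr1 mulr0 !addr0.
Qed.

Lemma has_gradN (f : R * R -> R) p a b : has_grad f p a b ->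
  has_grad (fun q => - f q) p (- a) (- b).
Proof.
move=> hf; have := has_gradM (has_grad_cst (-1) p) hf.
rewrite !mul0r !add0r !mulN1r.
by have -> : (fun q => -1 * f q) = (fun q => - f q)
  by apply/funext => q; rewrite mulN1r.
Qed.

Lemma has_gradB (f g : R * R -> R) p a b a' b' : has_grad f p a b ->
  has_grad g p a' b' -> has_grad (fun q => f q - g q) p (a - a') (b - b').
Proof. by move=> hf hg; exact: (has_gradD hf (has_gradN hg)). Qed.

(** The terms with the derivative [J] of the foot cancel, because [u - foot p =
    t * (4 - atan (foot p))]. *)
Lemma has_grad_potential p : explicit_domain p ->
  has_grad explicit_potential p (potential_dt p) (potential_dx p).
Proof.
move=> pO; have hX := has_grad_foot pO; have [_ E] := footP pO.
move: hX; set J := _ / _ => hX.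
have hA := has_grad_comp (is_derive1_atan (foot p)) hX.
have hG := has_grad_comp (is_derive_log_speed (foot p)) hX.
have hH := has_grad_comp (H' (foot p)) hX.
have hHu := has_grad_comp (H' (p.2 + 2 * p.1)) (has_grad_u p).
have := has_gradB (has_gradB (has_gradB hHu hH) (has_gradM (has_grad_fst p) hA))
  (has_gradM (has_gradB (has_grad_u p) hX) hG).
have uX : p.2 + 2 * p.1 - foot p = p.1 * (4 - atan (foot p)).
  by rewrite -E /char_map; move: (atan _) => a; ring.
rewrite uX /log_speed' /potential_dt /potential_dx.
have := speed_gt0 (foot p).
have : 0 < 1 + foot p ^+ 2 by rewrite ltr_wpDr ?sqr_ge0.
rewrite /explicit_potential.
move: (log_speed _) (log_speed _) (atan (foot p)) => g gu a.
move: (1 + _) => k k0 a0.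
have e1 : gu * 2 - g * (- (2 - a) * J) - (1 * a + p.1 * (k^-1 * (- (2 - a) * J)))
  - ((2 - - (2 - a) * J) * g + p.1 * (4 - a) * (- (k^-1 / (4 - a)) * (- (2 - a) * J)))
  = - a + 2 * (gu - g).
  by field; rewrite !gt_eqF.
have e2 : gu * 1 - g * J - (0 * a + p.1 * (k^-1 * J))
  - ((1 - J) * g + p.1 * (4 - a) * (- (k^-1 / (4 - a)) * J)) = gu - g.
  by field; rewrite !gt_eqF.
by rewrite e1 e2.
Qed.

(** A class of functions that contains the potential and is closed under partial
    derivatives on the explicit domain; smoothness becomes an induction on the
    number of derivatives. *)
Inductive elementary : (R * R -> R) -> Prop :=
| elementary_cst c : elementary (fun=> c)
| elementary_fst : elementary fst
| elementary_snd : elementary snd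
| elementary_foot : elementary (@foot R)
| elementaryD f g : elementary f -> elementary g ->
    elementary (fun p => f p + g p)
| elementaryM f g : elementary f -> elementary g ->
    elementary (fun p => f p * g p)
| elementaryV f : elementary f -> (forall p, explicit_domain p -> f p != 0) ->
    elementary (fun p => (f p)^-1)
| elementary_atan f : elementary f -> elementary (fun p => atan (f p))
| elementary_ln f : elementary f -> (forall p, explicit_domain p -> 0 < f p) ->
    elementary (fun p => ln (f p))
| elementary_potential : elementary explicit_potential.

Lemma is_derive_invr x : x != 0 -> is_derive x 1 (fun y : R => y^-1) (- (x^-1 * x^-1)).
Proof.
move=> x0; have K := is_deriveV x0 (is_derive_id x (1 : R)).
apply: (is_derive_eq K); rewrite /GRing.scale /= mulr1.
by rewrite expr2 invfM.
Qed.

Lemma elementaryN f : elementary f -> elementary (fun p => - f p).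
Proof.
move=> ef; have := elementaryM (elementary_cst (-1)) ef.
by have -> : (fun p => -1 * f p) = (fun p => - f p)
  by apply/funext => q; rewrite mulN1r.
Qed.

Lemma elementary_u : elementary (fun p => p.2 + 2 * p.1).
Proof.
by apply: elementaryD elementary_snd _; apply: elementaryM (elementary_cst 2) _;
  exact: elementary_fst.
Qed.

Lemma elementary_log_speed f : elementary f ->
  elementary (fun p => log_speed (f p)).
Proof.
move=> ef; apply: (@elementary_ln (fun p => 4 - atan (f p))).
  apply: (@elementaryD (fun=> 4) (fun p => - atan (f p))).
    exact: elementary_cst.
  exact/elementaryN/elementary_atan.
by move=> p _; exact: speed_gt0.
Qed.

Lemma elementary_potential_dx : elementary potential_dx.
Proof.
apply: (@elementaryD (fun p => log_speed (p.2 + 2 * p.1))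
  (fun p => - log_speed (foot p))).
  exact: (elementary_log_speed elementary_u).
exact: (elementaryN (elementary_log_speed elementary_foot)).
Qed.

Lemma elementary_potential_dt : elementary potential_dt.
Proof.
apply: (@elementaryD (fun p => - atan (foot p)) (fun p => 2 * potential_dx p)).
  exact: (elementaryN (elementary_atan elementary_foot)).
exact: elementaryM (elementary_cst 2) elementary_potential_dx.
Qed.

Lemma foot_speed_gt0 p : explicit_domain p -> 0 < 1 + foot p ^+ 2 - p.1.
Proof. by move=> /footP[[H1 _] _]; rewrite subr_gt0. Qed.

Lemma elementary_grad f : elementary f -> exists ft fx,
  [/\ elementary ft, elementary fx &
    forall p, explicit_domain p -> has_grad f p (ft p) (fx p)].
Proof.
elim=> {f} [c||||f g ef [ft [fx [eft efx fD]]] eg [gt [gx [egt egx gD]]]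
  |f g ef [ft [fx [eft efx fD]]] eg [gt [gx [egt egx gD]]]
  |f ef [ft [fx [eft efx fD]]] f0|f ef [ft [fx [eft efx fD]]]
  |f ef [ft [fx [eft efx fD]]] f0|].
- exists (fun=> 0), (fun=> 0); split; try exact: elementary_cst.
  by move=> p _; exact: has_grad_cst.
- exists (fun=> 1), (fun=> 0); split; try exact: elementary_cst.
  by move=> p _; exact: has_grad_fst.
- exists (fun=> 0), (fun=> 1); split; try exact: elementary_cst.
  by move=> p _; exact: has_grad_snd.
- pose J p := (1 + foot p * foot p) * (1 + foot p * foot p + -1 * p.1)^-1.
  have e1 : elementary (fun p => 1 + foot p * foot p).
    apply: (elementaryD (elementary_cst 1)).
    exact: (elementaryM elementary_foot elementary_foot).
  have eJ : elementary J.
    apply: (elementaryM e1); apply: (@elementaryV (fun p =>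
      1 + foot p * foot p + -1 * p.1)).
      exact: (elementaryD e1 (elementaryM (elementary_cst (-1)) elementary_fst)).
    by move=> p /foot_speed_gt0; rewrite mulN1r expr2 => /gt_eqF ->.
  exists (fun p => (-2 + atan (foot p)) * J p), J; split => //.
    apply: elementaryM => //.
    exact: (elementaryD (elementary_cst (-2)) (elementary_atan elementary_foot)).
  move=> p pO; have := has_grad_foot pO; rewrite /J -expr2 mulN1r.
  by rewrite opprB addrC.
- exists (fun p => ft p + gt p), (fun p => fx p + gx p); split.
  + exact: elementaryD.
  + exact: elementaryD.
  + by move=> p pO; apply: has_gradD; [exact: fD|exact: gD].
- exists (fun p => ft p * g p + f p * gt p), (fun p => fx p * g p + f p * gx p).
  split.
  + exact: (elementaryD (elementaryM eft eg) (elementaryM ef egt)).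
  + exact: (elementaryD (elementaryM efx eg) (elementaryM ef egx)).
  + by move=> p pO; apply: has_gradM; [exact: fD|exact: gD].
- have eV := elementaryV ef f0.
  have eVV := elementaryN (elementaryM eV eV).
  exists (fun p => - ((f p)^-1 * (f p)^-1) * ft p),
    (fun p => - ((f p)^-1 * (f p)^-1) * fx p); split.
  + exact: (elementaryM eVV eft).
  + exact: (elementaryM eVV efx).
  + move=> p pO; apply: (@has_grad_comp _ (fun y : R => y^-1)); last exact: fD.
    exact/is_derive_invr/f0.
- have n0 p : explicit_domain p -> 1 + f p * f p != 0.
    by move=> _; rewrite -expr2 gt_eqF// ltr_wpDr ?sqr_ge0.
  have eV := elementaryV (elementaryD (elementary_cst 1) (elementaryM ef ef)) n0.
  exists (fun p => (1 + f p * f p)^-1 * ft p), (fun p => (1 + f p * f p)^-1 * fx p).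
  split.
  + exact: (elementaryM eV eft).
  + exact: (elementaryM eV efx).
  + move=> p pO; rewrite -expr2.
    exact: (has_grad_comp (is_derive1_atan (f p)) (fD p pO)).
- have n0 p : explicit_domain p -> f p != 0 by move=> /f0 /gt_eqF ->.
  have eV := elementaryV ef n0.
  exists (fun p => (f p)^-1 * ft p), (fun p => (f p)^-1 * fx p); split.
  + exact: (elementaryM eV eft).
  + exact: (elementaryM eV efx).
  + move=> p pO.
    exact: (has_grad_comp (is_derive1_ln (f0 p pO)) (fD p pO)).
exists potential_dt, potential_dx; split.
- exact: elementary_potential_dt.
- exact: elementary_potential_dx.
- exact: has_grad_potential.
Qed.

Lemma has_grad_on (f g : R * R -> R) p a b : explicit_domain p ->
  (forall q, explicit_domain q -> f q = g q) ->
  has_grad f p a b -> has_grad g p a b.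
Proof.
move=> pO fg; apply: near_eq_has_grad; apply/nbhs_box.
have [e e0 eP] := open_box (@open_explicit_domain R) pO.
by exists e => // s x sp xp; apply: fg; exact: eP.
Qed.

Lemma elementary_smooth f : elementary f -> smooth_on (@explicit_domain R) f.
Proof.
move=> ef v.
have [g [eg gE]] : exists g, elementary g /\
    forall p, explicit_domain p -> g p = partials v f p.
  elim: v => [|b v [g [eg gE]]] /=; first by exists f.
  have [gt [gx [egt egx gD]]] := elementary_grad eg.
  case: b; [exists gt|exists gx]; split => // p pO;
    by have [] := has_grad_partials (has_grad_on pO gE (gD p pO)).
move=> p pO; have [gt [gx [egt egx gD]]] := elementary_grad eg.
by have [] := has_grad_diff (has_grad_on pO gE (gD p pO)).
Qed.

Lemma Psi_explicit p : explicit_domain p ->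
  Psi explicit_potential p = - atan (foot p).
Proof.
move=> pO; have [E1 E2] := has_grad_partials (has_grad_potential pO).
by rewrite /Psi E1 E2 /potential_dt addrK.
Qed.

Lemma wave_equation_values (Phi : R * R -> R) p (P A B C : R) :
  Psi Phi p = P -> dt (dt Phi) p = A -> dt (dx Phi) p = B ->
  dx (dx Phi) p = C -> - A - P * B + 2 * (2 + P) * C = 0 ->
  wave_equation Phi p.
Proof. by move=> <- <- <- <-. Qed.

Lemma explicit_wave_equation p : explicit_domain p ->
  wave_equation explicit_potential p.
Proof.
move=> pO.
have Et q : explicit_domain q -> potential_dt q = dt explicit_potential q.
  by move=> /has_grad_potential/has_grad_partials[].
have Ex q : explicit_domain q -> potential_dx q = dx explicit_potential q.
  by move=> /has_grad_potential/has_grad_partials[].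
have hX := has_grad_foot pO.
have hA := has_grad_comp (is_derive1_atan (foot p)) hX.
have hG := has_grad_comp (is_derive_log_speed (foot p)) hX.
have hGu := has_grad_comp (is_derive_log_speed (p.2 + 2 * p.1)) (has_grad_u p).
have hdx := has_gradB hGu hG.
have hdt := has_gradD (has_gradN hA) (has_gradM (has_grad_cst 2 p) hdx).
have [tt _] := has_grad_partials (has_grad_on pO Et hdt).
have [tx xx] := has_grad_partials (has_grad_on pO Ex hdx).
apply: (wave_equation_values (Psi_explicit pO) tt tx xx); rewrite /log_speed'.
have := speed_gt0 (foot p).
have : 0 < 1 + foot p ^+ 2 by rewrite ltr_wpDr ?sqr_ge0.
have := foot_speed_gt0 pO.
move: (speed_gt0 (p.2 + 2 * p.1)).
have : 0 < 1 + (p.2 + 2 * p.1) ^+ 2 by rewrite ltr_wpDr ?sqr_ge0.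
move: (1 + foot p ^+ 2) (atan (foot p)) => k a.
move: (1 + (_ + _) ^+ 2) (atan (_ + _)) => ku au.
move=> h1 h2 h3 h4 h5; field.
by rewrite !gt_eqF.
Qed.

Lemma foot_slice x : explicit_domain (0, x) /\ foot (0, x) = x.
Proof.
have A : admissible (0 : R) x.
  split; first by rewrite ltr_wpDr ?sqr_ge0.
  by have [x0|x0] := ltP 0 x; [left|right; rewrite mul0r; move: x0; lra].
have E : char_map 0 x = x by rewrite /char_map mul0r addr0.
by split; [exists x|rewrite (@footE R (0, x) x)].
Qed.

Lemma explicit_initial_data : initial_data explicit_potential.
Proof.
move=> x; have [xO xE] := foot_slice x.
split.
  by rewrite /explicit_potential xE /= mulr0 addr0 !subrr mul0r !mul0r !subr0.
have [-> _] := has_grad_partials (has_grad_potential xO).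
by rewrite /potential_dt /potential_dx xE /= mulr0 addr0 subrr mulr0 addr0.
Qed.

End ExplicitPotential.

(** * Timelike curves *)

Section Curves.
Variable R : realType.
Implicit Types (I : set R) (c v : R -> R * R) (s : R).

Lemma curve_quotient I c (w : R * R) s :
  (s' - s)^-1 *: (c s' - c s) @[s' --> within I s^'] --> w ->
  forall e, 0 < e -> exists2 d, 0 < d & forall s', I s' -> s' != s ->
    `|s' - s| < d ->
    `|((c s').1 - (c s).1) / (s' - s) - w.1| < e /\
    `|((c s').2 - (c s).2) / (s' - s) - w.2| < e.
Proof.
move=> H e e0; have := H _ (nbhsx_ballx w _ e0).
move=> /nbhs_ballP[d d0 dP]; exists d => // s' Is' ss' sd.
have [|/= A B] := dP s' _ ss' Is'; first by rewrite /ball /= distrC.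
by split; rewrite mulrC distrC.
Qed.

Lemma curve_is_derive I c v s : open I -> I s ->
  (s' - s)^-1 *: (c s' - c s) @[s' --> within I s^'] --> v s ->
  is_derive s 1 (fun s => (c s).1) (v s).1 /\
  is_derive s 1 (fun s => (c s).2) (v s).2.
Proof.
move=> oI Is /curve_quotient H.
have [r r0 rI] : exists2 r, 0 < r & forall s', `|s' - s| < r -> I s'.
  by apply/near_ball1; exact: open_nbhs_nbhs.
have K (a : R -> R) (w : R) : (forall e, 0 < e -> exists2 d, 0 < d &
    forall s', I s' -> s' != s -> `|s' - s| < d ->
    `|(a s' - a s) / (s' - s) - w| < e) -> is_derive s 1 a w.
  move=> aP; apply/is_derive1_caratheodory.
  exists (fun z => if z == s then w else (a z - a s) / (z - s)); split.
  - move=> z; case: eqP => [->|/eqP zs]; first by rewrite !subrr mulr0.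
    by rewrite divfK// subr_eq0.
  - apply/continuous_eps => e e0; have [d d0 dP] := aP e e0.
    apply/near_ball1; exists (Num.min r d); first by rewrite lt_min r0.
    move=> z; rewrite lt_min eqxx => /andP[zr zd].
    by case: eqP => [_|/eqP zs]; rewrite ?subrr ?normr0//; apply: dP => //; exact: rI.
  - by rewrite eqxx.
by split; apply: K => e /H[d d0 dP]; exists d => // s' Is' ss' sd;
  have [] := dP s' Is' ss' sd.
Qed.

(** The factors are the null forms that vanish on [vecLbar] and on [vecL psi]. *)
Lemma acoustical_metricE (psi : R) (X : R * R) : acoustical_metric psi X X =
  4 / (4 + psi) ^+ 2 * ((X.2 + 2 * X.1) * (X.2 - (2 + psi) * X.1)).
Proof.
by rewrite /acoustical_metric; move: ((4 + psi) ^+ 2)^-1 => a; ring.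
Qed.

Lemma timelikeE (psi : R) (X : R * R) : 4 + psi != 0 ->
  timelike psi X <-> (X.2 + 2 * X.1) * (X.2 - (2 + psi) * X.1) < 0.
Proof.
move=> p0; have k0 : 0 < 4 / (4 + psi) ^+ 2.
  by rewrite divr_gt0// exprn_even_gt0//= p0 orbT.
rewrite /timelike /= acoustical_metricE pmulr_rlt0//; split=> [[]//|H].
split => //; apply/eqP => X0; move: H; rewrite X0 /=.
by rewrite !mulr0 subrr mulr0 ltxx.
Qed.

Lemma timelike_components (psi : R) (X : R * R) : 0 < 4 + psi ->
  timelike psi X ->
  (0 < X.1 /\ 0 < X.2 + 2 * X.1 < (4 + psi) * X.1) \/
  (X.1 < 0 /\ (4 + psi) * X.1 < X.2 + 2 * X.1 < 0).
Proof.
move=> p0; rewrite timelikeE ?gt_eqF//.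
have E : X.2 - (2 + psi) * X.1 = X.2 + 2 * X.1 - (4 + psi) * X.1 by ring.
rewrite E; move: (X.2 + 2 * X.1) => U.
have [U0|U0|->] := ltgtP U 0; last by rewrite mul0r ltxx.
  rewrite nmulr_rlt0// subr_gt0 => H; right; rewrite H; split=> //.
  by rewrite -(pmulr_rlt0 _ p0); exact: lt_trans U0.
rewrite pmulr_rlt0// subr_lt0 => H; left; rewrite H; split=> //.
by rewrite -(pmulr_rgt0 _ p0); exact: lt_trans H.
Qed.

End Curves.

(** * Global hyperbolicity of the explicit domain *)

Section ExplicitHyperbolic.
Variable R : realType.
Implicit Types (I : set R) (a b u : R -> R) (s : R).

Lemma interval_between I s1 s2 s : is_interval I -> I s1 -> I s2 ->
  s1 <= s <= s2 -> I s.
Proof. by move=> iI I1 I2 s12; exact: (iI s1 s2). Qed.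

Lemma decreasing_limit I a (m : R) : I !=set0 ->
  (forall s s', I s -> I s' -> s <= s' -> a s' <= a s) ->
  (forall s, I s -> m <= a s) ->
  exists L, [/\ m <= L, forall s, I s -> L <= a s &
    forall e, 0 < e -> exists2 s0, I s0 &
      forall s, I s -> s0 <= s -> `|a s - L| < e].
Proof.
move=> [s1 Is1] mon bnd; pose A := [set a s | s in I].
have A0 : A !=set0 by exists (a s1), s1.
have Alb : has_lbound A by exists m => _ [s Is <-]; exact: bnd.
have LA s : I s -> inf A <= a s by move=> Is; apply: (ge_inf Alb); exists s.
exists (inf A); split => //.
  by apply: lb_le_inf => // _ [s Is <-]; exact: bnd.
move=> e e0; have [_ [s0 Is0 <-] sA] := inf_adherent e0 (conj A0 Alb).
exists s0 => // s Is ss; rewrite ger0_norm ?subr_ge0 ?LA// ltrBlDl.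
by apply: le_lt_trans sA; exact: mon.
Qed.

Lemma increasing_limit I a (m : R) : I !=set0 ->
  (forall s s', I s -> I s' -> s <= s' -> a s <= a s') ->
  (forall s, I s -> a s <= m) ->
  exists L, [/\ L <= m, forall s, I s -> a s <= L &
    forall e, 0 < e -> exists2 s0, I s0 &
      forall s, I s -> s0 <= s -> `|a s - L| < e].
Proof.
move=> I0 mon bnd.
have [|s Is|L [mL La Lim]] := @decreasing_limit I (fun s => - a s) (- m) I0.
- by move=> s s' Is Is' ss; rewrite lerN2; exact: mon.
- by rewrite lerN2; exact: bnd.
exists (- L); split.
- by rewrite lerNl.
- by move=> s /La; rewrite lerNr.
move=> e /Lim[s0 Is0 sP]; exists s0 => // s Is ss.
by have := sP s Is ss; rewrite -opprD normrN opprK.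
Qed.

Lemma limit_upper_endpoint I a b (La Lu : R) :
  (forall e, 0 < e -> exists2 s0, I s0 &
      forall s, I s -> s0 <= s -> `|a s - La| < e) ->
  (forall e, 0 < e -> exists2 s0, I s0 &
      forall s, I s -> s0 <= s -> `|b s + 2 * a s - Lu| < e) ->
  upper_endpoint I (fun s => (a s, b s)) (La, Lu - 2 * La).
Proof.
move=> la lu U /nbhs_box[e e0 eU].
have e3 : 0 < e / 3 by rewrite divr_gt0.
have [s0 I0 s0P] := la _ e3; have [s1 I1 s1P] := lu _ e3.
have Im : I (Num.max s0 s1) by case: (leP s0 s1).
exists (Num.max s0 s1) => // s Is; rewrite ge_max => /andP[ss0 ss1].
have := s0P s Is ss0; have := s1P s Is ss1.
rewrite !ltr_norml => /andP[A1 A2] /andP[B1 B2].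
by apply: eU => /=; rewrite ltr_norml; apply/andP; split; lra.
Qed.

Section Curve.
Variables (I : set R) (a b va vb : R -> R).
Hypothesis I0 : I !=set0.
Hypothesis oI : open I.
Hypothesis iI : is_interval I.
Hypothesis aD : forall s, I s -> is_derive s 1 a (va s).
Hypothesis bD : forall s, I s -> is_derive s 1 b (vb s).
Hypothesis cO : forall s, I s -> explicit_domain (a s, b s).

Let X s := foot (a s, b s).
Let u s := b s + 2 * a s.

Let uD s : I s -> is_derive s 1 u (vb s + 2 * va s).
Proof.
by move=> Is; exact: (is_deriveD (bD Is) (is_deriveZ 2 (aD Is))).
Qed.

Let u6D s : I s -> is_derive s 1 (fun s => u s - 6 * a s)
  (vb s + 2 * va s - 6 * va s).
Proof.
by move=> Is; exact: (is_deriveB (uD Is) (is_deriveZ 6 (aD Is))).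
Qed.

Let mono (f d : R -> R) : (forall s, I s -> is_derive s 1 f (d s)) ->
  (forall s, I s -> 0 <= d s) ->
  forall s s', I s -> I s' -> s <= s' -> f s <= f s'.
Proof.
move=> fD d0 s s' Is Is' ss; apply: (@derive_ge0_le _ f d s s' ss) => x xI.
  by apply: fD; apply: interval_between xI.
by apply: d0; apply: interval_between xI.
Qed.

Let smono (f d : R -> R) : (forall s, I s -> is_derive s 1 f (d s)) ->
  (forall s, I s -> 0 < d s) ->
  forall s s', I s -> I s' -> s < s' -> f s < f s'.
Proof.
move=> fD d0 s s' Is Is' ss; apply: (@derive_gt0_lt _ f d s s' ss) => x xI.
  by apply: fD; apply: interval_between xI.
by apply: d0; apply: (interval_between iI Is Is'); case/andP: xI => ? ?; rewrite !ltW.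
Qed.

(** Towards the past [t] and [u] decrease, and they stay bounded since [u - 6 t]
    increases; so the curve has a limit point. It is in the domain when its time
    is less than [1] or its [u] less than [4]. Otherwise all the feet are
    positive; they increase along the curve, because it moves to the right of
    the characteristics, and are bounded by [u]. With their limit as foot the
    limit point is admissible: its time is smaller, and its foot not smaller,
    than on the curve. *)
Lemma past_endpoint :
  (forall s, I s -> va s < 0 /\ (4 - atan (X s)) * va s < vb s + 2 * va s < 0) ->
  (forall s, I s -> 0 < a s) ->
  exists2 q, explicit_domain q & upper_endpoint I (fun s => (a s, b s)) q.
Proof.
move=> past apos.
have [s1 Is1] := I0.
have speed s : 0 < 4 - atan (X s) < 6.
  by have /andP[A1 A2] := atan_lt2 (X s); apply/andP; split; lra.
have u6 s : I s -> 0 <= vb s + 2 * va s - 6 * va s.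
  move=> Is; have [A /andP[B _]] := past s Is; have /andP[_ S] := speed s.
  have : 6 * va s < (4 - atan (X s)) * va s by rewrite ltr_nM2r.
  by move: B; move: (_ * va s) => y; lra.
have amon s s' : I s -> I s' -> s <= s' -> a s' <= a s.
  move=> Is Is' ss; rewrite -lerN2.
  apply: (mono (f := fun s => - a s) (d := fun s => - va s)) => // x Ix.
    exact: (is_deriveN (aD Ix)).
  by rewrite oppr_ge0 ltW//; case: (past x Ix).
have asmon s s' : I s -> I s' -> s < s' -> a s' < a s.
  move=> Is Is' ss; rewrite -ltrN2.
  apply: (smono (f := fun s => - a s) (d := fun s => - va s)) => // x Ix.
    exact: (is_deriveN (aD Ix)).
  by rewrite oppr_gt0//; case: (past x Ix).
have usmon s s' : I s -> I s' -> s < s' -> u s' < u s.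
  move=> Is Is' ss; rewrite -ltrN2.
  apply: (smono (f := fun s => - u s) (d := fun s => - (vb s + 2 * va s))) => // x Ix.
    exact: (is_deriveN (uD Ix)).
  by rewrite oppr_gt0//; case: (past x Ix) => _ /andP[].
have umon s s' : I s -> I s' -> s <= s' -> u s' <= u s.
  by move=> Is Is'; rewrite le_eqVlt => /predU1P[->//|/usmon/ltW]; exact.
have u6mon s s' : I s -> I s' -> s <= s' -> u s - 6 * a s <= u s' - 6 * a s'.
  exact: (mono u6D u6).
have [La [La0 aLa Lalim]] : exists L, [/\ 0 <= L, forall s, I s -> L <= a s &
    forall e, 0 < e -> exists2 s0, I s0 &
      forall s, I s -> s0 <= s -> `|a s - L| < e].
  by apply: decreasing_limit => // s /apos/ltW.
have ubnd s : I s -> u s1 - 6 * a s1 <= u s.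
  move=> Is; have [ss|ss] := leP s1 s.
    have := u6mon s1 s Is1 Is ss; have := apos s Is; lra.
  have := umon s s1 Is Is1 (ltW ss); have := apos s1 Is1; lra.
have [Lu [_ uLu Lulim]] := decreasing_limit I0 umon ubnd.
have next s : I s -> exists2 s', s < s' & I s'.
  move=> Is; have /near_ball1[r r0 rP] : \forall s' \near s, I s'.
    exact: open_nbhs_nbhs.
  exists (s + r / 2); first by rewrite ltrDl divr_gt0.
  by apply: rP; rewrite addrC addKr gtr0_norm ?divr_gt0//; lra.
exists (La, Lu - 2 * La); last exact: limit_upper_endpoint.
have [La1|La1] := ltP La 1; first exact: explicit_domain_early.
have [Lu4|Lu4] := ltP Lu 4.
  by apply: explicit_domain_left => //=; rewrite subrK.
have aLa' s : I s -> La < a s.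
  by move=> Is; have [s' ss Is'] := next s Is; apply: le_lt_trans (asmon _ _ Is Is' ss); exact: aLa.
have X0 s : I s -> 0 < X s.
  move=> Is; rewrite ltNge; apply/negP => Xs.
  have [A E] := footP (cO Is).
  have := left_branch_u A Xs; rewrite E /= -/(u s) ltNge.
  by rewrite (le_trans Lu4)// uLu.
have XD s : I s -> is_derive s 1 X ((1 + X s ^+ 2) / (1 + X s ^+ 2 - a s) *
    (vb s - (2 - atan (X s)) * va s)).
  move=> Is; have K := has_grad_curve (has_grad_foot (cO Is)) (aD Is) (bD Is).
  apply: (is_derive_eq K); rewrite /= -/(X s).
  by move: (_ / _) (atan _) => J at'; ring.
have Xmon s s' : I s -> I s' -> s <= s' -> X s <= X s'.
  apply: (mono XD) => x Ix.
  have [A _] := footP (cO Ix).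
  apply: mulr_ge0.
    by apply: divr_ge0; [rewrite addr_ge0 ?sqr_ge0|rewrite subr_ge0 ltW//; case: A].
  by have [_ /andP[B _]] := past x Ix; move: B; move: (atan _) => y; lra.
have Xu s : I s -> X s <= u s.
  move=> Is; have [A E] := footP (cO Is).
  have := char_map_u (a s) (X s); rewrite /X E /= -/(X s) -/(u s) => ->.
  rewrite lerDl mulr_ge0 ?(ltW (apos s Is))//.
  by case/andP: (speed s) => /ltW.
have Xbnd s : I s -> X s <= u s1.
  move=> Is; have [ss|ss] := leP s1 s.
    by apply: le_trans (Xu s Is) _; exact: umon.
  by apply: le_trans (Xmon _ _ Is Is1 (ltW ss)) _; exact: Xu.
have [LX [_ XLX LXlim]] := increasing_limit I0 Xmon Xbnd.
have LX0 : 0 < LX by apply: lt_le_trans (XLX s1 Is1); exact: X0.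
exists LX; split => /=.
  split; last by left.
  have [[A _] _] := footP (cO Is1).
  apply: (lt_trans (aLa' s1 Is1)); apply: (lt_le_trans A); rewrite lerD2l.
  by rewrite ler_pXn2r ?nnegrE ?(ltW LX0)//; [exact: XLX|exact/ltW/X0].
apply/eqP; rewrite -subr_eq0 -normr_eq0; apply/negP => /negP n0.
have e0 : 0 < `|char_map La LX - (Lu - 2 * La)| / 2.
  by rewrite divr_gt0// lt_def n0 normr_ge0.
move: e0; set e := _ / 2 => e0.
have hA : has_grad (fun p : R * R => atan p.2) (La, LX) _ _ :=
  has_grad_comp (is_derive1_atan LX) (has_grad_snd (La, LX)).
have cF : {for (La, LX), continuous (fun p : R * R => p.2 + p.1 * (2 - atan p.2))}.
  exact: (has_grad_continuous (has_gradD (has_grad_snd (La, LX))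
    (has_gradM (has_grad_fst (La, LX)) (has_gradB (has_grad_cst 2 (La, LX)) hA)))).
have [d d0 dP] := (continuous_box _ _).1 cF _ e0.
have [s2 I2 s2P] := Lalim _ d0; have [s3 I3 s3P] := LXlim _ d0.
have nb : nbhs (La, Lu - 2 * La) [set p : R * R | `|p.2 - (Lu - 2 * La)| < e].
  by apply/nbhs_box; exists e.
have [s4 I4 s4P] := limit_upper_endpoint Lalim Lulim nb.
pose s := Num.max (Num.max s2 s3) s4.
have Is : I s by rewrite /s; case: (leP s2 s3) => _; case: leP.
have := s4P s Is; rewrite le_max lexx orbT => /(_ isT) /= K1.
have K2 := s2P s Is; rewrite !le_max lexx in K2; have {}K2 := K2 isT.
have K3 := s3P s Is; rewrite !le_max lexx orbT in K3; have {}K3 := K3 isT.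
have := dP _ _ K2 K3; rewrite /= -/(char_map (a s) (X s)) -/(char_map La LX).
have [_ E] := footP (cO Is); rewrite {1}/X E /= => K4.
have : `|char_map La LX - (Lu - 2 * La)| <=
   `|b s - char_map La LX| + `|b s - (Lu - 2 * La)|.
  by rewrite (distrC (b s) (char_map _ _)) ler_distD.
apply/negP; rewrite -ltNge.
have -> : `|char_map La LX - (Lu - 2 * La)| = e + e by rewrite /e -splitr.
exact: ltrD.
Qed.

(** Before time [0] the limit point cannot fail to be in the domain. *)
Lemma future_endpoint :
  (forall s, I s -> 0 < va s /\ 0 < vb s + 2 * va s < (4 - atan (X s)) * va s) ->
  (forall s, I s -> a s < 0) ->
  exists2 q, explicit_domain q & upper_endpoint I (fun s => (a s, b s)) q.
Proof.
move=> fut aneg.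
have [s1 Is1] := I0.
have u6 s : I s -> 0 <= - (vb s + 2 * va s - 6 * va s).
  move=> Is; have [A /andP[_ B]] := fut s Is.
  have S : 4 - atan (X s) < 6 by have /andP[A1 A2] := atan_lt2 (X s); lra.
  have : (4 - atan (X s)) * va s < 6 * va s by rewrite ltr_pM2r.
  by move: B; move: (_ * va s) => y; lra.
have amon s s' : I s -> I s' -> s <= s' -> a s <= a s'.
  by apply: (mono aD) => x Ix; apply/ltW; case: (fut x Ix).
have umon s s' : I s -> I s' -> s <= s' -> u s <= u s'.
  by apply: (mono uD) => x Ix; apply/ltW; case: (fut x Ix) => _ /andP[].
have u6mon s s' : I s -> I s' -> s <= s' ->
    - (u s - 6 * a s) <= - (u s' - 6 * a s').
  exact: (mono (fun s Is => is_deriveN (u6D Is)) u6).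
have [La [La0 _ Lalim]] : exists L, [/\ L <= 0, forall s, I s -> a s <= L &
    forall e, 0 < e -> exists2 s0, I s0 &
      forall s, I s -> s0 <= s -> `|a s - L| < e].
  by apply: increasing_limit => // s /aneg/ltW.
have ubnd s : I s -> u s <= u s1 - 6 * a s1.
  move=> Is; have [ss|ss] := leP s1 s.
    have := u6mon s1 s Is1 Is ss; have := aneg s Is; lra.
  have := umon s s1 Is Is1 (ltW ss); have := aneg s1 Is1; lra.
have [Lu [_ _ Lulim]] := increasing_limit I0 umon ubnd.
exists (La, Lu - 2 * La); last exact: limit_upper_endpoint.
by apply: explicit_domain_early => /=; apply: le_lt_trans La0 _.
Qed.

End Curve.

End ExplicitHyperbolic.

Section ExplicitDevelopment.
Variable R : realType.
Variable H : R -> R.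
Hypothesis H' : forall y : R, is_derive y 1 H (log_speed y).

Let Phi := explicit_potential H.
Let Om := @explicit_domain R.

Lemma upper_endpoint_reverse (I : set R) (c : R -> R * R) q :
  upper_endpoint [set s | I (- s)] (fun s => c (- s)) q -> lower_endpoint I c q.
Proof.
move=> ue U /ue[s0 Is0 s0P]; exists (- s0) => // s Is ss.
have := s0P (- s); rewrite /= opprK; apply => //.
by rewrite lerNr.
Qed.

Lemma sign_constant (I : set R) (f : R -> R) : is_interval I -> open I ->
  (forall s, I s -> {for s, continuous f}) -> (forall s, I s -> f s != 0) ->
  (forall s, I s -> 0 < f s) \/ (forall s, I s -> f s < 0).
Proof.
move=> iI oI cf f0.
have [[s1 [Is1 f1]]|Nneg] := pselect (exists s, I s /\ f s < 0); last first.
  left=> s Is; rewrite lt_def f0//= leNgt; apply/negP => fs.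
  by apply: Nneg; exists s.
right=> s Is; rewrite lt_neqAle f0//= leNgt; apply/negP => fs.
have seg x y : I x -> I y -> x <= y -> {within `[x, y], continuous f}.
  move=> Ix Iy xy; apply: continuous_in_subspaceT => z.
  by rewrite inE /= in_itv /= => zI; apply: cf; exact: (iI x y).
have no0 x y : I x -> I y -> x <= y ->
    Num.min (f x) (f y) <= 0 <= Num.max (f x) (f y) -> False.
  move=> Ix Iy xy m0; have [z] := IVT xy (seg _ _ Ix Iy xy) m0.
  rewrite in_itv /= => zI fz; have Iz : I z by exact: (iI x y).
  by have := f0 z Iz; rewrite fz eqxx.
have [ss|ss] := leP s1 s.
  apply: (no0 _ _ Is1 Is ss).
  by rewrite ge_min le_max (ltW f1) (ltW fs) !orbT.
apply: (no0 _ _ Is Is1 (ltW ss)).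
by rewrite ge_min le_max (ltW f1) (ltW fs) !orbT.
Qed.

(** On a curve that misses [t = 0] the time has a constant sign. In the
    direction of [t = 0], which is the end or the beginning of the parameter
    interval, the curve has an endpoint in the domain. *)
Lemma explicit_globally_hyperbolic I c : inextendible_timelike Om Phi I c ->
  exists! s, I s /\ (c s).1 = 0.
Proof.
move=> [[I0 [oI iI]] cO [v [[cv cD] tl]] noend].
pose a s := (c s).1; pose b s := (c s).2.
pose va s := (v s).1; pose vb s := (v s).2.
have cab s : (a s, b s) = c s by rewrite -surjective_pairing.
have aD s : I s -> is_derive s 1 a (va s).
  by move=> Is; case: (curve_is_derive oI Is (cD s Is)).
have bD s : I s -> is_derive s 1 b (vb s).
  by move=> Is; case: (curve_is_derive oI Is (cD s Is)).
have abO s : I s -> explicit_domain (a s, b s) by move=> Is; rewrite cab; exact: cO.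
have tlc s : I s ->
   (0 < va s /\ 0 < vb s + 2 * va s < (4 - atan (foot (a s, b s))) * va s) \/
   (va s < 0 /\ (4 - atan (foot (a s, b s))) * va s < vb s + 2 * va s < 0).
  move=> Is; rewrite cab; apply: timelike_components; first exact: speed_gt0.
  have := tl s Is; rewrite (_ : Psi Phi (c s) = - atan (foot (c s)))//.
  by apply: Psi_explicit => //; exact: cO.
have cva s : I s -> {for s, continuous va}.
  move=> Is; have cvs : {for s, continuous v}.
    have K : {in I, continuous v} by rewrite -(continuous_open_subspace v oI).
    by apply: K; rewrite inE.
  exact: (@continuous_comp _ _ _ v fst s cvs
    (has_grad_continuous (has_grad_fst (v s)))).
have va0 s : I s -> va s != 0.
  by move=> /tlc[[/gt_eqF->]|[/lt_eqF->]].
have ca s : I s -> {for s, continuous a}.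
  by move=> /aD; exact: is_derive1_continuous.
have vsign := sign_constant iI oI cva va0.
have uniq s s' : I s -> I s' -> a s = 0 -> a s' = 0 -> s = s'.
  wlog ss : s s' / s < s'.
    move=> W Is Is' as0 as0'; have [l|l|//] := ltgtP s s'; first exact: W.
    by apply: esym; apply: W.
  move=> Is Is' as0 as0'; exfalso.
  have between x : s <= x <= s' -> I x by exact: (iI s s').
  have between' x : s < x < s' -> I x.
    by case/andP => ? ?; apply: between; rewrite !ltW.
  case: vsign => vs.
    have := @derive_gt0_lt _ a va _ _ ss (fun x xI => aD x (between x xI))
      (fun x xI => vs x (between' x xI)).
    by rewrite as0 as0' ltxx.
  have := @derive_gt0_lt _ (fun s => - a s) (fun s => - va s) _ _ ss
    (fun x xI => is_deriveN (aD x (between x xI))).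
  rewrite as0 as0' ltxx => K; suff : false by [].
  by apply: K => x xI; rewrite oppr_gt0; apply: vs; exact: between'.
suff [s [Is as0]] : exists s, I s /\ a s = 0.
  by exists s; split => // s' [Is' as0']; exact: uniq.
apply: contrapT => no0.
have a0 s : I s -> a s != 0.
  by move=> Is; apply/eqP => as0; apply: no0; exists s.
have cE : (fun s => (a s, b s)) = c by apply/funext.
pose I' := [set s | I (- s)].
have I'0 : I' !=set0 by case: I0 => s Is; exists (- s); rewrite /I' /= opprK.
have oI' : open I' by exact: open_oppr.
have iI' : is_interval I'.
  move=> x y Ix Iy z /andP[xz zy]; apply: (iI (- y) (- x)) => //.
  by rewrite !lerN2 zy.
have revD (f d : R -> R) : (forall s, I s -> is_derive s 1 f (d s)) ->
    forall s, I' s -> is_derive s 1 (fun s => f (- s)) (- d (- s)).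
  move=> fD s Is.
  have K : is_derive s 1 (fun s => f (- s)) _ := @is_derive1_comp R f (fun s => - s) s _ _
    (fD _ Is) (is_deriveN (is_derive_id s (1 : R))).
  by apply: (is_derive_eq K); rewrite mulrN1.
have aD' := revD _ _ aD; have bD' := revD _ _ bD.
have abO' s : I' s -> explicit_domain (a (- s), b (- s)) by move=> Is; exact: abO.
have cE' : (fun s => (a (- s), b (- s))) = fun s => c (- s).
  by apply/funext => s; rewrite cab.
case: (sign_constant iI oI ca a0) => asign; case: vsign => vs.
- have [||q qO] := past_endpoint I'0 oI' iI' aD' bD' abO'.
  + move=> s Is; case: (tlc _ Is) => [[A /andP[B C]]|[A _]].
      rewrite oppr_lt0; split => //.
      have -> : - vb (- s) + 2 * - va (- s) = - (vb (- s) + 2 * va (- s)) by ring.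
      by rewrite mulrN oppr_lt0 ltrN2 B C.
    by have := vs _ Is; rewrite ltNge ltW.
  + by move=> s Is; exact: asign.
  rewrite cE' => /upper_endpoint_reverse le.
  by have [_] := noend q qO; apply.
- have [||q qO] := past_endpoint I0 oI iI aD bD abO.
  + by move=> s Is; case: (tlc _ Is) => [[A _]|//]; have := vs _ Is; rewrite ltNge ltW.
  + exact: asign.
  by rewrite cE => ue; have [+ _] := noend q qO; apply.
- have [||q qO] := future_endpoint I0 iI aD bD.
  + by move=> s Is; case: (tlc _ Is) => [//|[A _]]; have := vs _ Is; rewrite ltNge ltW.
  + exact: asign.
  by rewrite cE => ue; have [+ _] := noend q qO; apply.
- have [||q qO] := future_endpoint I'0 iI' aD' bD'.
  + move=> s Is; case: (tlc _ Is) => [[A _]|[A /andP[B C]]].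
      by have := vs _ Is; rewrite ltNge ltW.
    rewrite oppr_gt0; split => //.
    have -> : - vb (- s) + 2 * - va (- s) = - (vb (- s) + 2 * va (- s)) by ring.
    by rewrite mulrN oppr_gt0 ltrN2 B C.
  + by move=> s Is; exact: asign.
  rewrite cE' => /upper_endpoint_reverse le.
  by have [_] := noend q qO; apply.
Qed.

Lemma explicit_development : globally_hyperbolic_development Om Phi.
Proof.
split.
- split; first exact: open_explicit_domain.
  by move=> x; case: (foot_slice x).
- exact: (elementary_smooth H' (elementary_potential H)).
- split; first exact: explicit_wave_equation.
  exact: explicit_initial_data.
- move=> p pO; rewrite (_ : Psi Phi p = - atan (foot p)).
    by rewrite gt_eqF// speed_gt0.
  exact: Psi_explicit.
- exact: explicit_globally_hyperbolic.
Qed.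

End ExplicitDevelopment.

(** * Every development lies in the explicit one *)

Section Uniqueness.
Variable R : realType.

Lemma quotient_curve (I : set R) (c : R -> R * R) (w : R * R) (s : R) :
  (forall e, 0 < e -> exists2 d, 0 < d & forall s', I s' -> s' != s ->
    `|s' - s| < d ->
    `|((c s').1 - (c s).1) / (s' - s) - w.1| < e /\
    `|((c s').2 - (c s).2) / (s' - s) - w.2| < e) ->
  (s' - s)^-1 *: (c s' - c s) @[s' --> within I s^'] --> w.
Proof.
move=> H A /nbhs_ballP[e e0 eA]; have [d d0 dP] := H e e0.
apply/nbhs_ballP; exists d => // s' sd ss' Is'; apply: eA.
have [|B C] := dP s' Is' ss'; first by move: sd; rewrite /ball /= distrC.
by split; [move: B|move: C]; rewrite mulrC distrC.
Qed.

Lemma derive_quotient (f : R -> R) (s d : R) : is_derive s 1 f d ->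
  forall e, 0 < e -> exists2 r, 0 < r & forall s', s' != s ->
    `|s' - s| < r -> `|(f s' - f s) / (s' - s) - d| < e.
Proof.
move=> /is_derive1_caratheodory[q [qE /continuous_eps cq <-]] e /cq/near_ball1[r r0 rP].
by exists r => // s' ss' sr; rewrite qE mulfK ?subr_eq0//; exact: rP.
Qed.

Lemma derivable_curve_limit (I : set R) (x y : R -> R) (s x' y' : R) :
  is_derive s 1 x x' -> is_derive s 1 y y' ->
  (s' - s)^-1 *: ((x s', y s') - (x s, y s)) @[s' --> within I s^'] --> (x', y').
Proof.
move=> xD yD; apply: (@quotient_curve I (fun s => (x s, y s))) => e e0.
have [d d0 dP] := derive_quotient xD e0.
have [r r0 rP] := derive_quotient yD e0.
exists (Num.min d r); first by rewrite lt_min d0.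
by move=> s' _ ss'; rewrite lt_min => /andP[A B]; split; [exact: dP|exact: rP].
Qed.

Lemma continuous_pair (x y : R -> R) (s : R) : {for s, continuous x} ->
  {for s, continuous y} -> {for s, continuous (fun s => (x s, y s))}.
Proof. by move=> cx cy A; exact: (cvg_pair cx cy). Qed.

Lemma has_grad_sub2 (f g : R * R -> R) p (a b a' b' : R) : has_grad f p a b ->
  has_grad g p a' b' ->
  has_grad (fun q => f q - 2 * g q) p (a - 2 * a') (b - 2 * b').
Proof.
move=> hf hg; have := has_gradB hf (has_gradM (has_grad_cst 2 p) hg).
by rewrite !mul0r !add0r.
Qed.

Variables (Om : set (R * R)) (Phi : R * R -> R).
Hypothesis ghd : globally_hyperbolic_development Om Phi.

Local Opaque dt dx.

Let oOm : open Om. Proof. by case: ghd => [[]]. Qed.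
Let sl x : Om (0, x). Proof. by case: ghd => [[_ +]]; exact. Qed.
Let sm v p : Om p -> differentiable (partials v Phi) p.
Proof. by case: ghd => _ + _ _ _; apply. Qed.

Let px (p : R * R) : R := dx (dt Phi) p - 2 * dx (dx Phi) p.

(** After exchanging the mixed derivatives the wave equation is the transport
    equation [Psi_t = - (2 + Psi) * Psi_x]. *)
Let has_grad_Psi p : Om p ->
  has_grad (Psi Phi) p (- (2 + Psi Phi p) * px p) (px p).
Proof.
move=> Op.
have h1 := differentiable_has_grad (sm [:: true] Op).
have h2 := differentiable_has_grad (sm [:: false] Op).
have sch : dt (dx Phi) p = dx (dt Phi) p.
  apply: (mixed_partials_eq oOm Op).
  - by move=> q Oq; exact: (sm [::] Oq).
  - by move=> q Oq; exact: (sm [:: true] Oq).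
  - by move=> q Oq; exact: (sm [:: false] Oq).
  - exact: differentiable_continuous (sm [:: true; false] Op).
  - exact: differentiable_continuous (sm [:: false; true] Op).
have wave : wave_equation Phi p by case: ghd => _ _ [W _] _ _; exact: W.
suff E : dt (dt Phi) p - 2 * dt (dx Phi) p = - (2 + Psi Phi p) * px p.
  by rewrite -E; exact: (has_grad_sub2 h1 h2).
move: wave; rewrite /wave_equation /px sch.
move: (dt (dt Phi) p) (dx (dt Phi) p) (dx (dx Phi) p) (Psi Phi p) => a b c d E.
have -> : a - 2 * b = - (2 + d) * (b - 2 * c) -
   (- a - d * b + 2 * (2 + d) * c) by ring.
by rewrite E subr0.
Qed.

Let continuous_px p : Om p -> {for p, continuous px}.
Proof.
move=> Op.
have h1 := differentiable_has_grad (sm [:: false; true] Op).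
have h2 := differentiable_has_grad (sm [:: false; false] Op).
exact: has_grad_continuous (has_grad_sub2 h1 h2).
Qed.

Let nz p : Om p -> 4 + Psi Phi p != 0.
Proof. by case: ghd => _ _ _ + _; apply. Qed.

Let Psi_slice x : Psi Phi (0, x) = - atan x.
Proof.
have [_ _ [_ ini] _ _] := ghd.
have [_ tE] := ini x; rewrite /Psi tE.
have D := differentiable_dx (sm [::] (sl x)).
have E : (fun x => partials [::] Phi (0, x)) = cst 0.
  by apply/funext => z; case: (ini z).
rewrite E in D; have := @derive_val _ _ _ _ _ _ _ D; rewrite derive_cst /= => <-.
by rewrite mulr0 subr0.
Qed.

Let slice x : Om (0, x) /\ 0 < 4 + Psi Phi (0, x).
Proof. by split => //; rewrite Psi_slice; exact: speed_gt0. Qed.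

Let gh (I : set R) (f g : R -> R) :
  I !=set0 -> open I -> is_interval I ->
  (forall t, I t -> [/\ is_derive t 1 f (g t), {for t, continuous g},
     Om (unshear (graph f t)) &
     g t * (g t - (4 + Psi Phi (unshear (graph f t)))) < 0]) ->
  (forall q, Om (unshear q) -> ~ upper_endpoint I (graph f) q /\
                               ~ lower_endpoint I (graph f) q) -> I 0.
Proof.
move=> I0 oI iI tg noend.
have [_ _ _ _ /(_ I (fun t => (t, f t - 2 * t)))] := ghd.
case; last by move=> s [[Is /= <-]].
have nb (q : R * R) (U : set (R * R)) : nbhs (q.1, q.2 + 2 * q.1) U ->
    nbhs q [set p | U (p.1, p.2 + 2 * p.1)].
  move=> /nbhs_box[e e0 eU]; apply/nbhs_box; exists (e / 3).
    by rewrite divr_gt0.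
  move=> s x /=; rewrite !ltr_norml => /andP[A1 A2] /andP[B1 B2].
  by apply: eU => /=; rewrite ltr_norml; apply/andP; split; lra.
split => //.
- by move=> t It; have [_ _ +] := tg t It.
- exists (fun t => (1, g t - 2)); split; first split.
  + rewrite (continuous_open_subspace _ oI) => t; rewrite inE => It.
    have [_ cg _ _] := tg t It.
    apply: (@continuous_pair (fun=> 1) (fun t => g t - 2)); first exact: cvg_cst.
    by apply: (@continuousB _ _ _ g (fun=> 2)) => //; exact: cvg_cst.
  + move=> t It; have [fD _ _ _] := tg t It.
    have K := is_deriveB fD (is_deriveZ 2 (is_derive_id t (1 : R))).
    have K' : is_derive t 1 (fun t => f t - 2 * t) (g t - 2).
      by apply: (is_derive_eq K); rewrite /GRing.scale /= mulr1.
    exact: (@derivable_curve_limit I (fun t => t) (fun t => f t - 2 * t) t 1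
      (g t - 2) (is_derive_id t (1 : R)) K').
  + move=> t It; have [_ _ Ot gt] := tg t It.
    apply/timelikeE; first exact: nz.
    move: gt; rewrite /unshear /graph /=; move: (Psi Phi _) (g t) => a b.
    have -> : (b - 2 + 2 * 1) * (b - 2 - (2 + a) * 1) = b * (b - (4 + a)) by ring.
    by [].
- move=> q Oq; have [|A B] := noend (q.1, q.2 + 2 * q.1).
    by rewrite /unshear /= addrK -surjective_pairing.
  split=> H; [apply: A|apply: B] => U /nb/H [s0 Is0 s0P];
    exists s0 => // s Is ss; have := s0P s Is ss; rewrite /= subrK//.
Qed.

Let L_seg p s := @L_segment R Om (Psi Phi) px oOm has_grad_Psi continuous_px nz
  slice gh p s.
Let Lbar_seg p s := @Lbar_segment R Om (Psi Phi) px oOm has_grad_Psi nz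
  slice gh p s.

(** The point where the characteristic through [p] meets [t = 0]. *)
Let Y (p : R * R) : R := p.2 - p.1 * (2 + Psi Phi p).

Let zero_between (t : R) : Num.min t 0 <= 0 <= Num.max t 0.
Proof. by rewrite ge_min le_max lexx !orbT. Qed.

Let Psi_foot p : Om p -> Psi Phi p = - atan (Y p).
Proof.
move=> Op; have [_ <-] := L_seg Op (zero_between p.1).
rewrite Psi_slice sub0r mulrN; congr (- atan _).
by rewrite /Y mulrC.
Qed.

Let char_map_Y p : Om p -> char_map p.1 (Y p) = p.2.
Proof.
by move=> Op; rewrite /char_map -Psi_foot// /Y subrK.
Qed.

Let has_grad_Y p : Om p -> exists y', has_grad Y p y' (1 - p.1 * px p).
Proof.
move=> Op; eexists.
have := has_gradB (has_grad_snd p) (has_gradM (has_grad_fst p)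
  (has_gradD (has_grad_cst 2 p) (has_grad_Psi Op))).
by rewrite mul0r !add0r; apply.
Qed.

(** Differentiating [Psi = - atan Y] in [x] gives [Psi_x * (1 + Y^2 - t) = -1]. *)
Let focusing p : Om p -> 1 + Y p ^+ 2 - p.1 != 0.
Proof.
move=> Op; have [y' hY] := has_grad_Y Op.
have hA := has_gradN (has_grad_comp (is_derive1_atan (Y p)) hY).
have near_eq : \forall q \near p, - atan (Y q) = Psi Phi q.
  apply/nbhs_box; have [e e0 eP] := open_box oOm Op.
  by exists e => // s x sp xp; rewrite Psi_foot//; exact: eP.
have [_ E1] := has_grad_partials (near_eq_has_grad near_eq hA).
have [_ E2] := has_grad_partials (has_grad_Psi Op).
move: E1; rewrite E2; move: (px p) => d.
have k0 : 0 < 1 + Y p ^+ 2 by rewrite ltr_wpDr ?sqr_ge0.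
move: (1 + _) k0 => k k0 dE; apply/eqP => kt.
have : d * k = - (1 - p.1 * d) by rewrite {1}dE; field; rewrite gt_eqF.
have -> : p.1 = k by apply/esym/eqP; rewrite -subr_eq0 kt.
lra.
Qed.

(** A later point would have on its characteristic, in the domain, the point at
    time exactly [1 + Y^2]. *)
Let before_focusing p : Om p -> p.1 < 1 + Y p ^+ 2.
Proof.
move=> Op; rewrite ltNge; apply/negP => H.
have k0 : 0 < 1 + Y p ^+ 2 by rewrite ltr_wpDr ?sqr_ge0.
have [|Or Er] := L_seg (s := 1 + Y p ^+ 2) Op.
  rewrite ge_min le_max H (ltW k0) orbT.
  by [].
have YE : Y (1 + Y p ^+ 2, p.2 + (2 + Psi Phi p) * (1 + Y p ^+ 2 - p.1)) = Y p.
  rewrite {1}/Y Er /=; rewrite [in RHS]/Y.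
  by move: (Psi Phi p) (1 + _) => a b; ring.
by have := focusing Or; rewrite YE /= subrr eqxx.
Qed.

(** If [Y <= 0] and [4 <= u] at [p], then on the line [u = const], from [p] down
    to [t = 0] where [Y = u], the foot vanishes somewhere. There [u = 4 t], so
    the time is at least [1], the focusing time of the foot [0]. *)
Let before_horizon p : Om p -> 0 < Y p \/ p.1 * (4 - atan (Y p)) < 4 - Y p.
Proof.
move=> Op; have [|Y0] := ltP 0 (Y p); [by left|right].
rewrite ltNge; apply/negP => Hu.
have u4 : 4 <= p.2 + 2 * p.1.
  by rewrite -{1}(char_map_Y Op) char_map_u -lerBlDl.
have t0 : 0 < p.1.
  rewrite ltNge; apply/negP => t0.
  have : p.1 * (4 - atan (Y p)) <= 0.
    by rewrite mulr_le0_ge0// ltW// speed_gt0.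
  by move: Hu Y0; lra.
pose l s : R := p.2 - 2 * (s - p.1).
have Ol s : 0 <= s <= p.1 -> Om (s, l s).
  by move=> sI; apply: (Lbar_seg Op); rewrite min_r ?max_l// ltW.
have lc s : {for s, continuous l}.
  have K := is_deriveB (is_derive_cst p.2 s (1 : R)) (is_deriveZ 2
    (is_deriveB (is_derive_id s (1 : R)) (is_derive_cst p.1 s (1 : R)))).
  exact: (is_derive1_continuous K).
have cY s : 0 <= s <= p.1 -> {for s, continuous (fun s => Y (s, l s))}.
  move=> sI; have [y' hY] := has_grad_Y (Ol s sI).
  apply: (@continuous_comp _ _ _ (fun s => (s, l s)) Y).
    by apply: (@continuous_pair (fun s => s)) => //; exact: cvg_id.
  exact: has_grad_continuous hY.
have [|||s sI Ys] := @IVT R (fun s => Y (s, l s)) 0 p.1 0.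
- exact: ltW.
- apply: continuous_in_subspaceT => s; rewrite inE /= in_itv /=; exact: cY.
- have -> : Y (p.1, l p.1) = Y p by rewrite /l subrr mulr0 subr0 -surjective_pairing.
  have -> : Y (0, l 0) = p.2 + 2 * p.1.
    by rewrite /Y /l /= mul0r subr0 sub0r mulrN opprK.
  rewrite ge_min le_max Y0 orbT /=; apply/orP; left.
  by apply: le_trans u4; rewrite ler0n.
have sI' : 0 <= s <= p.1 by move: sI; rewrite in_itv.
have := before_focusing (Ol s sI'); have := char_map_Y (Ol s sI').
rewrite Ys /= /char_map atan0 expr0n /= /l.
by move: u4; lra.
Qed.

Lemma development_sub_explicit p : Om p ->
  explicit_domain p /\ Psi Phi p = - atan (foot p).
Proof.
move=> Op.
have A : admissible p.1 (Y p) by split; [exact: before_focusing|exact: before_horizon].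
have E := char_map_Y Op.
by split; [exists (Y p)|rewrite (footE A E) Psi_foot].
Qed.

Variable H : R -> R.
Hypothesis H' : forall y : R, is_derive y 1 H (log_speed y).

(** Both potentials vanish on [t = 0] and have the derivative [- atan foot]
    along the lines [u = const]. *)
Lemma development_potential p : Om p -> Phi p = explicit_potential H p.
Proof.
move=> Op.
pose l s : R := p.2 - 2 * (s - p.1).
have lp : (p.1, l p.1) = p by rewrite /l subrr mulr0 subr0 -surjective_pairing.
have Ol s : Num.min p.1 0 <= s <= Num.max p.1 0 -> Om (s, l s).
  by move=> sI; exact: (Lbar_seg Op).
have lD (s : R) : is_derive s 1 l (- 2).
  have K := is_deriveB (is_derive_cst p.2 s (1 : R)) (is_deriveZ 2
    (is_deriveB (is_derive_id s (1 : R)) (is_derive_cst p.1 s (1 : R)))).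
  by apply: (is_derive_eq K); rewrite subr0 sub0r /GRing.scale /= mulr1.
pose h s := Phi (s, l s) - explicit_potential H (s, l s).
have hD (s : R) : Num.min p.1 0 <= s <= Num.max p.1 0 -> is_derive s 1 h 0.
  move=> sI; have Os := Ol s sI; have [eO PE] := development_sub_explicit Os.
  have K1 := has_grad_curve (differentiable_has_grad (sm [::] Os))
    (is_derive_id s (1 : R)) (lD s).
  have K2 := has_grad_curve (has_grad_potential H' eO)
    (is_derive_id s (1 : R)) (lD s).
  apply: (is_derive_eq (is_deriveB K1 K2)).
  move: PE; rewrite /Psi /potential_dt /=.
  move: (dt Phi _) (dx Phi _) (potential_dx _) (atan _) => a b c d E.
  by rewrite -[d]opprK -E; ring.
have h0 : h 0 = 0.
  rewrite /h; have [_ _ [_ ini] _ _] := ghd; have [-> _] := ini (l 0).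
  by have [-> _] := explicit_initial_data H' (l 0); rewrite subrr.
suff : h p.1 = 0 by rewrite /h lp => /eqP; rewrite subr_eq0 => /eqP.
rewrite -h0; have [t0|t0] := leP p.1 0.
  apply: (derive_eq0_const t0) => s sI; apply: hD.
  by rewrite min_l// max_r.
symmetry; apply: (derive_eq0_const (ltW t0)) => s sI; apply: hD.
by rewrite min_r ?max_l// ltW.
Qed.

End Uniqueness.

(** * Past cones *)

Section Cones.
Variable R : realType.
Implicit Types (psi : R) (X Y : R * R).

Lemma timelikeP psi X : 0 < 4 + psi ->
  0 < X.2 + 2 * X.1 < (4 + psi) * X.1 -> timelike psi X.
Proof.
move=> p0 /andP[A B]; apply/timelikeE; first by rewrite gt_eqF.
have -> : X.2 - (2 + psi) * X.1 = X.2 + 2 * X.1 - (4 + psi) * X.1 by ring.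
by rewrite pmulr_rlt0// subr_lt0.
Qed.

Lemma timelikeN psi X : 0 < 4 + psi ->
  (4 + psi) * X.1 < X.2 + 2 * X.1 < 0 -> timelike psi X.
Proof.
move=> p0 /andP[A B]; apply/timelikeE; first by rewrite gt_eqF.
have -> : X.2 - (2 + psi) * X.1 = X.2 + 2 * X.1 - (4 + psi) * X.1 by ring.
by rewrite nmulr_rlt0// subr_gt0.
Qed.

Lemma future_segment psi X Y : 0 < 4 + psi ->
  0 < X.2 + 2 * X.1 < (4 + psi) * X.1 -> 0 < Y.2 + 2 * Y.1 < (4 + psi) * Y.1 ->
  connected_component (timelike psi) X Y.
Proof.
move=> p0 hX hY.
pose f (s : R) : R * R := ((1 - s) * X.1 + s * Y.1, (1 - s) * X.2 + s * Y.2).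
pose S := f @` `[0, 1].
have cline (a b : R) : continuous (fun s : R => (1 - s) * a + s * b).
  move=> s; have K := is_deriveD (is_deriveZ a (is_deriveB (is_derive_cst (1 : R) s (1 : R))
    (is_derive_id s (1 : R)))) (is_deriveZ b (is_derive_id s (1 : R))).
  have := is_derive1_continuous K.
  have -> : (a *: (cst 1 - id) + b *: id : R -> R) = (fun s => (1 - s) * a + s * b).
    by apply/funext => r; rewrite !fctE /GRing.scale /=; ring.
  by [].
have cS : connected S.
  apply: connected_continuous_connected; first exact: segment_connected.
  apply: continuous_subspaceT => s; exact: (continuous_pair (cline _ _ s) (cline _ _ s)).
have SX : S X.
  exists 0; first by rewrite /= in_itv /= lexx ler01.
  by rewrite /f subr0 !mul1r !mul0r !addr0 -surjective_pairing.
have SY : S Y.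
  exists 1; first by rewrite /= in_itv /= lexx ler01.
  by rewrite /f subrr !mul1r !mul0r !add0r -surjective_pairing.
have St : S `<=` timelike psi.
  move=> _ [s + <-]; rewrite /= in_itv /= => /andP[s0 s1]; apply: timelikeP => //.
  rewrite /f /=; move: hX hY => /andP[]; move: (X.1) (X.2) (Y.1) (Y.2) => a b c d.
  move=> A B /andP[C D].
  have E1 : (1 - s) * b + s * d + 2 * ((1 - s) * a + s * c) =
    (1 - s) * (b + 2 * a) + s * (d + 2 * c) by ring.
  have E2 : (4 + psi) * ((1 - s) * a + s * c) =
    (1 - s) * ((4 + psi) * a) + s * ((4 + psi) * c) by ring.
  rewrite E1 E2; move: A B C D.
  move: (b + 2 * a) (d + 2 * c) (_ * a) (_ * c) => x y k l A B C D.
  have [s00|s0'] := eqVneq s 0; first by rewrite s00 subr0 !mul1r !mul0r !addr0 A B.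
  have sp : 0 < s by rewrite lt_def s0'.
  have s1' : 0 <= 1 - s by rewrite subr_ge0.
  apply/andP; split; first by rewrite ltr_wpDl ?mulr_ge0 ?(ltW A)// mulr_gt0.
  by apply: ler_ltD; [rewrite ler_wpM2l// ltW|rewrite ltr_pM2l].
by exists S.
Qed.

(** The timelike vectors with [0 < X.1] form a convex cone, whose closure
    contains [vecL] and [vecLbar]. A vector with [X.1 < 0] has another connected
    component, because no timelike vector has [X.1 = 0]. *)
Lemma past_timelikeE psi X : 0 < 4 + psi ->
  past_timelike psi X <-> X.1 < 0 /\ (4 + psi) * X.1 < X.2 + 2 * X.1 < 0.
Proof.
move=> p0; split=> [[tX nfX]|[X1 hX]].
  have [[X1 hX]|//] := timelike_components p0 tX.
  exfalso; apply: nfX; split => //=.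
  have near_cone (Z : R * R) : 0 <= Z.2 + 2 * Z.1 <= (4 + psi) * Z.1 ->
      closure (connected_component (timelike psi) X) Z.
    move=> /andP[Z0 Z1] U /nbhs_box[e e0 eU].
    pose m := 1 + `|X.1| + `|X.2|; have m0 : 0 < m by rewrite /m -addrA ltr_wpDr ?addr_ge0.
    pose d := e / m; have d0 : 0 < d by rewrite divr_gt0.
    have dm : d * m = e by rewrite /d divfK// gt_eqF.
    exists (Z.1 + d * X.1, Z.2 + d * X.2); split.
      apply: future_segment => //=; move: hX => /andP[].
      have -> : Z.2 + d * X.2 + 2 * (Z.1 + d * X.1) =
        Z.2 + 2 * Z.1 + d * (X.2 + 2 * X.1) by ring.
      move: (X.2 + 2 * X.1) => A hA hB.
      apply/andP; split; first by rewrite ltr_wpDl// mulr_gt0.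
      by rewrite mulrDr; apply: ler_ltD => //; rewrite mulrCA ltr_pM2l.
    have K x : `|x| < m -> `|d * x| < e.
      by move=> xm; rewrite normrM (gtr0_norm d0) -dm ltr_pM2l.
    by apply: eU => /=; rewrite addrC addKr; apply: K; rewrite /m;
      move: (normr_ge0 X.1) (normr_ge0 X.2); lra.
  split; apply: near_cone; rewrite /vecL /vecLbar /=.
    by move: p0; lra.
  by move: p0; lra.
split; first exact: timelikeN.
move=> [_ /= [cL _]].
have nb : nbhs (vecL psi) [set Y : R * R | 0 < Y.1].
  apply/nbhs_box; exists 1 => // s x /=.
  by rewrite ltr_norml => /andP[+ _]; lra.
have [Y [[B [BX BT cB] BY] Y1]] := cL _ nb.
have cF : connected (fst @` B).
  apply: connected_continuous_connected => //.
  apply: continuous_subspaceT => p; exact: has_grad_continuous (has_grad_fst p).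
have : (fst @` B) 0.
  apply: ((connected_intervalP _).1 cF X.1 Y.1); [by exists X|by exists Y|].
  by rewrite (ltW X1) ltW.
move=> [Z BZ Z1]; have := timelike_components p0 (BT _ BZ).
by rewrite Z1 ltxx => -[[]|[]].
Qed.

(** Small multiples of the past timelike vector [(- 1, 2 - (4 + psi) / 2)] are
    added to show that the null vector is in the closure. *)
Lemma past_causal_L psi k : 0 < 4 + psi -> k < 0 ->
  past_causal psi (k, k * (2 + psi)).
Proof.
move=> p0 k0; split.
  split; first by apply/eqP => -[kE _]; rewrite kE ltxx in k0.
  by rewrite acoustical_metricE /= (mulrC k) subrr !mulr0.
move=> U /nbhs_box[e e0 eU].
pose m := 1 + `|2 - (4 + psi) / 2|; have m0 : 0 < m by rewrite ltr_wpDr.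
pose d := e / m / 2; have d0 : 0 < d by rewrite !divr_gt0.
have dm : d * m < e.
  by rewrite /d mulrAC divfK ?gt_eqF//; move: e0; lra.
exists (k - d, k * (2 + psi) + d * (2 - (4 + psi) / 2)); split.
  apply/past_timelikeE => //=; split; first by move: k0 d0; lra.
  have kp : (4 + psi) * k < 0 by rewrite pmulr_rlt0.
  have dp : 0 < (4 + psi) * d by rewrite mulr_gt0.
  have E : k * (2 + psi) + d * (2 - (4 + psi) / 2) + 2 * (k - d) =
    (4 + psi) * k - (4 + psi) * d / 2 by field.
  rewrite E mulrBr; move: ((4 + psi) * k) ((4 + psi) * d) kp dp => x y; lra.
apply: eU => /=; rewrite addrC addKr.
  rewrite normrN (gtr0_norm d0); apply: le_lt_trans dm.
  by rewrite ler_peMr ?(ltW d0)// lerDl.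
rewrite normrM (gtr0_norm d0); apply: le_lt_trans dm.
by rewrite ler_pM2l// lerDr.
Qed.

End Cones.

(** * The extension of Psi to the singular boundary *)

Section Bubble.
Variable R : realType.
Implicit Types (s t x y z : R) (p q : R * R).

Let Om := @explicit_domain R.
Variable Phi : R * R -> R.
Hypothesis PsiE : forall p, Om p -> Psi Phi p = - atan (foot p).

(** The point of the singular boundary where the characteristic issued from [z]
    ends. *)
Definition fold z : R * R := (1 + z ^+ 2, char_map (1 + z ^+ 2) z).

Lemma Psi_extE p y : closure Om p ->
  (forall e, 0 < e -> exists2 d, 0 < d & forall q, Om q ->
     `|q.1 - p.1| < d -> `|q.2 - p.2| < d -> `|foot q - y| < e) ->
  Psi_ext Om Phi p = - atan y.
Proof.
move=> cp lim_foot; rewrite /Psi_ext.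
have PF : ProperFilter (within Om (nbhs p)) by exact: within_nbhs_proper.
apply: (cvg_lim (@Rhausdorff R)).
move=> A /near_ball1[e e0 eA].
have [d d0 dP] : exists2 d, 0 < d & forall y', `|y' - y| < d -> `|atan y' - atan y| < e.
  have /continuous_eps/(_ e e0)/near_ball1 := @continuous_atan R y; exact.
have [r r0 rP] := lim_foot d d0.
apply/nbhs_box; exists r => // s x sp xp Oq; apply: eA.
have K := dP _ (rP (s, x) Oq sp xp).
by rewrite PsiE// opprK addrC distrC; exact: K.
Qed.

Lemma Psi_ext_inside p : Om p -> Psi_ext Om Phi p = - atan (foot p).
Proof.
move=> pO; apply: Psi_extE; first exact: subset_closure.
move=> e e0; have [d d0 dP] := foot_near pO e0; exists d => // -[s x] _ sp xp.
by case: (dP s x sp xp).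
Qed.

Lemma fold_char t z : 0 < z -> t < 1 + z ^+ 2 ->
  Om (t, char_map t z) /\ foot (t, char_map t z) = z.
Proof.
move=> z0 tz; have A : admissible t z by split => //; left.
by split; [exists z|exact: (@footE R (t, char_map t z))].
Qed.

Lemma char_map_dist t t' y : `|char_map t y - char_map t' y| <= 4 * `|t - t'|.
Proof.
have -> : char_map t y - char_map t' y = (t - t') * (2 - atan y).
  by rewrite /char_map; move: (atan y) => a; ring.
rewrite normrM mulrC ler_wpM2r// ler_norml.
by have /andP[a b] := atan_lt2 y; apply/andP; split; lra.
Qed.

Lemma closure_fold z : 0 < z -> closure Om (fold z).
Proof.
move=> z0 U /nbhs_box[e e0 eU].
pose t := 1 + z ^+ 2 - e / 5.
have tz : t < 1 + z ^+ 2 by rewrite ltrBlDr ltrDl divr_gt0.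
have tE : `|t - (1 + z ^+ 2)| = e / 5.
  by rewrite /t addrAC subrr sub0r normrN gtr0_norm// divr_gt0.
exists (t, char_map t z); split; first by case: (fold_char z0 tz).
apply: eU => /=; first by rewrite tE; lra.
by apply: (le_lt_trans (char_map_dist _ _ _)); rewrite tE; lra.
Qed.

(** For a point of the domain near the fold, a positive foot much smaller than
    [z] would have focused earlier, a foot [<= 0] would put the point on the
    left of [u = 4], and a foot much larger than [z] would put it too far to the
    right. *)
Lemma foot_near_fold z e : 0 < z -> 0 < e -> exists2 d, 0 < d &
  forall q, Om q -> `|q.1 - (fold z).1| < d -> `|q.2 - (fold z).2| < d ->
  `|foot q - z| < e.
Proof.
move=> z0 e0'; pose e1 := Num.min e z.
have e10 : 0 < e1 by rewrite lt_min e0'.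
have e1e : e1 <= e by rewrite ge_min lexx.
have e1z : e1 <= z by rewrite ge_min lexx orbT.
clearbody e1; pose tp := 1 + z ^+ 2.
have tp1 : 1 <= tp by rewrite lerDl sqr_ge0.
have sq y : z < y -> tp < 1 + y ^+ 2.
  by move=> zy; rewrite ltrD2l ltr_pXn2r ?nnegrE ?ltW// (lt_trans z0).
have g1 : char_map tp z < char_map tp (z + e1).
  by apply: char_map_lt; [rewrite ltrDl|move=> y /andP[zy _]; exact: sq].
have g2 : (z - e1) ^+ 2 < z ^+ 2.
  by rewrite ltr_pXn2r ?nnegrE ?subr_ge0 ?(ltW z0)// gtrBl.
have g3 := right_branch_u tp1 z0.
have g4 : tp < 1 + (z + e1) ^+ 2 by apply: sq; rewrite ltrDl.
pose d := Num.min (Num.min ((char_map tp (z + e1) - char_map tp z) / 5)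
  (z ^+ 2 - (z - e1) ^+ 2))
  (Num.min ((char_map tp z + 2 * tp - 4) / 3) (1 + (z + e1) ^+ 2 - tp)).
have d0 : 0 < d.
  by rewrite !lt_min [X in _ && X && _]subr_gt0 [X in _ && (_ && X)]subr_gt0 g2 g4
    !divr_gt0 ?subr_gt0.
have [d1 [d2 [d3 d4]]] : d <= (char_map tp (z + e1) - char_map tp z) / 5 /\
    d <= z ^+ 2 - (z - e1) ^+ 2 /\ d <= (char_map tp z + 2 * tp - 4) / 3 /\
    d <= 1 + (z + e1) ^+ 2 - tp by rewrite /d !ge_min !lexx ?orbT.
clearbody d; exists d => // q qO; rewrite /fold /= -/tp => qt qx.
have [A E] := footP qO; move: (foot q) A E => y A E.
move: qt qx; rewrite ltr_norml => /andP[t1 t2]; rewrite ltr_norml => /andP[x1 x2].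
apply: lt_le_trans e1e; rewrite ltr_norml; apply/andP; split.
  rewrite ltrNl opprB ltrBlDr -ltrBlDl ltNge; apply/negP => yz.
  have [y0|y0] := leP y 0.
    have := left_branch_u A y0; rewrite E.
    by move: t1 x1 d3; move: (char_map tp z) => a; lra.
  have : y ^+ 2 <= (z - e1) ^+ 2.
    by rewrite ler_pXn2r ?nnegrE ?subr_ge0 ?(ltW y0).
  have [A1 _] := A; move: A1 t1 d2; rewrite /tp.
  by move: (y ^+ 2) (z ^+ 2) ((_ - _) ^+ 2) => a b c; lra.
rewrite ltrBlDl ltNge; apply/negP => yz.
have ty : q.1 < 1 + (z + e1) ^+ 2 by move: t2 d4; lra.
have L : char_map q.1 (z + e1) <= q.2.
  rewrite -E; move: yz; rewrite le_eqVlt => /predU1P[->//|yz].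
  apply/ltW/char_map_lt => // r /andP[r1 _]; apply: (lt_trans ty).
  by rewrite ltrD2l ltr_pXn2r ?nnegrE ?addr_ge0 ?ltW// (lt_trans _ r1)// addr_gt0.
have := char_map_dist q.1 tp (z + e1).
have : `|q.1 - tp| < d by rewrite ltr_norml t1 t2.
rewrite ler_norml => Q /andP[C _].
move: L C Q x2 d1; move: (char_map _ _) (char_map _ _) (char_map _ _) (`|_|).
by move=> a b c f; lra.
Qed.

Lemma Psi_ext_fold z : 0 < z -> Psi_ext Om Phi (fold z) = - atan z.
Proof.
move=> z0; apply: Psi_extE; first exact: closure_fold.
by move=> e e0; exact: foot_near_fold.
Qed.

Lemma Psi_ext_char t z : 0 < z -> t <= 1 + z ^+ 2 ->
  closure Om (t, char_map t z) /\ Psi_ext Om Phi (t, char_map t z) = - atan z.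
Proof.
move=> z0; rewrite le_eqVlt => /predU1P[->|tz].
  by split; [exact: closure_fold|exact: Psi_ext_fold].
have [tO tF] := fold_char z0 tz.
by split; [exact: subset_closure|rewrite Psi_ext_inside ?tF].
Qed.

End Bubble.

(** * The two pasts of a point of the singular boundary *)

Section Pasts.
Variable R : realType.
Implicit Types (s t x y z : R) (p q : R * R).

Lemma interval_induction (Q : R -> Prop) (al be : R) : Q al ->
  (forall s, al <= s < be -> Q s -> exists2 d, 0 < d &
     forall s', s < s' < s + d -> s' <= be -> Q s') ->
  (forall s, al < s <= be -> (forall r, al <= r < s -> Q r) -> Q s) ->
  forall s, al <= s <= be -> Q s.
Proof.
move=> Qal next closed s /andP[als sbe]; apply: contrapT => nQs.
pose A := [set s' | al <= s' <= s /\ forall r, al <= r <= s' -> Q r].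
have Aal : A al.
  split; first by rewrite lexx.
  by move=> r; rewrite -eq_le => /eqP <-.
have A0 : A !=set0 by exists al.
have Aub : has_ubound A by exists s => r [/andP[]].
pose sg := sup A.
have alsg : al <= sg by apply: (ub_le_sup Aub).
have sgs : sg <= s by apply: ge_sup => // r [/andP[]].
have below r : al <= r < sg -> Q r.
  move=> /andP[r1 r2]; have [s' [_ As'] rs'] := sup_gt A0 r2.
  by apply: As'; rewrite r1 ltW.
have Qsg : Q sg.
  move: alsg; rewrite le_eqVlt => /predU1P[<-//|alsg].
  by apply: closed => //; rewrite alsg (le_trans sgs).
have upto r : al <= r <= sg -> Q r.
  move=> /andP[r1]; rewrite le_eqVlt => /predU1P[->//|r2].
  by apply: below; rewrite r1.
have sgs' : sg < s.
  by rewrite lt_neqAle sgs andbT; apply/eqP => E; apply: nQs; rewrite -E.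
have [|d d0 dP] := next sg _ Qsg.
  by rewrite alsg (lt_le_trans sgs').
pose s' := Num.min s (sg + d / 2).
have ss' : sg < s' by rewrite lt_min sgs' ltrDl divr_gt0.
have s's : s' <= s by rewrite ge_min lexx.
have s'd : s' <= sg + d / 2 by rewrite ge_min lexx orbT.
have : A s'.
  split; first by rewrite s's (le_trans alsg)// ltW.
  move=> r /andP[r1 r2]; have [rs|rs] := leP r sg; first by apply: upto; rewrite r1.
  apply: dP; last by rewrite (le_trans r2)// (le_trans s's).
  by rewrite rs; move: r2 s'd d0; lra.
by move=> /(ub_le_sup Aub); rewrite leNgt ss'.
Qed.

Lemma quotient_continuous (I : set R) (c : R -> R * R) (w : R * R) s :
  (s' - s)^-1 *: (c s' - c s) @[s' --> within I s^'] --> w ->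
  forall e, 0 < e -> exists2 d, 0 < d & forall s', I s' -> `|s' - s| < d ->
    `|(c s').1 - (c s).1| < e /\ `|(c s').2 - (c s).2| < e.
Proof.
move=> /curve_quotient/(_ 1 ltr01)[d d0 dP] e e0.
pose m := 1 + `|w.1| + `|w.2|.
have m0 : 0 < m by rewrite /m -addrA ltr_wpDr ?addr_ge0.
exists (Num.min d (e / m)); first by rewrite lt_min d0 divr_gt0.
move=> s' Is'; rewrite lt_min => /andP[sd se].
have [->|ss'] := eqVneq s' s; first by rewrite !subrr normr0.
have [A B] := dP s' Is' ss' sd.
have h0 : s' - s != 0 by rewrite subr_eq0.
have K (D k : R) : `|D / (s' - s) - k| < 1 -> 1 + `|k| <= m -> `|D| < e.
  move=> Dk km.
  have -> : D = D / (s' - s) * (s' - s) by rewrite divfK.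
  rewrite normrM; apply: (@le_lt_trans _ _ (m * `|s' - s|)).
    rewrite ler_wpM2r//; apply: le_trans km.
    have -> : D / (s' - s) = D / (s' - s) - k + k by rewrite subrK.
    by apply: le_trans (ler_normD _ _) _; rewrite lerD2r ltW.
  by rewrite mulrC -ltr_pdivlMr.
by split; [apply: K A _|apply: K B _]; rewrite /m;
  move: (normr_ge0 w.1) (normr_ge0 w.2); lra.
Qed.

Let Om := @explicit_domain R.
Variable Phi : R * R -> R.
Hypothesis PsiE : forall p, Om p -> Psi Phi p = - atan (foot p).

(** At the time of the fold the points on its right are reached by
    characteristics with a larger foot, which still exist. *)
Lemma Psi_ext_after_fold z x : 0 < z -> char_map (1 + z ^+ 2) z < x ->
  exists y, Psi_ext Om Phi (1 + z ^+ 2, x) = - atan y.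
Proof.
move=> z0; set tp := 1 + z ^+ 2 => zx.
have tp0 : 0 < tp by rewrite ltr_wpDr ?sqr_ge0.
pose M := z + `|x|.
have zM : z <= M by rewrite lerDl.
have [|||y yI yE] := @IVT R (char_map tp) z M x => //.
- exact/continuous_subspaceT/continuous_char_map.
- apply/andP; split; first by rewrite ge_min ltW.
  rewrite le_max; apply/orP; right; rewrite /char_map.
  have /andP[_ a2] := atan_lt2 M.
  apply: (@le_trans _ _ M).
    by rewrite (le_trans (ler_norm x))// lerDr ltW.
  by rewrite lerDl mulr_ge0 ?(ltW tp0)// subr_ge0 ltW.
have zy : z < y.
  move: yI; rewrite in_itv /= => /andP[+ _]; rewrite le_eqVlt => /predU1P[zy|//].
  by move: zx; rewrite zy yE ltxx.
have [|yO yF] := fold_char (lt_trans z0 zy) (t := tp).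
  by rewrite ltrD2l ltr_pXn2r ?nnegrE ?(ltW z0)// ltW// (lt_trans z0).
by exists y; rewrite -yE (Psi_ext_inside PsiE)// yF.
Qed.

(** The region on the right of the characteristic of foot [z], up to the time of
    [fold z], cannot be left by a past timelike curve. When the curve touches
    the characteristic, [Psi] is [- atan z] there and the curve is timelike, so
    it moves strictly to the right of the characteristic; when it is at the
    final time, on the right of the fold, [Psi] is again some [- atan y] and the
    time decreases. *)
Lemma past_piece z (al be : R) (c v : R -> R * R) : 0 < z -> al <= be ->
  C1_curve `[al, be]%classic c v ->
  (forall s, s \in `[al, be] -> past_timelike (Psi_ext Om Phi (c s)) (v s)) ->
  char_map (c al).1 z <= (c al).2 /\ (c al).1 <= 1 + z ^+ 2 ->
  char_map (c be).1 z <= (c be).2 /\ (c be).1 <= 1 + z ^+ 2.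
Proof.
move=> z0 albe [_ cD] past.
set tp := 1 + z ^+ 2 => Qal.
have /andP[k1 k2] := atan_lt2 z.
pose F s := (c s).2 - char_map (c s).1 z.
pose Q s := 0 <= F s /\ (c s).1 <= tp.
have FD s s' : F s' - F s = ((c s').2 - (c s).2) -
    (2 - atan z) * ((c s').1 - (c s).1).
  by rewrite /F /char_map; move: (c s) (c s') (atan z) => [? ?] [? ?] k /=; ring.
have ccont s : al <= s <= be -> forall e, 0 < e -> exists2 d, 0 < d &
    forall s', al <= s' <= be -> `|s' - s| < d ->
    `|(c s').1 - (c s).1| < e /\ `|F s' - F s| < e.
  move=> sI e e0; have e5 : 0 < e / 5 by rewrite divr_gt0.
  have sI' : `[al, be]%classic s by rewrite /= in_itv.
  have [d d0 dP] := quotient_continuous (cD s sI') e5.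
  exists d => // s' s'I sd; have [|A B] := dP s' _ sd; first by rewrite /= in_itv.
  split; first by apply: (lt_trans A); move: e0; lra.
  rewrite FD; apply: le_lt_trans (ler_normB _ _) _; rewrite normrM.
  have k0 : `|2 - atan z| <= 4 by rewrite ler_norml; apply/andP; split; lra.
  have := ler_wpM2r (normr_ge0 ((c s').1 - (c s).1)) k0.
  move=> K; apply: (@lt_le_trans _ _ (e / 5 + 4 * (e / 5))); last lra.
  by apply: ltr_leD => //; apply: le_trans K _; rewrite ler_pM2l// ltW.
suff H : forall s, al <= s <= be -> Q s.
  have [] := H be _; first by rewrite albe lexx.
  by rewrite /F subr_ge0.
apply: interval_induction.
- by case: Qal => A B; split => //; rewrite /F subr_ge0.
- move=> s /andP[als sbe] [Fs Ts].
  have sI : al <= s <= be by rewrite als ltW.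
  have sI' : `[al, be]%classic s by rewrite /= in_itv.
  have cq := curve_quotient (cD s sI').
  have pst : past_timelike (Psi_ext Om Phi (c s)) (v s) by apply: past; rewrite in_itv.
  have vneg y : Psi_ext Om Phi (c s) = - atan y -> (v s).1 < 0 /\
      0 < (v s).2 - (2 - atan y) * (v s).1.
    move=> PE; move: pst; rewrite PE => /(past_timelikeE _ (speed_gt0 y)) [A /andP[B _]].
    split => //; move: B; rewrite -subr_gt0.
    by have -> : (v s).2 + 2 * (v s).1 - (4 + - atan y) * (v s).1 =
      (v s).2 - (2 - atan y) * (v s).1 by ring.
  have onfold : F s = 0 -> Psi_ext Om Phi (c s) = - atan z.
    move=> /eqP; rewrite /F subr_eq0 => /eqP E.
    by rewrite (surjective_pairing (c s)) E; case: (Psi_ext_char PsiE z0 Ts).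
  have [d1 d10 d1P] : exists2 d, 0 < d & forall s', s < s' < s + d -> s' <= be ->
      (c s').1 <= tp.
    move: Ts; rewrite le_eqVlt => /predU1P[Ts|Ts].
      have [y PE] : exists y, Psi_ext Om Phi (c s) = - atan y.
        move: Fs; rewrite le_eqVlt => /predU1P[/esym/onfold PE|Fs].
          by exists z.
        rewrite (surjective_pairing (c s)) Ts; apply: Psi_ext_after_fold => //.
        by move: Fs; rewrite /F subr_gt0 Ts.
      have [v1 _] := vneg y PE.
      have nv : 0 < - (v s).1 by rewrite oppr_gt0.
      have [d d0 dP] := cq _ nv.
      exists d => // s' /andP[ss' s'd] s'be.
      have s'I : `[al, be]%classic s'.
        by rewrite /= in_itv /= s'be (le_trans als)// ltW.
      have [||A _] := dP s' s'I; first by rewrite gt_eqF.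
        by rewrite gtr0_norm ?subr_gt0//; move: s'd; lra.
      have h0 : 0 < s' - s by rewrite subr_gt0.
      move: A; rewrite ltr_norml => /andP[_]; rewrite ltrBlDr addNr.
      by rewrite ltr_pdivrMr// mul0r subr_lt0 Ts => /ltW.
    have e0 : 0 < tp - (c s).1 by rewrite subr_gt0.
    have [d d0 dP] := ccont s sI _ e0; exists d => // s' /andP[ss' s'd] s'be.
    have [||A _] := dP s'; first by rewrite s'be (le_trans als)// ltW.
      by rewrite gtr0_norm ?subr_gt0//; move: s'd; lra.
    move: A; rewrite ltr_norml => /andP[_].
    by move: ((c s').1) ((c s).1) => x y; lra.
  have [d2 d20 d2P] : exists2 d, 0 < d & forall s', s < s' < s + d -> s' <= be ->
      0 <= F s'.
    move: Fs; rewrite le_eqVlt => /predU1P[/esym Fs|Fs].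
      have [_ w0] := vneg z (onfold Fs).
      (* The quotient of [F] is that of the second coordinate minus [2 - atan
         z], which is at most [4], times that of the first: errors below [e] in
         both cost less than [5 * e]. *)
      pose e := ((v s).2 - (2 - atan z) * (v s).1) / 5.
      have e0 : 0 < e by rewrite divr_gt0.
      have [d d0 dP] := cq _ e0.
      exists d => // s' /andP[ss' s'd] s'be.
      have s'I : `[al, be]%classic s'.
        by rewrite /= in_itv /= s'be (le_trans als)// ltW.
      have [||A B] := dP s' s'I; first by rewrite gt_eqF.
        by rewrite gtr0_norm ?subr_gt0//; move: s'd; lra.
      have h0 : 0 < s' - s by rewrite subr_gt0.
      have -> : F s' = ((((c s').2 - (c s).2) / (s' - s)) -
         (2 - atan z) * (((c s').1 - (c s).1) / (s' - s))) * (s' - s).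
        rewrite -[F s']subr0 -Fs FD.
        by move: (_ - (c s).2) (_ - (c s).1) => x y; field; rewrite gt_eqF.
      rewrite mulr_ge0 ?(ltW h0)//.
      have eE : 5 * e = (v s).2 - (2 - atan z) * (v s).1 by rewrite /e; field.
      move: A B eE e0; rewrite !ltr_norml => /andP[A1 A2] /andP[B1 B2].
      have [k0 k4] : 0 <= 2 - atan z /\ 2 - atan z <= 4 by split; lra.
      clearbody e; move: (_ / _) (_ / _) (2 - atan z) k0 k4 A1 A2 B1 B2.
      move=> D2 D1 k k0 k4 A1 A2 B1 B2 eE e0.
      have K1 : k * D1 <= k * ((v s).1 + e) by rewrite ler_wpM2l//; move: A2; lra.
      have K2 : k * e <= 4 * e by rewrite ler_wpM2r// ltW.
      move: K1; rewrite mulrDr => K1.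
      move: (k * D1) (k * (v s).1) (k * e) K1 K2 eE B1 e0 => x1 x2 x3; lra.
    have [d d0 dP] := ccont s sI _ Fs; exists d => // s' /andP[ss' s'd] s'be.
    have [||_ A] := dP s'; first by rewrite s'be (le_trans als)// ltW.
      by rewrite gtr0_norm ?subr_gt0//; move: s'd; lra.
    move: A; rewrite ltr_norml => /andP[+ _].
    by move: (F s') (F s) => x y; lra.
  exists (Num.min d1 d2); first by rewrite lt_min d10.
  move=> s' /andP[ss' s'd] s'be.
  have m1 : Num.min d1 d2 <= d1 by rewrite ge_min lexx.
  have m2 : Num.min d1 d2 <= d2 by rewrite ge_min lexx orbT.
  split; [apply: d2P|apply: d1P] => //; rewrite ss' (lt_le_trans s'd)// lerD2l//.
move=> s /andP[als sbe] below.
have sI : al <= s <= be by rewrite ltW.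
have approx (e : R) : 0 < e -> exists r, Q r /\ `|(c r).1 - (c s).1| < e /\ `|F r - F s| < e.
  move=> e0; have [d d0 dP] := ccont s sI e e0.
  pose r := Num.max al (s - d / 2).
  have r1 : al <= r by rewrite le_max lexx.
  have r2 : s - d / 2 <= r by rewrite le_max lexx orbT.
  have rs : r < s by rewrite gt_max als /=; move: d0; lra.
  exists r; split; first by apply: below; rewrite r1.
  apply: dP; first by rewrite r1 (le_trans (ltW rs)).
  by rewrite ltr_norml; apply/andP; split; move: r2 rs d0; lra.
split; rewrite leNgt; apply/negP => H.
  have e0 : 0 < - F s by rewrite oppr_gt0.
  have [r [[Fr _] [_ A]]] := approx _ e0.
  by move: A Fr; rewrite ltr_norml => /andP[_]; move: (F r) (F s) => x y; lra.
have e0 : 0 < (c s).1 - tp by rewrite subr_gt0.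
have [r [[_ Tr] [A _]]] := approx _ e0.
move: A Tr; rewrite ltr_norml => /andP[+ _].
by move: ((c r).1) ((c s).1) => x y; lra.
Qed.

Lemma chronological_past_right z q : 0 < z ->
  chronological_past Om Phi (fold z) q -> char_map q.1 z <= q.2.
Proof.
move=> z0 [n [tau [c [[n0 tauS] [c0 cn] _ pieces]]]].
suff H i : (i <= n)%N ->
    char_map (c (tau i)).1 z <= (c (tau i)).2 /\ (c (tau i)).1 <= 1 + z ^+ 2.
  by have [+ _] := H n (leqnn n); rewrite cn.
elim: i => [_|i IH iN]; first by rewrite c0 /fold /= !lexx.
have [v [C1 past]] := pieces i iN.
by apply: (past_piece z0 (ltW (tauS i iN)) C1 past); apply: IH; exact: ltnW.
Qed.

(** The derivative of [fold] at [z] is [2 z] times [L]. So a causal curve goes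
    down along the singular boundary from [fold z] to [fold y], and then down
    the characteristic of foot [y]. *)
Lemma causal_past_below z y t : 0 < y -> y < z -> t < 1 + y ^+ 2 ->
  causal_past Om Phi (fold z) (t, char_map t y).
Proof.
move=> y0 yz ty.
(* For [- z <= s <= - y] the curve is [fold (- s)]; after that time runs
   backwards at unit speed, starting from [1 + y^2] at [s = - y]. *)
pose T1 (s : R) : R := 1 + s * s.
pose X1 (s : R) : R := - s + (1 + s * s) * (2 + atan s).
pose T2 (s : R) : R := 1 + y ^+ 2 - y - s.
pose X2 (s : R) : R := y + (1 + y ^+ 2 - y - s) * (2 - atan y).
pose c s := if s < - y then (T1 s, X1 s) else (T2 s, X2 s).
pose en := 1 + y ^+ 2 - y - t.
have en0 : - y < en by rewrite /en; move: ty; lra.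
have zy : - z < - y by rewrite ltrN2.
pose tau (i : nat) : R := if i is 0%N then - z else if i is 1%N then - y else en.
have c1 s : c s = fold (- s) \/ - y <= s.
  have [sy|sy] := ltP s (- y); last by right.
  by left; rewrite /c sy /fold /char_map sqrrN atanN opprK expr2.
have c1' s : s <= - y -> c s = (T1 s, X1 s).
  move=> sy; rewrite /c; case: ltP => // ys.
  have -> : s = - y by apply/eqP; rewrite eq_le sy ys.
  rewrite /T1 /X1 /T2 /X2 atanN; congr pair; move: (atan y) => a; ring.
have c1f s : s <= - y -> c s = fold (- s).
  move=> sy; rewrite c1'// /fold /char_map sqrrN atanN opprK expr2.
  by rewrite /T1 /X1.
have c2 s : - y <= s -> c s = (T2 s, X2 s) by move=> sy; rewrite /c ltNge sy.
have c2f s : - y <= s -> c s = (T2 s, char_map (T2 s) y) by exact: c2.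
have T2le s : - y <= s -> T2 s <= 1 + y ^+ 2 by rewrite /T2; lra.
exists 2%N, tau, c; split.
- by split => // -[|[|]].
- split; rewrite /=.
    by rewrite c1f ?(ltW zy)// opprK.
  rewrite c2f ?(ltW en0)//.
  by have -> : T2 en = t by rewrite /T2 /en; ring.
- move=> s; rewrite /= in_itv /= => /andP[s1 s2].
  have [sy|sy] := leP s (- y).
    by rewrite c1f//; apply: closure_fold; rewrite ltrNr oppr0; lra.
  by rewrite c2f ?ltW//; case: (Psi_ext_char PsiE y0 (T2le s (ltW sy))).
have sD (s : R) : is_derive s 1 (fun s : R => s) 1 by exact: is_derive_id.
have T1D (s : R) : is_derive s 1 T1 (2 * s).
  have K := is_deriveD (is_derive_cst (1 : R) s (1 : R)) (is_deriveM (sD s) (sD s)).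
  by apply: (is_derive_eq K); rewrite /GRing.scale /= add0r !mulr1 -mulr2n mulr_natl.
have X1D (s : R) : is_derive s 1 X1 (2 * s * (2 + atan s)).
  have K := is_deriveD (is_deriveN (sD s)) (is_deriveM (T1D s)
    (is_deriveD (is_derive_cst (2 : R) s (1 : R)) (is_derive1_atan s))).
  apply: (is_derive_eq K); rewrite /GRing.scale /= add0r /T1 !fctE -expr2.
  have : 0 < 1 + s ^+ 2 by rewrite ltr_wpDr ?sqr_ge0.
  rewrite /cst; move: (1 + s ^+ 2) (atan s) => k a k0.
  by field; rewrite gt_eqF.
have T2D (s : R) : is_derive s 1 T2 (- 1).
  have K := is_deriveB (is_derive_cst (1 + y ^+ 2 - y) s (1 : R)) (sD s).
  by apply: (is_derive_eq K); rewrite sub0r.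
have X2D (s : R) : is_derive s 1 X2 (- (2 - atan y)).
  have K := is_deriveD (is_derive_cst y s (1 : R)) (is_deriveZ (2 - atan y) (T2D s)).
  have -> : X2 = cst y + (2 - atan y) *: T2.
    by apply/funext => r; rewrite /X2 !fctE /GRing.scale /= mulrC.
  by apply: (is_derive_eq K); rewrite add0r /GRing.scale /= mulrN1.
have onI (I : set R) (x1 x2 : R -> R) (s d1 d2 : R) : I s ->
    (forall s', I s' -> c s' = (x1 s', x2 s')) ->
    is_derive s 1 x1 d1 -> is_derive s 1 x2 d2 ->
    (s' - s)^-1 *: (c s' - c s) @[s' --> within I s^'] --> (d1, d2).
  move=> Is cE D1 D2; apply: quotient_curve => e e0.
  have [d d0 dP] := derive_quotient D1 e0; have [r r0 rP] := derive_quotient D2 e0.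
  exists (Num.min d r); first by rewrite lt_min d0.
  move=> s' Is' ss'; rewrite lt_min => /andP[A B]; rewrite !cE//.
  by split; [exact: dP|exact: rP].
case=> [_|[_|//]] /=.
- exists (fun s => (2 * s, 2 * s * (2 + atan s))); split; first split.
  + apply: continuous_subspaceT => s.
    have cs : {for s, continuous (fun s : R => 2 * s)}.
      exact: (is_derive1_continuous (is_deriveZ 2 (sD s))).
    apply: (continuous_pair cs); apply: (continuousM cs).
    exact: (is_derive1_continuous (is_deriveD (is_derive_cst (2 : R) s (1 : R))
      (is_derive1_atan s))).
  + move=> s sI; apply: (onI _ T1 X1) => // s'; rewrite /= in_itv /= => /andP[_].
    exact: c1'.
  + move=> s; rewrite in_itv /= => /andP[s1 s2].
    have sn : 0 < - s by move: s2 y0; lra.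
    rewrite c1f// (Psi_ext_fold PsiE sn) atanN opprK.
    apply: past_causal_L; last by move: sn; lra.
    by have /andP[a1 a2] := atan_lt2 s; lra.
exists (fun=> (- 1, - (2 - atan y))); split; first split.
- by apply: continuous_subspaceT => s; exact: cvg_cst.
- move=> s sI; apply: (onI _ T2 X2) => // s'; rewrite /= in_itv /= => /andP[+ _].
  exact: c2.
move=> s; rewrite in_itv /= => /andP[s1 s2].
rewrite c2f//.
have [_ ->] := Psi_ext_char PsiE y0 (T2le s s1).
have := @past_causal_L R (- atan y) (-1) (speed_gt0 y).
by rewrite mulN1r; apply; rewrite oppr_lt0.
Qed.

(** The bubble contains the open set of the points with foot in [(0, z)]. *)
Lemma explicit_causal_bubble z : 0 < z -> causal_bubble Om Phi (fold z).
Proof.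
move=> z0; pose V : set (R * R) := [set q | Om q /\ 0 < foot q < z].
have oV : open V.
  apply: open_boxes => q [qO /andP[f0 fz]].
  have e0 : 0 < Num.min (foot q) (z - foot q) by rewrite lt_min f0 subr_gt0.
  have [d d0 dP] := foot_near qO e0; exists d => // s x sq xq.
  have [sO] := dP s x sq xq; rewrite lt_min !ltr_norml => /andP[/andP[A _] /andP[_ B]].
  by split => //; apply/andP; split; [move: A|move: B];
    move: (foot (s, x)) (foot q) => a b; lra.
have V0 : V (0, z / 2).
  have [sO sE] := foot_slice (z / 2).
  by split; rewrite ?sE// divr_gt0//=; move: z0; lra.
suff VB : V `<=` causal_past Om Phi (fold z) `\` chronological_past Om Phi (fold z).
  by exists (0, z / 2); move: V0; rewrite (open_subsetE _ oV) in VB; exact: VB.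
move=> q [qO /andP[f0 fz]]; have [[A _] E] := footP qO; split.
  have := causal_past_below f0 fz A.
  by rewrite E -surjective_pairing.
move=> /(chronological_past_right z0); rewrite leNgt => /negP; apply.
rewrite -E; apply: char_map_lt => // r /andP[fr _]; apply: (lt_trans A).
by rewrite ltrD2l ltr_pXn2r ?nnegrE ?(ltW f0)// ltW// (lt_trans f0).
Qed.

End Pasts.

Theorem corollary1p3 (R : realType) (Omega_C : set (R * R))
    (Phi_C : R * R -> R)
    (hC : maximal_globally_hyperbolic_development Omega_C Phi_C)
    (p : R * R) (hp : singular_boundary p) :
  causal_bubble Omega_C Phi_C p.
Proof.
have cG : continuous (@log_speed R).
  by move=> y; exact: is_derive1_continuous (is_derive_log_speed y).
have [H [_ H']] := antiderivative cG.
have [ghd maximal] := hC.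
have sub q : Omega_C q -> explicit_domain q.
  by move=> /(development_sub_explicit ghd)[].
have OE : @explicit_domain R = Omega_C.
  apply: (maximal _ (explicit_potential H)) => //.
    exact: explicit_development.
  by move=> q Oq; rewrite (development_potential ghd H').
case: hp => z /= z0 <-.
have -> : (2 - atan z) * (1 + z ^+ 2) + z = char_map (1 + z ^+ 2) z.
  by rewrite /char_map mulrC addrC.
rewrite -OE; apply: (explicit_causal_bubble _ z0) => q qO.
by have [] := development_sub_explicit ghd (p := q); rewrite -?OE.
Qed.
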